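(* Let $\Gamma$ be a strongly regular graph with parameters $(99,14,1,2)$ and let $G=\mathrm{Aut}(\Gamma)$ be its full automorphism group. If $|G|$ is divisible by $7$, then $G\cong\mathbb Z_7$.
   Context: A strongly regular graph with parameters $(v,k,\lambda,\mu)$ is a simple $k$-regular graph on $v$ vertices in which any two adjacent vertices have exactly $\lambda$ common neighbors and any two distinct nonadjacent vertices have exactly $\mu$ common neighbors. Whether a graph with parameters $(99,14,1,2)$ exists is not known; the statement concerns any such graph. *)

(* Defs.v *)
From mathcomp Require Import all_boot all_fingroup all_algebra.

Set Implicit Arguments.
Unset Strict Implicit.
Unset Printing Implicit Defensive.

(* A simple graph is given by its adjacency relation [e : rel T], required to
   be symmetric and irreflexive, on a finite vertex type [T]. *)

Definition nbhd (T : finType) (e : rel T) (x : T) : {set T} :=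
  [set y | e x y].

Record strongly_regular (T : finType) (e : rel T) (v k lam mu : nat) : Prop :=
  StronglyRegular {
    srg_sym : symmetric e;
    srg_irr : irreflexive e;
    srg_card : #|T| = v;
    srg_reg : forall x : T, #|nbhd e x| = k;
    srg_adj : forall x y : T, e x y -> #|nbhd e x :&: nbhd e y| = lam;
    srg_nadj : forall x y : T,
      x != y -> ~~ e x y -> #|nbhd e x :&: nbhd e y| = mu }.

Definition graph_aut (T : finType) (e : rel T) : {set {perm T}} :=
  [set s : {perm T} | [forall x, forall y, e (s x) (s y) == e x y]].

Lemma graph_autP (T : finType) (e : rel T) (s : {perm T}) :
  reflect (forall x y, e (s x) (s y) = e x y) (s \in graph_aut e).
Proof.
rewrite inE; apply: (iffP forallP) => [H x y | H x].
  exact/eqP/(forallP (H x)).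
by apply/forallP => y; apply/eqP.
Qed.

Lemma graph_aut_group_set (T : finType) (e : rel T) :
  group_set (graph_aut e).
Proof.
apply/group_setP; split=> [|s t /graph_autP Hs /graph_autP Ht].
  by apply/graph_autP => x y; rewrite !perm1.
by apply/graph_autP => x y; rewrite !permM Ht Hs.
Qed.

Canonical graph_aut_group (T : finType) (e : rel T) : {group {perm T}} :=
  Group (graph_aut_group_set e).

(* Main.v *)
(** Let [s] be an automorphism of order 7. It fixes a unique vertex [x] and permutes cyclically two
    heptads of neighbours of [x], interchanged by the map sending [u] to the third vertex of the
    triangle on [x] and [u]. The remaining 84 vertices correspond to the pairs of nonadjacent
    neighbours of [x], their common neighbours with [x]. Hence an automorphism fixing [x] is known
    from its action on the two heptads, and one that normalizes <[s]> acts there, up to a power of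
    [s], as [i |-> r i] in Z/7, possibly with an interchange of the heptads. None of these is an
    automorphism except the identity: [r = 2, 4] leads to a Frobenius group of order 21, whose
    possible orbit neighbourhoods are enumerated; [r = 3, 5, 6] leads to an involution whose fixed
    points violate a congruence mod 7 on traces; an interchange commuting with [s] leads to a 6 x 6
    quotient matrix that does not exist. So <[s]> is its own normalizer.

    If <[s]> were a proper subgroup, it would be a Frobenius complement, and the kernel would
    contain a nontrivial [s]-invariant Sylow subgroup [P] on which [s] acts freely. An [s]-invariant
    subgroup fixing [x] on which [s] acts freely can only interchange vertices [u] and [mate x u]
    and is ruled out by counting fixed points, so [P] is regular on the orbit of [x]. Thus
    [#|P| <= 99] and [#|P| = 1 %[mod 7]]. A prime larger than 14 is excluded since [P] would fix a
    vertex and its neighbours, and for the prime 2 there is an [s]-invariant subgroup of order 8,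
    whose fixed points would span a strongly regular graph with parameters (7, d, 1, 2). *)

Require Import Defs.
From mathcomp Require Import all_boot all_fingroup all_solvable all_order all_algebra.
From mathcomp Require vcharacter.
From mathcomp Require Import zify ring lra.

Set Implicit Arguments.
Unset Strict Implicit.
Unset Printing Implicit Defensive.
Import GRing.Theory Num.Theory.

(** * Neighbourhoods in the graph *)

(** All divisibility comes from one fact. Let M be 7 times the orthogonal projection on the
    eigenspace of eigenvalue 3; for a group H of automorphisms, the sum of tr (M h) over h in H is 7
    |H| times the dimension of the H-invariants in that eigenspace. For |H| = 7, the number of
    vertices adjacent to one of their own translates under <[s]> is thus a multiple of 49. If a
    group of order 14 or 21 containing <[s]> preserves this set, it is a union of regular orbits
    among the 84 vertices far from x; its size is at most 84 and also a multiple of 14 or 21, so it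
    is empty. For |H| = 2, one gets a congruence mod 7 on the degrees in the subgraph of fixed
    points. For order 21, this emptiness and a count leave a vertex joined to two elements of one
    heptad exactly two neighbours in its own orbit, its translates by an element of order 3 and by
    the inverse; the enumeration starts from these. One list of candidates serves both heptads, and
    the contradiction comes from the common neighbours of a vertex of one kind with the translates
    of a vertex of the other. *)

Section Srg.
Variables (T : finType) (e : rel T).
Hypothesis srg : strongly_regular e 99 14 1 2.
Implicit Types (u v w x y z : T) (s t : {perm T}).
Local Notation N := (nbhd e).
Local Notation Aut := (graph_aut e).

Lemma adjC u v : e u v = e v u. Proof. exact: (srg_sym srg). Qed.
Lemma adj_irr u : e u u = false. Proof. exact: (srg_irr srg). Qed.
Lemma adj_neq u v : e u v -> u != v.
Proof. by apply: contraTneq => ->; rewrite adj_irr. Qed.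

(** Entrywise form of A^2 + A = 2 J + 12 I for the adjacency matrix A; keeping A on the left avoids
    truncated subtraction. *)
Lemma common_nbrs u v : #|N u :&: N v| + e u v = 2 + 12 * (u == v).
Proof.
case: eqVneq => [->|uv]; first by rewrite setIid (srg_reg srg) adj_irr.
by case: (boolP (e u v)) => uvE; rewrite ?(srg_adj srg uvE) ?(srg_nadj srg uv uvE).
Qed.

Lemma common_le2 u v : u != v -> #|N u :&: N v| <= 2.
Proof.
by move=> uv; apply: leq_trans (leq_addr (e u v) _) _; rewrite common_nbrs (negPf uv).
Qed.

Lemma no_three_common u v w1 w2 w3 : u != v -> uniq [:: w1; w2; w3] ->
  e u w1 -> e v w1 -> e u w2 -> e v w2 -> e u w3 -> e v w3 -> False.
Proof.
move=> uv un u1 v1 u2 v2 u3 v3; have := common_le2 uv; rewrite leqNgt => /negP[].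
apply: (leq_trans (n := #|[set w in [:: w1; w2; w3]]|)).
  by rewrite cardsE (card_uniqP un).
by apply/subset_leq_card/subsetP=> w; rewrite !inE => /or3P[]/eqP->; apply/andP.
Qed.

Lemma triangle_uniq u v w1 w2 : e u v -> e u w1 -> e v w1 -> e u w2 -> e v w2 -> w1 = w2.
Proof.
move=> uv u1 v1 u2 v2; have /eqP/cards1P[w E] := srg_adj srg uv.
have : w1 \in N u :&: N v by rewrite !inE u1.
have : w2 \in N u :&: N v by rewrite !inE u2.
by rewrite E !inE => /eqP-> /eqP->.
Qed.

Lemma autE s : s \in Aut -> forall u v, e (s u) (s v) = e u v.
Proof. by move/graph_autP. Qed.

Definition mate x u := odflt x [pick v in N x :&: N u].

Lemma mateP x u : e x u -> e x (mate x u) && e u (mate x u).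
Proof.
move=> xu; rewrite /mate; case: pickP => [v|/eq_card0]; first by rewrite !inE.
by rewrite (srg_adj srg xu).
Qed.

Lemma mate_eq x u v : e x u -> e x v -> e u v -> mate x u = v.
Proof.
by move=> xu xv uv; have /andP[] := mateP xu; move=> ? ?; apply: triangle_uniq xu _ _ _ _.
Qed.

Lemma mateK x u : e x u -> mate x (mate x u) = u.
Proof. by move=> xu; have /andP[xm um] := mateP xu; apply: mate_eq; rewrite // adjC. Qed.

Lemma aut_mate s x u : s \in Aut -> e x u -> s (mate x u) = mate (s x) (s u).
Proof.
by move=> sA xu; apply/esym/mate_eq; rewrite autE //; case/andP: (mateP xu).
Qed.

Definition join x u v := odflt x [pick w in N u :&: N v :\ x].

Section Join.
Variables x u v : T.
Hypotheses (xu : e x u) (xv : e x v) (uv : u != v) (uvE : ~~ e u v).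

Lemma joinE : N u :&: N v = [set x; join x u v] /\ join x u v != x.
Proof.
have c2 : #|N u :&: N v| = 2 by exact: (srg_nadj srg uv uvE).
have xI : x \in N u :&: N v by rewrite !inE adjC xu adjC xv.
have := cardsD1 x (N u :&: N v); rewrite xI c2 add1n => -[/esym c1].
rewrite /join; case: pickP => [w|/eq_card0]; last by rewrite c1.
rewrite inE in_set1 /= => /andP[wx wI]; split=> //; apply/esym/eqP.
rewrite eqEcard cards2 eq_sym wx c2 andbT.
by apply/subsetP=> z; rewrite in_set2 => /orP[]/eqP->.
Qed.

Lemma join_adjl : e u (join x u v).
Proof.
have [E _] := joinE; have : join x u v \in N u :&: N v by rewrite E in_set2 eqxx orbT.
by rewrite !inE => /andP[].
Qed.

Lemma join_adjr : e v (join x u v).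
Proof.
have [E _] := joinE; have : join x u v \in N u :&: N v by rewrite E in_set2 eqxx orbT.
by rewrite !inE => /andP[].
Qed.

Lemma join_neq : join x u v != x. Proof. by case: joinE. Qed.

Lemma join_nadj : ~~ e x (join x u v).
Proof.
apply/negP=> xj; move/eqP: uv; apply.
by apply: (triangle_uniq xj); rewrite // adjC ?join_adjl ?join_adjr.
Qed.

Lemma join_eq w : e u w -> e v w -> w != x -> w = join x u v.
Proof.
move=> uw vw wx; have [E _] := joinE; have : w \in N u :&: N v by rewrite !inE uw.
by rewrite E in_set2 (negPf wx) => /eqP.
Qed.

(** The join is at distance two from [x], hence has only two neighbours in [N x], and [u], [v] are
    two such. This is why the unordered pair can be recovered from the join. *)
Lemma join_nbrs w : e x w -> e w (join x u v) = (w == u) || (w == v).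
Proof.
move=> xw; have jx : x != join x u v by rewrite eq_sym join_neq.
have c2 : #|N x :&: N (join x u v)| = 2 by exact: (srg_nadj srg jx join_nadj).
suff E : N x :&: N (join x u v) = [set u; v].
  have : (w \in N x :&: N (join x u v)) = (w \in [set u; v]) by rewrite E.
  by rewrite !inE xw [e w _]adjC.
apply/esym/eqP; rewrite eqEcard cards2 uv c2 andbT.
apply/subsetP=> z; rewrite in_set2 !inE => /orP[]/eqP->.
  by rewrite xu adjC join_adjl.
by rewrite xv adjC join_adjr.
Qed.
End Join.

Lemma joinC x u v : join x u v = join x v u.
Proof. by rewrite /join setIC. Qed.

Lemma aut_join s x u v : s \in Aut -> e x u -> e x v -> u != v -> ~~ e u v ->
  s (join x u v) = join (s x) (s u) (s v).
Proof.
move=> sA xu xv uv uvE; apply: join_eq; rewrite ?autE ?(inj_eq perm_inj) //.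
- exact: join_adjl.
- exact: join_adjr.
exact: join_neq.
Qed.

Lemma ex_join x z : z != x -> ~~ e x z ->
  exists u v, [/\ e x u, e x v, u != v, ~~ e u v & z = join x u v].
Proof.
rewrite eq_sym => xz xzE; have /eqP/cards2P[u [v [uv E]]] := srg_nadj srg xz xzE.
have : u \in N x :&: N z by rewrite E in_set2 eqxx.
have : v \in N x :&: N z by rewrite E in_set2 eqxx orbT.
rewrite !inE => /andP[xv zv] /andP[xu zu]; exists u, v.
have uvE : ~~ e u v.
  apply: contra xz => uvE; apply/eqP; apply: (triangle_uniq uvE); by rewrite adjC.
split=> //; apply: (@join_eq x u v _ _ uv uvE); rewrite 1?eq_sym //; by rewrite adjC.
Qed.

Lemma aut_fix_nbhd s x : s \in Aut -> s x = x -> (forall u, e x u -> s u = u) -> s = 1%g.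
Proof.
move=> sA sx su; apply/permP=> z; rewrite perm1.
have [->//|zx] := eqVneq z x; have [/su//|xz] := boolP (e x z).
have [u [v [xu xv uv uvE ->]]] := ex_join zx xz.
by rewrite aut_join // sx !su.
Qed.

End Srg.

(** * Traces on the eigenspace of eigenvalue 3 *)

Section Trace.
Local Open Scope ring_scope.

(** Factor M = C R through its rank. Cancelling C on the left and R on the right in C (R C) R = c C
    R gives R C = c I, a matrix of size the rank of M with the same trace as M. *)
Lemma mxtrace_quasi_idem (F : fieldType) n (M : 'M[F]_n) (c : F) :
  c != 0 -> M *m M = c *: M -> \tr M = c *+ \rank M.
Proof.
move=> c0 MM; set C := col_base M; set R := row_base M.
have CR : C *m R = M by exact: mulmx_base.
have RC : R *m C = c%:M.
  apply: (row_full_inj (col_base_full M)); apply: (row_free_inj (row_base_free M)).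
  rewrite -/C -/R; have -> : C *m (R *m C) *m R = (C *m R) *m (C *m R) by rewrite !mulmxA.
  by rewrite CR MM mul_mx_scalar -scalemxAl CR.
by rewrite -[in LHS]CR mxtrace_mulC RC mxtrace_scalar.
Qed.

Section Kernels.
Variable T : finType.
Definition kmx (f : T -> T -> rat) : 'M[rat]_#|T| :=
  \matrix_(i, j) f (enum_val i) (enum_val j).

Lemma sum_enum_val (f : T -> rat) : \sum_(i < #|T|) f (enum_val i) = \sum_u f u.
Proof. by rewrite -big_enum_val. Qed.

Lemma mulmx_kmx f g : kmx f *m kmx g = kmx (fun u v => \sum_w f u w * g w v).
Proof.
apply/matrixP=> i j; rewrite !mxE -(sum_enum_val (fun w => f _ w * g w _)).
by apply: eq_bigr => k _; rewrite !mxE.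
Qed.

Lemma trace_kmx f : \tr (kmx f) = \sum_u f u u.
Proof. by rewrite -sum_enum_val; apply: eq_bigr => i _; rewrite mxE. Qed.
End Kernels.
End Trace.

Section Srg.
Variables (T : finType) (e : rel T).
Hypothesis srg : strongly_regular e 99 14 1 2.
Implicit Types (u v w x y z : T) (s t : {perm T}).
Local Notation N := (nbhd e).
Local Notation Aut := (graph_aut e).

Definition nfix s := #|[set z | s z == z]|.
Definition nshift s := #|[set z | e z (s z)]|.

Section TraceCount.
Local Open Scope ring_scope.

(* The adjacency matrix has eigenvalues 14, 3 and -4; this is 7 times the orthogonal projection on
   the eigenspace of 3, and 2 / 11 = (14 + 4) / 99. *)
Definition eig u v : rat := (e u v)%:R + 4%:R * (u == v)%:R - 2%:R / 11%:R.

Lemma sum_delta (f : T -> rat) v : \sum_w f w * (w == v)%:R = f v.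
Proof.
rewrite (bigD1 v) //= eqxx mulr1 big1 ?addr0 // => w /negPf ->.
by rewrite mulr0.
Qed.

Lemma sum_adj u : \sum_w (e u w)%:R = 14%:R :> rat.
Proof.
rewrite -(srg_reg srg u) -sum1_card natr_sum [RHS]big_mkcond.
by apply: eq_bigr => w _; rewrite inE; case: (e u w).
Qed.

(** The matrix A + 4 I - (2/11) J acts as 7 on the eigenspace of 3 and as 0 on those of -4 and 14.
    The computation uses A^2 = 2 J + 12 I - A and A J = 14 J. *)
Lemma eig_sq u v : \sum_w eig u w * eig w v = 7%:R * eig u v.
Proof.
have aa : \sum_w (e u w)%:R * (e w v)%:R = 2%:R + 12%:R * (u == v)%:R - (e u v)%:R :> rat.
  have : #|N u :&: N v|%:R + (e u v)%:R = 2%:R + 12%:R * (u == v)%:R :> rat.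
    by rewrite -natrD common_nbrs // natrD natrM.
  move=> /(canRL (addrK _)) <-.
  rewrite -sum1_card natr_sum [RHS]big_mkcond; apply: eq_bigr => w _.
  by rewrite !inE [e v w]adjC; case: (e u w); case: (e w v); rewrite ?mulr1 ?mul0r ?mulr0.
pose c : rat := 2%:R / 11%:R.
pose d u v : rat := (u == v)%:R.
have dC u' v' : d u' v' = d v' u' by rewrite /d eq_sym.
have d1 u' : \sum_w d w u' = 1.
  by rewrite -[RHS](sum_delta (fun=> 1) u'); apply: eq_bigr => w _; rewrite mul1r.
transitivity (\sum_w ((e u w)%:R * (e w v)%:R + 4%:R * ((e u w)%:R * d w v)
    + 4%:R * ((e w v)%:R * d w u) + 16%:R * (d w u * d w v) - c * (e u w)%:R - 4%:R * c * d w u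
    - c * (e v w)%:R - 4%:R * c * d w v + c * c)).
  by apply: eq_bigr => w _; rewrite /eig -/c -/(d u w) -/(d w v) (dC u w) [e v w]adjC //; ring.
rewrite big_split 4!sumrB 3!big_split /= -!mulr_sumr aa !d1 !sum_adj !(sum_delta _ u, sum_delta _ v).
rewrite sumr_const (srg_card srg) /eig -mulr_natr dC -/(d u v) /c.
by field.
Qed.

(* [r] is the dimension of the space of H-invariants in that eigenspace. *)
Lemma trace_count (H : {group {perm T}}) : H \subset Aut ->
  exists r : nat, (\sum_(h in H) (nshift h + 4 * nfix h) = #|H| * (18 + 7 * r))%N.
Proof.
move=> HA; pose F u v := \sum_(h in H) eig u ((h : {perm T}) v).
have eigA (h : {perm T}) u v : h \in H -> eig (h u) (h v) = eig u v.
  by move=> /(subsetP HA) hA; rewrite /eig autE // (inj_eq perm_inj).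
(* [F] is the sum of the products of [eig] with the permutation matrices of H. Since [eig] is
   H-invariant, the product of the terms for h and k is 7 times a single term, and for each h these
   run over all of [F] as k varies. *)
have FF : kmx F *m kmx F = (7 * #|H|)%:R *: kmx F.
  rewrite mulmx_kmx; apply/matrixP=> i j; rewrite !mxE.
  move: (enum_val i) (enum_val j) => {i j} u v.
  transitivity (\sum_(h in H) \sum_(k in H) \sum_w eig u ((h : {perm T}) w) * eig w ((k : {perm T}) v)).
    under [RHS]eq_bigr do rewrite exchange_big.
    by rewrite [RHS]exchange_big; apply: eq_bigr => w _; rewrite big_distrlr.
  transitivity (\sum_(h in H) 7%:R * F u v); last first.
    by rewrite sumr_const natrM mulr_natr -mulrnAl -mulr_natr.
  apply: eq_bigr => h hH.
  rewrite /F [in RHS](reindex_inj (mulIg h)) mulr_sumr.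
  apply: eq_big => k; rewrite ?groupMr // => kH.
  rewrite -eig_sq [RHS](reindex_inj (@perm_inj _ h)); apply: eq_bigr => w _.
  by rewrite permM (eigA h).
have c0 : (7 * #|H|)%:R != 0 :> rat.
  by rewrite pnatr_eq0 -lt0n muln_gt0 cardG_gt0.
have := mxtrace_quasi_idem c0 FF; set r := \rank _ => E; exists r.
apply/eqP; rewrite -(eqr_nat rat); apply/eqP.
rewrite natr_sum mulnDr natrD mulnA [(#|H| * 7)%N]mulnC [X in _ = _ + X]natrM.
rewrite [X in _ = _ + X]mulr_natr -E trace_kmx /F exchange_big natrM mulr_natl -sumr_const.
rewrite -big_split; apply: eq_bigr => h _ /=.
(* The constant 2 / 11 summed over the 99 vertices is the 18 of the statement. *)
rewrite /eig !big_split /= -mulr_sumr sumr_const (srg_card srg) natrD natrM.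
have -> : (nshift h)%:R = \sum_u (e u (h u))%:R :> rat.
  rewrite /nshift -sum1_card natr_sum big_mkcond; apply: eq_bigr => u _.
  by rewrite inE; case: (e u _).
have -> : (nfix h)%:R = \sum_u (u == h u)%:R :> rat.
  rewrite /nfix -sum1_card natr_sum big_mkcond; apply: eq_bigr => u _.
  by rewrite inE eq_sym; case: (u == _).
by rewrite -mulr_natr; field.
Qed.
End TraceCount.
End Srg.

(** * Fixed points of an involution *)

(* [(x - c) (x - c - 1) >= 0], without subtraction. *)
Lemma consecutive_gap c x : (2 * c + 1) * x <= x ^ 2 + c * (c + 1).
Proof.
rewrite -mulnn; case: (leqP x c) => [/subnKC <-|/subnKC <-]; last by nia.
by move: (c - x) => k; nia.
Qed.

Section Invol.
Variables (T : finType) (e : rel T).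
Hypothesis srg : strongly_regular e 99 14 1 2.
Implicit Types (u v w x y z : T) (s t : {perm T}).
Local Notation N := (nbhd e).
Local Notation Aut := (graph_aut e).

Variable t : {perm T}.
Hypotheses (tA : t \in Aut) (tt : (t * t = 1)%g).

Definition fixset := [set z | t z == z].
Definition nfn v := #|N v :&: fixset|.
Local Notation Phi := fixset.
Local Notation d := nfn.

Lemma tK : involutive t.
Proof. by move=> v; rewrite -permM tt perm1. Qed.

Lemma nfn_common v : N v :&: Phi \subset N v :&: N (t v).
Proof.
apply/subsetP=> w; rewrite !inE => /andP[vw /eqP tw]; rewrite vw -tw.
by rewrite (autE tA).
Qed.

Lemma nfn_le2 v : v \notin Phi -> d v <= 2.
Proof.
rewrite inE eq_sym => vt; apply: leq_trans (common_le2 srg vt).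
exact/subset_leq_card/nfn_common.
Qed.

Lemma common_tstable v w : w \in N v :&: N (t v) -> t w \in N v :&: N (t v).
Proof.
by rewrite !inE (autE tA) => /andP[vw tvw]; rewrite vw andbT -[v]tK (autE tA).
Qed.

(** [t] acts on the common neighbours of [v] and [t v], and the fixed ones among them are exactly
    the fixed neighbours of [v]. If [v] and [t v] are adjacent there is one common neighbour, so it
    is fixed; if they are distinct and nonadjacent there are two, and an involution cannot fix
    exactly one of them. *)
Lemma nshiftE v : e v (t v) = (v \notin Phi) && (d v == 1).
Proof.
rewrite inE; case: eqVneq => [->|tv] /=; first exact: adj_irr.
rewrite eq_sym in tv; apply/idP/eqP => [vE|d1].
  apply/eqP; rewrite -(srg_adj srg vE); apply/eqP; congr #|pred_of_set _|.
  apply/eqP; rewrite eqEsubset nfn_common; apply/subsetP=> w wI.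
  have /andP[vw tvw] : e v w && e (t v) w by move: wI; rewrite !inE.
  have := common_tstable wI; rewrite !inE vw => /andP[vtw tvtw].
  by apply/eqP/(triangle_uniq srg vE).
apply: contraT => vE; have c2 := srg_nadj srg tv vE.
have /eqP/cards1P[w E] := d1.
have wI : w \in N v :&: N (t v) by apply: (subsetP (nfn_common v)); rewrite E inE.
have tw : t w = w by have := set11 w; rewrite -E !inE => /andP[_ /eqP].
have := cardsD1 w (N v :&: N (t v)); rewrite wI c2 => -[/esym/eqP/cards1P[w' E']].
have := set11 w'; rewrite -E' inE in_set1 => /andP[w'w w'I].
have := common_tstable w'I => tw'I.
have : t w' \in N v :&: N (t v) :\ w.
  by rewrite inE in_set1 tw'I andbT -{1}tw (inj_eq perm_inj).
rewrite E' in_set1 => tw'.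
have : w' \in N v :&: Phi by move: w'I; rewrite !inE tw' => /andP[->].
by rewrite E in_set1 (negPf w'w).
Qed.

Definition fix_degree_sum := \sum_(z in Phi) d z.
Definition fix_degree_sq_sum := \sum_(z in Phi) d z ^ 2.
Local Notation n := #|Phi|.

Lemma sum_nfn : \sum_v d v = 14 * n.
Proof.
transitivity (\sum_(z in Phi) \sum_v e v z).
  rewrite exchange_big; apply: eq_bigr => v _; rewrite /d -sum1_card [LHS]big_mkcond.
  rewrite [RHS]big_mkcond; apply: eq_bigr => w _; rewrite !inE.
  by case: (e v w); case: (t w == w).
rewrite mulnC -sum_nat_const; apply: eq_bigr => z _.
rewrite -(srg_reg srg z) -sum1_card [RHS]big_mkcond; apply: eq_bigr => v _.
by rewrite inE adjC //; case: (e z v).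
Qed.

(** Count the triples of a vertex and two fixed neighbours of it: for given fixed vertices the
    number of middle vertices is [common_nbrs]. *)
Lemma sum_nfn_sq : \sum_v d v ^ 2 + fix_degree_sum = 2 * n ^ 2 + 12 * n.
Proof.
have -> : \sum_v d v ^ 2 = \sum_(z in Phi) \sum_(z' in Phi) #|N z :&: N z'|.
  transitivity (\sum_v \sum_(z in Phi) \sum_(z' in Phi) (e v z && e v z')).
    apply: eq_bigr => v _; rewrite -mulnn.
    have -> : d v = \sum_(z in Phi) e v z.
      rewrite /d -sum1_card [LHS]big_mkcond [RHS]big_mkcond.
      by apply: eq_bigr => w _; rewrite !inE; case: (e v w); case: (t w == w).
    by rewrite big_distrlr; apply: eq_bigr => z _; apply: eq_bigr => z' _; case: (e v z); case: (e v z').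
  rewrite exchange_big; apply: eq_bigr => z _; rewrite exchange_big.
  apply: eq_bigr => z' _; rewrite -sum1_card [RHS]big_mkcond; apply: eq_bigr => v _.
  by rewrite !inE [e v z]adjC // [e v z']adjC //; case: (_ && _).
rewrite /fix_degree_sum -big_split /=.
have -> : 2 * n ^ 2 + 12 * n = \sum_(z in Phi) (2 * n + 12).
  by rewrite sum_nat_const mulnDr mulnCA mulnn [12 * _]mulnC.
apply: eq_bigr => z zP.
have -> : d z = \sum_(z' in Phi) e z z'.
  rewrite /d -sum1_card [LHS]big_mkcond [RHS]big_mkcond.
  by apply: eq_bigr => w _; rewrite !inE; case: (e z w); case: (t w == w).
rewrite -big_split /=.
transitivity (\sum_(z' in Phi) (2 + 12 * (z == z'))).
  by apply: eq_bigr => z' _; apply: common_nbrs.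
rewrite big_split /= sum_nat_const mulnC -big_distrr (bigD1 z) //= eqxx big1.
  by [].
by move=> w /andP[_]; rewrite eq_sym => /negPf ->.
Qed.

Lemma card_nPhi : #|~: Phi| + n = 99.
Proof. by rewrite addnC cardsC (srg_card srg). Qed.

Lemma sum_out (f : T -> nat) : \sum_v f v = \sum_(v in Phi) f v + \sum_(v in ~: Phi) f v.
Proof.
rewrite (bigID (mem Phi)) /=; congr (_ + _).
by apply: eq_bigl => v; rewrite in_setC.
Qed.

Lemma nshift_count : nshift e t + 2 * n ^ 2 + fix_degree_sum = 16 * n + fix_degree_sq_sum.
Proof.
(* For d = 0, 1, 2 the indicator of d = 1 equals 2 d - d^2. *)
have E : nshift e t + \sum_(v in ~: Phi) d v ^ 2 = \sum_(v in ~: Phi) 2 * d v.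
  have -> : nshift e t = \sum_(v in ~: Phi) (d v == 1).
    rewrite /nshift -sum1_card [LHS]big_mkcond [RHS]big_mkcond; apply: eq_bigr => v _.
    by rewrite !inE nshiftE inE; case: (t v == v); case: (d v == 1).
  rewrite -big_split; apply: eq_bigr => v; rewrite in_setC => /nfn_le2.
  by case: (d v) => [|[|[|]]].
have := sum_nfn_sq; have := sum_nfn; rewrite !sum_out -/fix_degree_sum -/fix_degree_sq_sum.
rewrite -big_distrr /= in E.
by lia.
Qed.

(** Outside the fixed set d is 0, 1 or 2, so d^2 <= d + 2 and 3 d <= d^2 + 2. On the fixed set, (d -
    c) (d - c - 1) >= 0 for c = 5 and c = 10 bounds the sum of squares from below. With the values
    of the sums of d and d^2 over all vertices these inequalities exclude the interval. *)
Lemma nfix_gap : ~~ (19 <= n <= 91).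
Proof.
have D1 : \sum_(v in ~: Phi) d v ^ 2 <= \sum_(v in ~: Phi) d v + 2 * #|~: Phi|.
  rewrite [2 * _]mulnC -sum_nat_const -big_split; apply: leq_sum => v; rewrite in_setC => /nfn_le2.
  by case: (d v) => [|[|[|]]].
have D2 : 3 * \sum_(v in ~: Phi) d v <= \sum_(v in ~: Phi) d v ^ 2 + 2 * #|~: Phi|.
  rewrite [2 * _]mulnC -sum_nat_const -big_split big_distrr /=; apply: leq_sum => v; rewrite in_setC => /nfn_le2.
  by case: (d v) => [|[|[|]]].
have D3 c : (2 * c + 1) * fix_degree_sum <= fix_degree_sq_sum + c * (c + 1) * n.
  rewrite [_ * n]mulnC -sum_nat_const -big_split big_distrr; apply: leq_sum => v _ /=.
  exact: consecutive_gap.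
have := card_nPhi; have := sum_nfn_sq; have := sum_nfn; rewrite !sum_out -/fix_degree_sum -/fix_degree_sq_sum.
move: (D3 5) (D3 10) D1 D2.
move: (\sum_(v in ~: Phi) d v) (\sum_(v in ~: Phi) d v ^ 2) fix_degree_sum fix_degree_sq_sum #|~: Phi| => A B g1 g2 m.
move=> h1 h2 h3 h4 h5 h6 h7; apply/negP=> h8.
nia.
Qed.

(** [trace_count] for the group of order 2 and [nshift_count] both involve [nshift e t]; eliminating
    it leaves a condition on the subgraph of fixed points alone. *)
Lemma fix_trace : t != 1%g -> fix_degree_sq_sum + 6 * n = fix_degree_sum + 2 * n ^ 2 + 4 %[mod 7].
Proof.
move=> t1.
have sub : (<[t]> \subset Aut)%g by rewrite cycle_subG.
have o2 : #[t]%g = 2.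
  have : (#[t] %| 2)%g by rewrite order_dvdn expgS expg1 tt.
  by rewrite dvdn_divisors // !inE => /orP[]/eqP => [/eqP|//]; rewrite order_eq1 (negPf t1).
have [r] := trace_count srg (H := <[t]>%G) sub.
rewrite /= [#|<[t]>%g|]o2 (cycle2g o2) big_setU1 ?inE 1?eq_sym // big_set1.
have -> : nshift e 1 = 0.
  by apply: eq_card0 => z; rewrite !inE perm1 adj_irr.
have -> : nfix (1 : {perm T})%g = 99.
  rewrite /nfix -(srg_card srg) -[RHS]cardsT; congr #|pred_of_set _|.
  by apply/setP=> z; rewrite !inE perm1 eqxx.
rewrite -[nfix t]/n => H; have := nshift_count; move: H.
move: (nshift e t) fix_degree_sum fix_degree_sq_sum n => a g1 g2 m H1 H2.
have {}H1 : 396 + (a + 4 * m) = 2 * (18 + 7 * r) := H1.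
(* The elimination produces 20 m + 360 on the left, and 360 = 7 * 52 - 4. *)
have H : g2 + 6 * m + 7 * (52 + 2 * m) = g1 + 2 * m ^ 2 + 4 + 7 * (2 * r).
  by lia.
by rewrite -[LHS](modnMDl (52 + 2 * m)) -[RHS](modnMDl (2 * r)); congr (_ %% 7); lia.
Qed.
End Invol.

(** * Enumeration of the neighbourhoods for a group of order 21 *)

(* [k = 7 j + c], with [j < 3] and [c < 7], encodes the affine map [z |-> 2^j z + c] of Z/7. *)
Definition pow2 j := nth 0 [:: 1; 2; 4] j.
Definition aff_mul (k l : nat) : nat :=
  7 * ((k %/ 7 + l %/ 7) %% 3) + (pow2 (k %/ 7) * (l %% 7) + k %% 7) %% 7.
Definition aff_inv (k : nat) : nat :=
  nth 0 [seq l <- iota 0 21 | aff_mul k l == 0] 0.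
(* [class_rep d], for [d < 10], are representatives of the classes {k, k^-1} of nontrivial maps. *)
Definition class_rep (d : nat) : nat := nth 0 [:: 1; 2; 3; 7; 8; 9; 10; 11; 12; 13] d.
Definition aff_class k := find (fun d => (class_rep d == k) || (aff_inv (class_rep d) == k)) (iota 0 10).
Definition diff_class_tab := Eval vm_compute in
  mkseq (fun k => mkseq (fun l => aff_class (aff_mul k (aff_inv l))) 21) 21.
Definition diff_class k l := nth 10 (nth [::] diff_class_tab k) l.

(* The point [p < 14] stands for the element [p %% 7] of the heptad [p %/ 7] of neighbours of x, and
   the cell [(o, k)] for the vertex whose common neighbours with x are the images under [k] of the
   elements 0 and 1 of the heptads given by [orbit_sides o]. *)
Definition cell := (nat * nat)%type.
Definition orbit_sides (o : nat) : nat * nat := nth (0,0) [:: (0,0); (1,1); (0,1); (1,0)] o.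
Definition ends_of (v : cell) : nat * nat :=
  let: (o,k) := v in
  (7 * (orbit_sides o).1 + k %% 7, 7 * (orbit_sides o).2 + (k %% 7 + pow2 (k %/ 7)) %% 7).
Definition ends_tab := Eval vm_compute in mkseq (fun o => mkseq (fun k => ends_of (o,k)) 21) 4.
Definition ends (v : cell) := nth (14,14) (nth [::] ends_tab v.1) v.2.
Definition is_end p (v : cell) := let: (a,b) := ends v in if eqn a p then true else eqn b p.

(* Number of cells adjacent to both the base cell (0, 0) and the point [p]. *)
Definition need0 p := if p \in [:: 0; 1; 7; 8] then 1 else 2.
Definition need R p := need0 p - count (is_end p) R.
Definition pairs d := fix F (R : seq cell) := if R is v :: R' then
  count (fun w => if eqn v.1 w.1 then eqn (diff_class v.2 w.2) d else false) R' + F R' else 0.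
(* Number of common neighbours that the base cell and its translate by [class_rep d] may still have
   among the cells; [tc] is the class of the translates of the base cell adjacent to it. *)
Definition quota0 (tc : nat) d := nth 0 [:: 1; 2; 2; 1; 1; 2; 2; 2; 1; 1] d - (d == tc).
Definition quota tc R d := quota0 tc d - pairs d R.

Definition admissible (nd ls : seq nat) (R : seq cell) (u : cell) :=
  let: (a,b) := ends u in
  if nth 0 nd a is 0 then false else if nth 0 nd b is 0 then false else
  (fix F R := if R is w :: R' then
     if eqn u.1 w.1 then if nth 0 ls (diff_class u.2 w.2) is 0 then false else F R' else F R'
   else true) R.

Definition weight n k := if n == 1 then k else (k * k.-1)./2.
(* The point [p] with the fewest ways to complete its set of neighbours, by the crude estimate
   [weight]. *)
Fixpoint best_point nd av p best : option (nat * nat) :=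
  if nd is n :: nd' then
    let best' := if n is 0 then best else
       let k := weight n (count (is_end p) av) in
       if best is Some (k', _) then if k < k' then Some (k, p) else best else Some (k,p) in
    best_point nd' av p.+1 best'
  else best.

(** An option already treated is not passed on to the later ones, so each set of cells is built in
    one order only. *)
Fixpoint branch A (f : cell -> seq cell -> seq A) opts rest :=
  if opts is v :: o then f v (o ++ rest) ++ branch f o rest else [::].

(** [R] is returned when all needs are met, but also when the depth [n] runs out; [incompatible]
    checks afterwards that every list returned has 12 cells, so that it is a whole neighbourhood. *)
Fixpoint search tc n R av : seq (seq cell) :=
  if n is n'.+1 then
    let nd := mkseq (need R) 14 in
    let ls := mkseq (quota tc R) 10 in
    let av' := filter (admissible nd ls R) av in
    if best_point nd av' 0 None is Some (_, p) then
      branch (fun v rest => search tc n' (v :: R) rest)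
        (filter (is_end p) av') (filter (fun v => ~~ is_end p v) av')
    else [:: R]
  else [:: R].

Lemma searchS tc n R av : search tc n.+1 R av =
  let nd := mkseq (need R) 14 in
  let ls := mkseq (quota tc R) 10 in
  let av' := filter (admissible nd ls R) av in
  if best_point nd av' 0 None is Some (_, p) then
    branch (fun v rest => search tc n (v :: R) rest)
      (filter (is_end p) av') (filter (fun v => ~~ is_end p v) av')
  else [:: R].
Proof. by []. Qed.

Definition cells := [seq (o,k) | o <- iota 0 4, k <- iota 0 21].
Definition cells0 := [seq v <- cells | v.1 != 0].
Definition row_candidates tc := search tc 13 [:: (0, class_rep tc); (0, aff_inv (class_rep tc))] cells0.

(** The witness is the first option in [r]: the options dropped before it are not in [r], so no
    other cell of [r] is lost. *)
Lemma branchP (A : eqType) (f : cell -> seq cell -> seq A) (r : pred cell) opts rest :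
  has r opts ->
  exists v l, [/\ v \in opts, r v,
    {subset f v l <= branch f opts rest} &
    forall w, r w -> w != v -> w \in opts ++ rest -> w \in l].
Proof.
elim: opts => //= v o IH; have [rv _|nrv /= /IH [w [l [wo rw fs sub]]]] := boolP (r v).
  exists v, (o ++ rest); split=> //; first by rewrite mem_head.
  - by move=> w wf; rewrite mem_cat wf.
  - by move=> w _ /negPf wv; rewrite inE wv.
exists w, l; split=> //; first by rewrite inE wo orbT.
  by move=> x /fs xb; rewrite mem_cat xb orbT.
move=> x rx xw; rewrite inE; case: eqP => [xv|_ /=]; last exact: sub.
by rewrite -xv rx in nrv.
Qed.

(** This makes branching at the chosen point complete: a point with a positive need lies on a cell
    of the row not yet chosen. *)
Lemma best_point_need nd av p best a b : best_point nd av p best = Some (a, b) ->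
  (nth 0 nd (b - p) != 0 /\ p <= b) \/ best = Some (a, b).
Proof.
elim: nd p best => [|n nd IH] p best /=; first by right.
case/IH => [[nz le]|].
  by left; split; [case: (b - p) (subnSK le) nz => // k [<-] | exact: ltnW].
case: n => [|n]; first by right.
have P c : Some (c, p) = Some (a, b) ->
  (nth 0 (n.+1 :: nd) (b - p) != 0 /\ p <= b) \/ best = Some (a, b).
  by case=> _ <-; left; rewrite subnn leqnn.
by case: best P => [[k' q]|] P; [case: ifP => _ //; [exact: P | right] | exact: P].
Qed.

(** * Soundness of the search *)

Definition aff_act g (v : cell) : cell := (v.1, aff_mul g v.2).

(* [r] is the set of cells adjacent to the base cell. *)
Record row_spec tc (r : pred cell) : Prop := RowSpec {
  rs_inc : forall p, p < 14 -> count (fun v => r v && is_end p v) cells = need0 p;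
  rs_diff : forall d, d < 10 ->
    count (fun v => r v && r (aff_act (class_rep d) v)) cells <= quota0 tc d;
  rs_T : forall k, k < 21 -> r (0, k) = (k == class_rep tc) || (k == aff_inv (class_rep tc)) }.

Lemma cells_uniq : uniq cells. Proof. by vm_compute. Qed.

Lemma all_iotaP (P : pred nat) n : all P (iota 0 n) -> forall k, k < n -> P k.
Proof. by move=> /allP aP k kn; apply: aP; rewrite mem_iota. Qed.

Lemma mem_cells v : (v \in cells) = (v.1 < 4) && (v.2 < 21).
Proof.
apply/idP/idP => [|/andP[]].
  by apply/allP: v; vm_compute.
have T : all (fun o => all (fun k => (o, k) \in cells) (iota 0 21)) (iota 0 4).
  by vm_compute.
by case: v => o k oo; apply: all_iotaP (all_iotaP T oo) _.
Qed.

Lemma diff_classP d k l : d < 10 -> k < 21 -> l < 21 ->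
  (diff_class k l == d) = (k == aff_mul (class_rep d) l) || (l == aff_mul (class_rep d) k).
Proof.
have T : all (fun d => all (fun k => all (fun l => (diff_class k l == d) ==
    ((k == aff_mul (class_rep d) l) || (l == aff_mul (class_rep d) k)))
  (iota 0 21)) (iota 0 21)) (iota 0 10) by vm_compute.
by move=> dd kk ll; have /eqP := all_iotaP (all_iotaP (all_iotaP T dd) kk) ll.
Qed.

Lemma class_rep_free d k : d < 10 -> k < 21 ->
  (aff_mul (class_rep d) k != k) && (aff_mul (class_rep d) (aff_mul (class_rep d) k) != k).
Proof.
have T : all (fun d => all (fun k => (aff_mul (class_rep d) k != k) &&
    (aff_mul (class_rep d) (aff_mul (class_rep d) k) != k)) (iota 0 21)) (iota 0 10) by vm_compute.
by move=> dd kk; apply: (all_iotaP (all_iotaP T dd) kk).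
Qed.

Lemma eq_count_pred0 (A : Type) (P : pred A) s : P =1 pred0 -> count P s = 0.
Proof. by move/eq_count ->; rewrite count_pred0. Qed.

Section Sound.
Variables (tc : nat) (r : pred cell) (rP : row_spec tc r).
Hypothesis rsub : forall v, r v -> v \in cells.

(** Let g be the action of [class_rep d]. A pair of the class d is {v, g v}, and since neither g nor
    g^2 fixes a cell it arises from only one v; so [pairs] counts the v in [R] with g v in [R]. *)
Lemma pairs_le d R : d < 10 -> uniq R -> (forall v, v \in R -> r v) -> pairs d R <= quota0 tc d.
Proof.
move=> dd uR sR; apply: leq_trans (rs_diff rP dd).
suff -> : pairs d R = count (fun w => aff_act (class_rep d) w \in R) R.
  rewrite -!size_filter; apply: uniq_leq_size; first exact: filter_uniq.
  move=> w; rewrite !mem_filter => /andP[gR wR].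
  by rewrite !sR // rsub //; apply: sR.
have {sR} sR w : w \in R -> w.1 < 4 /\ w.2 < 21.
  by move/sR/rsub; rewrite mem_cells => /andP.
elim: R uR sR => //= v R IH /andP[vR uR] sR.
have sR' w : w \in R -> w.1 < 4 /\ w.2 < 21 by move=> wR; apply: sR; rewrite inE wR orbT.
have [v1 v2] := sR v (mem_head _ _).
rewrite {}IH //.
have gmulE w : w.2 < 21 -> (v.1 == w.1) && (diff_class v.2 w.2 == d)
    = (w == aff_act (class_rep d) v) || (aff_act (class_rep d) w == v).
  case: v w {sR vR} v1 v2 => o k [o' k'] /= _ kk kk'.
  rewrite diff_classP // /aff_act !xpair_eqE /= [o' == o]eq_sym -andb_orr orbC.
  by rewrite [k == _]eq_sym.
have /andP[n1 n2] := class_rep_free dd v2.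
move: gmulE; set g := aff_act (class_rep d) => gmulE.
have gv : (g v == v) = false.
  by apply/negbTE; move: n1; apply: contra => /eqP {2}<-.
have ggv : (g (g v) == v) = false.
  by apply/negbTE; move: n2; apply: contra => /eqP {2}<-.
rewrite inE gv /= -(count_uniq_mem (g v) uR).
have -> : count (fun w => g w \in v :: R) R =
    count (fun w => g w == v) R + count (fun w => g w \in R) R.
  rewrite -count_predUI [X in _ = _ + X]eq_count_pred0; last first.
    by move=> w /=; case: eqP => //= ->; apply/negbTE.
  by rewrite addn0; apply: eq_count => w /=; rewrite inE.
rewrite addnA; congr (_ + _).
rewrite -count_predUI [X in _ = _ + X]eq_count_pred0; last first.
  by move=> w /=; case: eqP => //= ->.
rewrite addn0; apply: eq_in_count => w wR /=.
by rewrite -gmulE ?(sR' w wR).2 //; case: eqn.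
Qed.

Lemma need_gt0 p R : p < 14 -> (forall v, v \in R -> r v) -> uniq R ->
  need R p != 0 -> has (fun v => r v && (is_end p v) && (v \notin R)) cells.
Proof.
move=> pp sR uR; apply: contraR => /hasPn hn; rewrite /need subn_eq0 -(rs_inc rP pp).
rewrite -!size_filter; apply: uniq_leq_size; first by rewrite filter_uniq // cells_uniq.
move=> v; rewrite !mem_filter => /andP[/andP[rv pv] vc].
by move: (hn v vc); rewrite rv pv /= negbK => ->.
Qed.

Lemma count_need0 p R : p < 14 -> uniq R -> (forall v, v \in R -> r v) ->
  count (is_end p) R <= need0 p.
Proof.
move=> pp uR sR; rewrite -(rs_inc rP pp) -!size_filter.
apply: uniq_leq_size; first exact: filter_uniq.
by move=> v; rewrite !mem_filter => /andP[-> /sR rv]; rewrite rv rsub.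
Qed.

Lemma ends_lt v : v \in cells -> ((ends v).1 < 14) && ((ends v).2 < 14).
Proof. by apply/allP: v; vm_compute. Qed.

Lemma diff_class_lt k l : k < 21 -> l < 21 -> k != l -> diff_class k l < 10.
Proof.
have T : all (fun k => all (fun l => (k != l) ==> (diff_class k l < 10)) (iota 0 21)) (iota 0 21).
  by vm_compute.
by move=> kk ll; apply/implyP; apply: (all_iotaP (all_iotaP T kk) ll).
Qed.

(** [count_need0] and [pairs_le], applied to [u :: R], say that before [u] is added no need or quota
    that it consumes is exhausted. *)
Lemma admissible_row R u : uniq (u :: R) -> (forall v, v \in u :: R -> r v) ->
  admissible (mkseq (need R) 14) (mkseq (quota tc R) 10) R u.
Proof.
move=> uR sR; have uc : u \in cells by apply/rsub/sR/mem_head.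
have /andP[uNR uR'] := uR.
have := ends_lt uc; case E: (ends u) => [a b] /= /andP[aa bb].
rewrite /admissible E !nth_mkseq //.
have needp p : p < 14 -> is_end p u -> need R p != 0.
  move=> pp ou; have := count_need0 pp uR sR; rewrite /= ou.
  by rewrite /need subn_eq0 -ltnNge.
have oa : is_end a u by rewrite /is_end E !eqnE eqxx.
have ob : is_end b u by rewrite /is_end E !eqnE eqxx if_same.
case: (need R a) (needp a aa oa) => // _ _; case: (need R b) (needp b bb ob) => // _ _.
have {uR'} H d : d < 10 -> pairs d (u :: R) <= quota0 tc d by move=> dd; apply: pairs_le.
have uc2 : u.2 < 21 by move: uc; rewrite mem_cells => /andP[].
have {sR} sR w : w \in R -> w \in cells by move=> wR; apply/rsub/sR; rewrite inE wR orbT.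
set ls := mkseq _ 10.
suff : forall w, w \in R -> eqn u.1 w.1 -> nth 0 ls (diff_class u.2 w.2) != 0.
  elim: (R) => //= w R' IH HR.
  case: ifP => [ew|_]; last by apply: IH => x xR; apply: HR; rewrite inE xR orbT.
  case: (nth 0 ls _) (HR w (mem_head _ _) ew) => // _ _.
  by apply: IH => x xR; apply: HR; rewrite inE xR orbT.
move=> w wR /eqnP uw; have := sR w wR; rewrite mem_cells => /andP[_ w2].
have dd : diff_class u.2 w.2 < 10.
  apply: diff_class_lt => //; apply: contraNneq uNR => e.
  by rewrite (_ : u = w) // [u]surjective_pairing uw e -surjective_pairing.
rewrite nth_mkseq // /quota subn_eq0 -ltnNge; apply: leq_trans (H _ dd) => /=.
rewrite -add1n leq_add2r -has_count; apply/hasP; exists w => //=.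
by rewrite !eqnE uw !eqxx.
Qed.

(** The third hypothesis is the invariant of the search: no cell of the row has been discarded. The
    list found is only shown to lie inside the row; equality follows later, as both have 12
    elements. *)
Lemma search_sound n R av : uniq R -> (forall v, v \in R -> r v) ->
  (forall v, r v -> v \notin R -> v \in av) ->
  exists s, [/\ s \in search tc n R av, uniq s & forall v, v \in s -> r v].
Proof.
elim: n R av => [|n IH] R av uR sR hav; first by exists R; rewrite mem_head.
rewrite searchS; cbv zeta; set nd := mkseq (need R) 14; set ls := mkseq (quota tc R) 10.
set av' := filter _ _; case Ep: (best_point nd av' 0 None) => [[a p]|]; last first.
  by exists R; rewrite mem_head.
have hav' v : r v -> v \notin R -> v \in av'.
  move=> rv vR; rewrite mem_filter hav // andbT ; apply: admissible_row.
    by rewrite /= vR.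
  by move=> w; rewrite inE => /predU1P[->|/sR].
have [[+ _]|//] := best_point_need Ep; rewrite subn0 => np.
clearbody av'.
have pp : p < 14 by rewrite ltnNge; apply: contra np => ?; rewrite nth_default ?size_mkseq.
rewrite nth_mkseq // in np; have /hasP[v _ /andP[/andP[rv pv] vR]] := need_gt0 pp sR uR np.
have hr : has (fun v => r v && (v \notin R)) (filter (is_end p) av').
  by apply/hasP; exists v; rewrite ?rv ?vR // mem_filter pv hav'.
have [w [l [wo /andP[rw wR] fs sub]]] := branchP
  (fun v rest => search tc n (v :: R) rest) (filter (fun v => ~~ is_end p v) av') hr.
have [||x rx|s [si us sr]] := IH (w :: R) l.
- by rewrite /= wR.
- by move=> x; rewrite inE => /predU1P[->|/sR].
- rewrite inE negb_or => /andP[xw xR]; apply: sub xw _; first by rewrite rx.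
  by rewrite mem_cat !mem_filter (hav' _ rx xR) !andbT orbN.
by exists s; split=> //; apply: fs.
Qed.

Lemma row_candidates_sound : 2 < tc < 10 ->
  exists s, [/\ s \in row_candidates tc, uniq s & forall v, v \in s -> r v].
Proof.
move=> /andP[tc2 tc10]; apply: search_sound.
- have T : all (fun d => (2 < d) ==> uniq [:: (0, class_rep d); (0, aff_inv (class_rep d))]) (iota 0 10).
    by vm_compute.
  by apply: implyP tc2; apply: all_iotaP T _ tc10.
- have T : all (fun d => (class_rep d < 21) && (aff_inv (class_rep d) < 21)) (iota 0 10) by vm_compute.
  have /andP[T1 T2] := all_iotaP T tc10.
  by move=> v; rewrite !inE => /orP[]/eqP ->; rewrite (rs_T rP) // eqxx ?orbT.
move=> [o k] rv vR; have vc := rsub rv; rewrite mem_filter vc andbT /=.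
apply: contraNneq vR => o0; rewrite o0 in rv vc *.
by move: rv vc; rewrite mem_cells !inE !xpair_eqE /= => rv k21; rewrite -(rs_T rP) .
Qed.
End Sound.

(** * Incompatibility of the candidates *)

Fixpoint anyb A (f : A -> bool) s :=
  if s is x :: s' then if f x then true else anyb f s' else false.

Lemma anybE A (f : A -> bool) s : anyb f s = has f s.
Proof. by elim: s => //= x s ->; case: (f x). Qed.

Definition swap_orbit (o : nat) := nth 0 [:: 1; 0; 3; 2] o.
(** The labels starting from [mate e x a] interchange the heptads. The translate by [k] of their
    base cell is the cell (1, k), and it is adjacent to [v] iff that base cell is adjacent to the
    translate of [v] by the inverse of [k], which in those labels is [cross_shift k v]. *)
Definition cross_shift k (v : cell) : cell := (swap_orbit v.1, aff_mul (aff_inv k) v.2).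

Definition quot_tab := Eval vm_compute in
  mkseq (fun k => mkseq (fun l => aff_mul (aff_inv k) l) 21) 21.

Definition mem_cell (v : cell) (s : seq cell) : bool :=
  anyb (fun w : cell => if eqn v.1 w.1 then eqn v.2 w.2 else false) s.

(** The ends of (0, 0) and of (1, k) lie in different heptads, so all common neighbours of these two
    cells are cells: their number plus the adjacency must be 2. *)
Definition cross_ok (s s' : seq cell) k :=
  let q := nth [::] quot_tab k in
  eqn (count (fun v => mem_cell (swap_orbit v.1, nth 0 q v.2) s') s + mem_cell (1, k) s) 2.

Definition incompatible (A : seq (seq cell)) :=
  if anyb (fun s => ~~ eqn (size s) 12) A then false else
  ~~ anyb (fun s => anyb (fun s' =>
        ~~ anyb (fun k => ~~ cross_ok s s' k) (iota 0 21)) A) A.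

Lemma row_candidates_incompatible : incompatible (flatten [seq row_candidates d | d <- iota 3 7]). Proof. by vm_compute. Qed.

Lemma mem_cellE v s : mem_cell v s = (v \in s).
Proof.
case: v => o k; rewrite -has_pred1 /mem_cell anybE; apply: eq_has => -[o' k'] /=.
by rewrite !eqnE xpair_eqE [o' == o]eq_sym [k' == k]eq_sym; case: eqP.
Qed.

Lemma quot_tab_nth k : k < 21 -> nth [::] quot_tab k = mkseq (fun l => aff_mul (aff_inv k) l) 21.
Proof.
have T : all (fun k => nth [::] quot_tab k == mkseq (fun l => aff_mul (aff_inv k) l) 21) (iota 0 21).
  by vm_compute.
by move=> kk; apply/eqP; apply: (all_iotaP T kk).
Qed.

Lemma on2 v : v \in cells -> count (fun p => is_end p v) (iota 0 14) = 2.
Proof. by move=> vc; apply/eqP; move: v vc; apply/allP; vm_compute. Qed.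

(** The needs of the 14 points add up to 24 and each cell has two ends. *)
Lemma row_size tc r : row_spec tc r -> count r cells = 12.
Proof.
move=> rP; apply/eqP; rewrite -(eqn_pmul2r (_ : 0 < 2)) //; apply/eqP.
transitivity (\sum_(p <- iota 0 14) need0 p); last by rewrite unlock.
transitivity (\sum_(p <- iota 0 14) \sum_(v <- cells | r v) is_end p v).
  rewrite exchange_big -sum1_count big_distrl.
  rewrite big_seq_cond [RHS]big_seq_cond; apply: eq_bigr => v /andP[vc _].
  rewrite [LHS]mul1n -[LHS](on2 vc) -sum1_count [LHS]big_mkcond.
  by apply: eq_bigr => p _; case: is_end.
rewrite big_seq [RHS]big_seq; apply: eq_bigr => p; rewrite mem_iota => /= pp.
rewrite -(rs_inc rP pp) -sum1_count big_mkcondr.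
by apply: eq_bigr => v _; case: is_end.
Qed.

Lemma incompatibleP A s s' : incompatible A -> s \in A -> s' \in A ->
  size s = 12 /\ exists2 k, k < 21 & ~~ cross_ok s s' k.
Proof.
rewrite /incompatible !anybE; case: ifP => // /hasPn sz /hasPn cr sA s'A.
split; first by apply/eqP; move: (sz s sA); rewrite negbK eqnE.
move: (cr s sA); rewrite anybE => /hasPn/(_ s' s'A); rewrite negbK anybE => /hasP[k].
by rewrite mem_iota add0n => /andP[_ kk] ck; exists k.
Qed.

Lemma mem_flatten_range (f : nat -> seq (seq cell)) t s : 2 < t < 10 -> s \in f t ->
  s \in flatten [seq f d | d <- iota 3 7].
Proof.
by move=> tt sf; apply/flatten_mapP; exists t => //; rewrite mem_iota.
Qed.

(* No two candidates, for the base cells of the orbits 0 and 1, satisfy [cross_ok] for all [k]. *)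
Lemma no_rows_from (S : nat -> seq (seq cell)) :
  incompatible (flatten [seq S d | d <- iota 3 7]) ->
  (forall tc r, row_spec tc r -> (forall v, r v -> v \in cells) -> 2 < tc < 10 ->
    exists s, [/\ s \in S tc, uniq s & forall v, v \in s -> r v]) ->
  forall tc tc' (r r' : pred cell),
  2 < tc < 10 -> 2 < tc' < 10 -> row_spec tc r -> row_spec tc' r' ->
  (forall v, r v -> v \in cells) -> (forall v, r' v -> v \in cells) ->
  (forall k, k < 21 -> count (fun v => r v && r' (cross_shift k v)) cells + r (1, k) = 2) ->
  False.
Proof.
set A := flatten _ => incA soundS tc tc' r r'.
have solE t q : 2 < t < 10 -> row_spec t q -> (forall v, q v -> v \in cells) ->
  exists s, [/\ s \in A, perm_eq s (filter q cells) & forall v, (v \in s) = q v].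
  move=> tt qP qc; have [s [ss us sq]] := soundS t q qP qc tt.
  have sub : {subset s <= filter q cells}.
    by move=> v vs; rewrite mem_filter sq //= qc // sq.
  have szf : size (filter q cells) = 12 by rewrite size_filter (row_size qP).
  have sA : s \in A by apply: mem_flatten_range ss.
  have [sz _] := incompatibleP incA sA sA.
  have [_ E] := uniq_min_size us sub (eq_leq (etrans szf (esym sz))).
  exists s; split=> //.
    by apply: uniq_perm => //; rewrite filter_uniq // cells_uniq.
  by move=> v; rewrite E mem_filter andb_idr // => /qc.
move=> tt tt' rP rP' rc rc' cr.
have [s [sA ps sr]] := solE tc r tt rP rc.
have [s' [sA' _ sr']] := solE tc' r' tt' rP' rc'.
have [_ [k kk /negP[]]] := incompatibleP incA sA sA'.
rewrite /cross_ok quot_tab_nth // eqnE -[X in _ == X](cr k kk) mem_cellE sr eqn_add2r.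
rewrite (seq.permP ps) count_filter; apply/eqP/eq_in_count => v vc /=.
have v2 : v.2 < 21 by move: vc; rewrite mem_cells => /andP[].
by rewrite mem_cellE sr' andbC nth_mkseq.
Qed.

Lemma no_rows tc tc' (r r' : pred cell) :
  2 < tc < 10 -> 2 < tc' < 10 -> row_spec tc r -> row_spec tc' r' ->
  (forall v, r v -> v \in cells) -> (forall v, r' v -> v \in cells) ->
  (forall k, k < 21 -> count (fun v => r v && r' (cross_shift k v)) cells + r (1, k) = 2) ->
  False.
Proof. exact: (no_rows_from row_candidates_incompatible row_candidates_sound). Qed.

Global Opaque cells aff_mul aff_inv aff_class.

(** * Coordinates attached to an automorphism of order 7 *)

Lemma prime_expg_fix (T : finType) (s : {perm T}) p k z :
  prime p -> #[s]%g = p -> ~~ (p %| k) -> (s ^+ k)%g z = z -> s z = z.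
Proof.
move=> pp os pk sz; have : generator <[s]>%g (s ^+ k)%g.
  by rewrite generator_coprime os prime_coprime.
move/eqP=> E; have : s \in <[s ^+ k]>%g by rewrite -E cycle_id.
case/cycleP=> j {1}->; elim: j => [|j IH]; first by rewrite perm1.
by rewrite expgSr permM IH.
Qed.

Definition mate_index p := if p < 7 then p + 7 else p - 7.

Lemma mate_index_lt p : p < 14 -> mate_index p < 14.
Proof.
rewrite /mate_index; case: (ltnP p 7) => p7 p14; last exact: leq_ltn_trans (leq_subr _ _) p14.
by rewrite addnC -ltn_subRL.
Qed.

Definition good_pair p q := [&& p < 14, q < 14, p != q & q != mate_index p].

Lemma ends_good v : v \in cells -> good_pair (ends v).1 (ends v).2.
Proof. by apply/allP: v; vm_compute. Qed.

Definition same_pair (v w : nat * nat) :=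
  (v.1 == w.1) && (v.2 == w.2) || (v.1 == w.2) && (v.2 == w.1).

Lemma ends_inj v w : v \in cells -> w \in cells -> same_pair (ends v) (ends w) -> v = w.
Proof.
have T1 : all (fun v => all (fun w => same_pair (ends v) (ends w) ==> (v == w)) cells) cells.
  by vm_compute.
by move=> vc wc /(implyP (allP (allP T1 v vc) w wc))/eqP.
Qed.

Section Label.
Variables (T : finType) (e : rel T).
Hypothesis srg : strongly_regular e 99 14 1 2.
Implicit Types (u x y z : T) (s t h : {perm T}).
Local Notation N := (nbhd e).
Local Notation Aut := (graph_aut e).
Variables (sg : {perm T}) (x a : T).
Hypotheses (sA : sg \in Aut) (o7 : #[sg]%g = 7) (sx : sg x = x) (xa : e x a) (sa : sg a != a).
Let b := mate e x a.

Lemma adj_x_mate : e x b. Proof. by case/andP: (mateP srg xa). Qed.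
Lemma adj_a_mate : e a b. Proof. by case/andP: (mateP srg xa). Qed.
Lemma mate_b : mate e x b = a. Proof. exact: mateK. Qed.

Lemma sXx k : (sg ^+ k)%g x = x.
Proof. by elim: k => [|k IH]; rewrite ?perm1 // expgSr permM IH. Qed.

Lemma sXA k : (sg ^+ k)%g \in Aut. Proof. exact: groupX. Qed.

Lemma sXmate k u : e x u -> (sg ^+ k)%g (mate e x u) = mate e x ((sg ^+ k)%g u).
Proof. by move=> xu; rewrite (aut_mate srg (sXA k)) // sXx. Qed.

Lemma sXmod k u : (sg ^+ (k %% 7))%g u = (sg ^+ k)%g u.
Proof. by rewrite -o7 expg_mod_order. Qed.

Lemma mate_moved : sg b != b.
Proof.
apply: contraNneq sa => E; rewrite -mate_b -[in X in _ == X]E.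
by have := sXmate 1 adj_x_mate; rewrite expg1 => ->.
Qed.

Definition nbr_label p := (sg ^+ (p %% 7))%g (if p < 7 then a else b).

Local Notation Pt := nbr_label.

Lemma x_Pt p : e x (Pt p).
Proof. by rewrite -(sXx (p %% 7)) (autE (sXA _)); case: ifP => _ //; apply: adj_x_mate. Qed.

Lemma Pt_a k : (sg ^+ k)%g a = Pt (k %% 7).
Proof. by rewrite /nbr_label modn_mod ltn_pmod // sXmod. Qed.

Lemma Pt_b k : (sg ^+ k)%g b = Pt (7 + k %% 7).
Proof. by rewrite /nbr_label modnDl modn_mod ltnNge leq_addr sXmod. Qed.

Lemma sX_inj c i j : i < 7 -> j < 7 -> sg c != c ->
  (sg ^+ i)%g c = (sg ^+ j)%g c -> i = j.
Proof.
move=> i7 j7 sc E; have : (sg ^+ (i + (7 - j)))%g c = c.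
  by rewrite expgD permM E -permM -expgD subnKC ?(ltnW j7) // -o7 expg_order perm1.
move=> F; have [/dvdnP[k Ek]|nd] := boolP (7 %| i + (7 - j)); first by lia.
by case/eqP: sc; apply: prime_expg_fix nd F.
Qed.

(** If a power of [sg] maps [a] to its mate, it also maps the mate back to [a]; its square then
    fixes [a], which is impossible in a group of order 7 moving [a]. So the neighbours of [x] form
    two orbits of length 7. *)
Lemma sX_cross i j : j < 7 -> (sg ^+ i)%g a <> (sg ^+ j)%g b.
Proof.
move=> j7 E; pose k := i + (7 - j).
have ka : (sg ^+ k)%g a = b.
  by rewrite expgD permM E -permM -expgD subnKC ?(ltnW j7) // -o7 expg_order perm1.
have kb : (sg ^+ k)%g b = a by rewrite sXmate // ka mate_b.
have [/dvdnP[l El]|nd] := boolP (7 %| k).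
  have : a = b by rewrite -ka El mulnC expgM -o7 expg_order expg1n perm1.
  by apply/eqP/(adj_neq srg)/adj_a_mate.
case/eqP: sa; apply: (prime_expg_fix (k := k * 2) _ o7) => //.
  by rewrite Euclid_dvdM // negb_or nd.
by rewrite muln2 -addnn expgD permM ka kb.
Qed.

Lemma Pt_inj p q : p < 14 -> q < 14 -> Pt p = Pt q -> p = q.
Proof.
move=> p14 q14; rewrite /nbr_label; have m7 r : r %% 7 < 7 by rewrite ltn_pmod.
case: (ltnP p 7) => p7; case: (ltnP q 7) => q7 E.
- by have := sX_inj (m7 p) (m7 q) sa E; rewrite !modn_small.
- by case: (sX_cross (m7 q) E).
- by case: (sX_cross (m7 p) (esym E)).
have := sX_inj (m7 p) (m7 q) mate_moved E.
by rewrite -(subnK p7) -(subnK q7) !modnDr !modn_small ?ltn_subLR // => ->.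
Qed.

Lemma Pt_eq p q : p < 14 -> q < 14 -> (Pt p == Pt q) = (p == q).
Proof. by move=> p14 q14; apply/eqP/eqP => [/Pt_inj->|->]. Qed.

Definition pts := map Pt (iota 0 14).

Lemma pts_uniq : uniq pts.
Proof.
rewrite map_inj_in_uniq ?iota_uniq // => p q; rewrite !mem_iota => /= p14 q14.
exact: Pt_inj.
Qed.

Lemma nbhd_pts : N x =i pts.
Proof.
have sub : {subset pts <= enum (N x)}.
  by move=> u /mapP[p _ ->]; rewrite mem_enum inE x_Pt.
have [|_ E] := uniq_min_size pts_uniq sub.
  by rewrite -cardE (srg_reg srg) size_map size_iota.
by move=> u; rewrite E mem_enum.
Qed.

Lemma ptP u : e x u -> exists2 p, p < 14 & u = Pt p.
Proof.
move=> xu; have : u \in N x by rewrite inE.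
by rewrite nbhd_pts => /mapP[p]; rewrite mem_iota => /= p14 ->; exists p.
Qed.

Lemma mate_Pt p : p < 14 -> mate e x (Pt p) = Pt (mate_index p).
Proof.
move=> p14; rewrite /nbr_label /mate_index -sXmate; last by case: ifP => _ //; apply: adj_x_mate.
case: (ltnP p 7) => p7; first by rewrite modnDr ltnNge leq_addl.
by rewrite mate_b ltn_subLR // p14 -{1}(subnK p7) modnDr.
Qed.

Lemma e_Pt p q : p < 14 -> q < 14 -> e (Pt p) (Pt q) = (q == mate_index p).
Proof.
move=> p14 q14; have o14 := mate_index_lt p14.
rewrite -(Pt_eq q14 o14) -mate_Pt //; apply/idP/eqP => [pq|->].
  by apply/esym/mate_eq; rewrite ?x_Pt.
by case/andP: (mateP srg (x_Pt p)).
Qed.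

Definition pair_label p q := join e x (Pt p) (Pt q).

Local Notation J := pair_label.

Section GoodPair.
Variables p q : nat.
Hypotheses (p14 : p < 14) (q14 : q < 14) (pq : p != q) (pq' : q != mate_index p).

Lemma good_neq : Pt p != Pt q. Proof. by rewrite Pt_eq. Qed.
Lemma good_nadj : ~~ e (Pt p) (Pt q). Proof. by rewrite e_Pt. Qed.

Lemma e_PtJ r : r < 14 -> e (Pt r) (J p q) = (r == p) || (r == q).
Proof.
by move=> r14; rewrite (join_nbrs srg (x_Pt p) (x_Pt q) good_neq good_nadj) ?x_Pt // !Pt_eq.
Qed.

Lemma J_neq : J p q != x.
Proof.
exact: (@join_neq _ _ srg _ _ _ (x_Pt p) (x_Pt q) good_neq good_nadj).
Qed.

Lemma J_nadj : ~~ e x (J p q).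
Proof.
exact: (@join_nadj _ _ srg _ _ _ (x_Pt p) (x_Pt q) good_neq good_nadj).
Qed.

Lemma aut_J h (phi : nat -> nat) : h \in Aut -> h x = x ->
  (forall r, r < 14 -> h (Pt r) = Pt (phi r)) -> h (J p q) = J (phi p) (phi q).
Proof.
move=> hA hx hP; rewrite /pair_label (aut_join srg hA) ?x_Pt ?good_neq ?good_nadj //.
by rewrite hx !hP.
Qed.
End GoodPair.

Lemma JC p q : J p q = J q p. Proof. exact: joinC. Qed.

Lemma J_inj p q p' q' : good_pair p q -> good_pair p' q' ->
  (J p q == J p' q') = (p == p') && (q == q') || (p == q') && (q == p').
Proof.
move=> /and4P[p14 q14 pq pq'] /and4P[r14 s14 rs rs'].
apply/eqP/orP => [E|[]/andP[/eqP-> /eqP->] //]; last exact: JC.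
have := e_PtJ p14 q14 pq pq' p14; have := e_PtJ p14 q14 pq pq' q14.
rewrite !E !e_PtJ // !eqxx orbT /= => /orP[]/eqP Eq /orP[]/eqP Ep.
- by rewrite Ep Eq eqxx in pq.
- by right; rewrite Ep Eq !eqxx.
- by left; rewrite Ep Eq !eqxx.
by rewrite Ep Eq eqxx in pq.
Qed.

Definition far_label (v : cell) := J (ends v).1 (ends v).2.

Local Notation V := far_label.

Lemma V_inj v w : v \in cells -> w \in cells -> V v = V w -> v = w.
Proof.
move=> vc wc /eqP; rewrite J_inj ?ends_good // => E; exact: ends_inj.
Qed.

Definition labels := x :: pts ++ map V cells.

Lemma labels_uniq : uniq labels.
Proof.
rewrite cons_uniq cat_uniq pts_uniq map_inj_in_uniq ?cells_uniq ?andbT; last exact: V_inj.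
rewrite mem_cat negb_or -andbA; apply/and3P; split.
- by rewrite -nbhd_pts inE (adj_irr srg).
- apply/mapP=> -[v vc E]; have /and4P[p14 q14 pq pq'] := ends_good vc.
  by have := J_neq p14 q14 pq pq'; rewrite -[J _ _]E eqxx.
apply/hasPn=> _ /mapP[v vc ->]; have /and4P[p14 q14 pq pq'] := ends_good vc.
by rewrite -nbhd_pts inE; apply: J_nadj.
Qed.

(** The labels are distinct and there are 1 + 14 + 84 = 99 of them. *)
Lemma labels_perm : perm_eq labels (enum T).
Proof.
have [|_ E] := uniq_min_size labels_uniq (fun u _ => mem_enum T u).
  by rewrite -cardE (srg_card srg).
by apply: uniq_perm; rewrite ?labels_uniq ?enum_uniq.
Qed.

Lemma count_label (Q : pred T) : #|Q| =
  Q x + count (fun p => Q (Pt p)) (iota 0 14) + count (fun v => Q (V v)) cells.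
Proof.
rewrite cardE /enum_mem size_filter -enumT -(seq.permP labels_perm).
rewrite (@eq_count _ _ Q) // /labels -cat1s 2!count_cat (count_map Pt) (count_map V) addnA.
rewrite [X in X + _ + _]addn0.
reflexivity.
Qed.

Lemma labelP u : u != x -> ~~ e x u -> exists2 v, v \in cells & u = V v.
Proof.
move=> ux xu; have : u \in labels by rewrite (perm_mem labels_perm) mem_enum.
rewrite inE (negPf ux) mem_cat -nbhd_pts inE (negPf xu) => /mapP[v vc ->].
by exists v.
Qed.

End Label.

(* The default value is never reached on good pairs, by [cellofP]. *)
Definition cellof p q := nth (0, 0) cells (find (fun v => same_pair (ends v) (p, q)) cells).
Definition actc (phi : nat -> nat) v := cellof (phi (ends v).1) (phi (ends v).2).

Lemma cellofP p q : good_pair p q ->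
  (cellof p q \in cells) && same_pair (ends (cellof p q)) (p, q).
Proof.
have T1 : all (fun p => all (fun q => good_pair p q ==>
    (cellof p q \in cells) && same_pair (ends (cellof p q)) (p, q)) (iota 0 14)) (iota 0 14).
  by vm_compute.
move=> g; have /and4P[p14 q14 _ _] := g.
by move: g; apply/implyP; apply: all_iotaP (all_iotaP T1 p14) _ q14.
Qed.

Section Act.
Variables (T : finType) (e : rel T).
Hypothesis srg : strongly_regular e 99 14 1 2.
Local Notation Aut := (graph_aut e).
Local Notation N := (nbhd e).
Variables (sg : {perm T}) (x a : T).
Hypotheses (sA : sg \in Aut) (o7 : #[sg]%g = 7) (sx : sg x = x) (xa : e x a) (sa : sg a != a).
Local Notation Pt := (nbr_label e sg x a).
Local Notation V := (far_label e sg x a).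
Local Notation J := (pair_label e sg x a).

Lemma J_cellof p q : good_pair p q -> J p q = V (cellof p q).
Proof.
move=> g; have /andP[vc /orP[/andP[/eqP /= E1 /eqP /= E2]|/andP[/eqP /= E1 /eqP /= E2]]] := cellofP g.
  by rewrite /far_label E1 E2.
by rewrite JC /far_label E1 E2.
Qed.

Section OneAct.
Variables (h : {perm T}) (phi : nat -> nat).
Hypotheses (hA : h \in Aut) (hx : h x = x).
Hypothesis hP : forall p, p < 14 -> phi p < 14 /\ h (Pt p) = Pt (phi p).

Lemma act_good p q : good_pair p q -> good_pair (phi p) (phi q).
Proof.
case/and4P=> p14 q14 pq pq'; have [p14' Ep] := hP p14; have [q14' Eq] := hP q14.
rewrite /good_pair p14' q14' -(Pt_eq srg sA o7 sx xa sa p14' q14') -Ep -Eq (inj_eq perm_inj).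
rewrite (Pt_eq srg sA o7 sx xa sa) // pq -(e_Pt srg sA o7 sx xa sa p14' q14') -Ep -Eq.
by rewrite (autE hA) (e_Pt srg sA o7 sx xa sa).
Qed.

Lemma act_cell v : v \in cells -> (actc phi v \in cells) && (h (V v) == V (actc phi v)).
Proof.
move=> vc; have g := ends_good vc; have g' := act_good g.
have /andP[-> _] := cellofP g'.
have /and4P[p14 q14 pq pq'] := g.
rewrite /actc -(J_cellof g') {1}/far_label; apply/eqP.
by apply: (aut_J srg sA o7 sx xa sa p14 q14 pq pq' hA hx) => r /hP[].
Qed.

Lemma act_V v : v \in cells -> h (V v) = V (actc phi v).
Proof. by case/act_cell/andP=> _ /eqP. Qed.

Lemma fix_Pt p : p < 14 -> (h (Pt p) == Pt p) = (phi p == p).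
Proof. by move=> p14; have [q14 ->] := hP p14; rewrite (Pt_eq srg sA o7 sx xa sa). Qed.

Lemma fix_V v : v \in cells -> (h (V v) == V v) = (actc phi v == v).
Proof.
move=> vc; have /andP[wc /eqP->] := act_cell vc.
by apply/eqP/eqP => [/(V_inj srg sA o7 sx xa sa wc vc)|->].
Qed.

Lemma nfix_label : nfix h = 1 + count (fun p => phi p == p) (iota 0 14)
  + count (fun v => actc phi v == v) cells.
Proof.
have := count_label srg sA o7 sx xa sa (fun z => h z == z).
rewrite hx eqxx /nfix cardsE => ->.
congr (_ + _ + _); apply: eq_in_count; last exact: fix_V.
by move=> p; rewrite mem_iota => /= /fix_Pt.
Qed.
End OneAct.

Lemma sum_label (F : T -> nat) : \sum_u F u =
  F x + \sum_(p <- iota 0 14) F (Pt p) + \sum_(v <- cells) F (V v).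
Proof.
transitivity (\sum_(u in T) F u); first exact: eq_bigl.
rewrite -big_enum /= -(perm_big _ (labels_perm srg sA o7 sx xa sa)) /labels.
rewrite [LHS]big_cons -addnA; congr (_ + _); rewrite [LHS]big_cat /=.
by congr (_ + _); apply: big_map.
Qed.

Lemma e_PtV p v : p < 14 -> v \in cells -> e (Pt p) (V v) = is_end p v.
Proof.
move=> p14 /ends_good/and4P[q14 r14 qr qr'].
rewrite (e_PtJ srg sA o7 sx xa sa q14 r14 qr qr' p14) /is_end; case: (ends v) => q r /=.
by rewrite !eqnE ![p == _]eq_sym; case: (q == p).
Qed.

Lemma e_xV v : v \in cells -> e x (V v) = false.
Proof.
move=> /ends_good/and4P[q14 r14 qr qr'].
by apply/negbTE/(J_nadj srg sA o7 sx xa sa q14 r14 qr qr').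
Qed.

Lemma common_label u w : #|N u :&: N w| = (e u x && e w x)
  + count (fun p => e u (Pt p) && e w (Pt p)) (iota 0 14)
  + count (fun v => e u (V v) && e w (V v)) cells.
Proof.
rewrite -(count_label srg sA o7 sx xa sa (fun z => e u z && e w z)).
by apply: eq_card => z; rewrite !inE.
Qed.

Lemma V_neq_Pt p v : v \in cells -> V v != Pt p.
Proof.
by move=> vc; apply: contraFneq (e_xV vc) => ->; apply: x_Pt.
Qed.

End Act.

(** * The neighbourhood of a vertex under a group of order 21 *)

Lemma countE (A : Type) (P : pred A) s : count P s = \sum_(i <- s) P i.
Proof. by rewrite -sum1_count big_mkcond; apply: eq_bigr => i _; case: (P i). Qed.

Definition phik k p := 7 * (p %/ 7) + (pow2 (k %/ 7) * (p %% 7) + k %% 7) %% 7.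

Lemma actc_phik k v : k < 21 -> v \in cells -> actc (phik k) v = aff_act k v.
Proof.
move=> kk vc.
have T1 : all (fun k => all (fun v => actc (phik k) v == aff_act k v) cells) (iota 0 21).
  by vm_compute.
by have /allP H := all_iotaP T1 kk; apply/eqP/H.
Qed.

Lemma aff_act_cells k v : k < 21 -> v \in cells -> aff_act k v \in cells.
Proof.
move=> kk vc.
have T1 : all (fun k => all (fun v => aff_act k v \in cells) cells) (iota 0 21).
  by vm_compute.
by have /allP H := all_iotaP T1 kk; apply: H.
Qed.

Definition nbr_overlap k := count (fun q => is_end q (0, 0) && is_end (phik k q) (0, 0)) (iota 0 14).

Lemma sum_cells (F : cell -> nat) :
  \sum_(v <- cells) F v = \sum_(o <- iota 0 4) \sum_(k <- iota 0 21) F (o, k).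
Proof. exact: big_allpairs. Qed.

Lemma aff_mul_perm l : l < 21 -> perm_eq [seq aff_mul k l | k <- iota 0 21] (iota 0 21).
Proof.
move=> ll; have T1 : all (fun l => perm_eq [seq aff_mul k l | k <- iota 0 21] (iota 0 21)) (iota 0 21).
  by vm_compute.
exact: (all_iotaP T1 ll).
Qed.

Lemma count2_eq (P : pred nat) n i j : count P (iota 0 n) = 2 -> i < n -> j < n ->
  P i -> P j -> i != j -> forall k, k < n -> P k = (k == i) || (k == j).
Proof.
move=> c2 i1 j1 Pi Pj ij k kn.
have u2 : uniq [:: i; j] by rewrite /= inE ij.
have sub : {subset [:: i; j] <= filter P (iota 0 n)}.
  by move=> l; rewrite !inE mem_filter mem_iota => /orP[]/eqP->; rewrite ?Pi ?Pj.
have [|_ E] := uniq_min_size u2 sub; first by rewrite size_filter c2.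
by have := E k; rewrite mem_filter mem_iota add0n leq0n kn !andbT !inE => ->.
Qed.

Section Row.
Variables (T : finType) (e : rel T).
Hypothesis srg : strongly_regular e 99 14 1 2.
Local Notation Aut := (graph_aut e).
Local Notation N := (nbhd e).
Variables (sg : {perm T}) (x a : T).
Hypotheses (sA : sg \in Aut) (o7 : #[sg]%g = 7) (sx : sg x = x) (xa : e x a) (sa : sg a != a).
Local Notation Pt := (nbr_label e sg x a).
Local Notation V := (far_label e sg x a).
Local Notation J := (pair_label e sg x a).
Variable h : nat -> {perm T}.
Hypotheses (hA : forall k, h k \in Aut) (hx : forall k, h k x = x).
Hypothesis hP : forall k p, k < 21 -> p < 14 -> phik k p < 14 /\ h k (Pt p) = Pt (phik k p).
Hypothesis no_short : forall k, 0 < k < 7 -> ~~ e (V (0, 0)) (V (0, k)).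

Definition orbit_row v := (v \in cells) && e (V (0, 0)) (V v).
Local Notation y := (V (0, 0)).
Local Notation r := orbit_row.

Lemma c00 : (0, 0) \in cells. Proof. by rewrite mem_cells. Qed.

Lemma h_V k v : k < 21 -> v \in cells -> h k (V v) = V (aff_act k v).
Proof.
move=> kk vc; rewrite -(actc_phik kk vc).
by apply: (act_V srg sA o7 sx xa sa (hA k) (hx k)) vc => p; apply: hP.
Qed.

Lemma row_cells v : r v -> v \in cells. Proof. by case/andP. Qed.

Lemma e_yPt q : q < 14 -> e y (Pt q) = is_end q (0, 0).
Proof. by move=> qq; rewrite adjC // (e_PtV srg sA o7 sx xa sa qq c00). Qed.

Lemma e_yx : e y x = false.
Proof. by rewrite adjC // (e_xV srg sA o7 sx xa sa c00). Qed.

Lemma row_inc p : p < 14 -> count (fun v => r v && is_end p v) cells = need0 p.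
Proof.
move=> pp; have := common_nbrs srg y (Pt p).
rewrite (negPf (V_neq_Pt srg sA o7 sx xa sa p c00)) (common_label srg sA o7 sx xa sa) e_yx.
rewrite (e_yPt pp).
rewrite (@eq_in_count _ _ (fun q => is_end q (0, 0) && (q == mate_index p))); last first.
  move=> q; rewrite mem_iota => /= qq; rewrite e_yPt // (e_Pt srg sA o7 sx xa sa) //.
have -> : count (fun v => e y (V v) && e (Pt p) (V v)) cells = count (fun v => r v && is_end p v) cells.
  by apply: eq_in_count => v vc; rewrite /orbit_row vc (e_PtV srg sA o7 sx xa sa pp vc).
have /eqP : 2 == need0 p + is_end p (0, 0) + count (fun q => is_end q (0, 0) && (q == mate_index p)) (iota 0 14).
  have T1 : all (fun p => 2 == need0 p + is_end p (0, 0) + count (fun q => is_end q (0, 0) && (q == mate_index p)) (iota 0 14)) (iota 0 14).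
    by vm_compute.
  exact: (all_iotaP T1 pp).
by move: (count _ cells) (count _ _) (need0 p) (is_end _ _ : nat); lia.
Qed.

Definition dcount k := count (fun v => r v && r (aff_act k v)) cells.

Lemma row_diff k : 0 < k < 21 -> nbr_overlap k + dcount k + r (0, k) = 2.
Proof.
(* With the inverse translate, adjacency of [w] to z is adjacency of the base cell to the image of z
   under [h k], which is what [dcount] and [nbr_overlap] count. *)
move=> /andP[k0 kk]; pose w := ((h k)^-1)%g y.
have hw z : e w z = e y (h k z) by rewrite -(autE (hA k) w z) /w permKV.
have kc : (0, k) \in cells by rewrite mem_cells.
have hy : h k y = V (0, k).
  rewrite h_V ?c00 // /aff_act /=; congr (V (0, _)).
  by apply/eqP; move: k kk {k0 w hw kc}; apply: all_iotaP; vm_compute.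
have yw : (y == w) = false.
  apply/negbTE; rewrite -(inj_eq (@perm_inj _ (h k))) permKV hy.
  apply: contraTneq k0 => /(V_inj srg sA o7 sx xa sa kc c00)[->]; by [].
have := common_nbrs srg y w; rewrite yw (common_label srg sA o7 sx xa sa) e_yx.
have -> : e y w = r (0, k) by rewrite [e y w]adjC // hw hy /orbit_row kc.
have -> : count (fun p => e y (Pt p) && e w (Pt p)) (iota 0 14) = nbr_overlap k.
  apply: eq_in_count => q; rewrite mem_iota => /= qq; rewrite hw.
  by have [q' ->] := hP kk qq; rewrite !e_yPt.
have -> : count (fun v => e y (V v) && e w (V v)) cells = dcount k.
  by apply: eq_in_count => v vc; rewrite hw h_V // /orbit_row vc aff_act_cells.
by [].
Qed.

Definition csize o := count (fun k => r (o, k)) (iota 0 21).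

(** The group of order 21 is regular on each of the four orbits of cells, so an ordered pair of row
    cells in one orbit is (v, k v) for exactly one k. *)
Lemma sum_dcount : \sum_(k <- iota 0 21) dcount k = \sum_(o <- iota 0 4) csize o ^ 2.
Proof.
under eq_bigr do rewrite /dcount countE sum_cells.
rewrite exchange_big; apply: eq_bigr => o _; rewrite exchange_big.
rewrite -mulnn {1}/csize countE big_distrl; apply: eq_big_seq => l lI.
have ll : l < 21 by move: lI; rewrite mem_iota.
rewrite /csize countE.
rewrite -[in RHS](perm_big _ (aff_mul_perm ll)) big_map big_distrr; apply: eq_bigr => k _.
by rewrite /aff_act; case: (r (o, l)); case: (r (o, aff_mul k l)).
Qed.

Lemma inc_sum s : \sum_(p <- iota s 7) count (fun v => r v && is_end p v) cells =
  \sum_(o <- iota 0 4) \sum_(k <- iota 0 21) r (o, k) * count (fun p => is_end p (o, k)) (iota s 7).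
Proof.
under eq_bigr do rewrite countE.
rewrite exchange_big sum_cells; apply: eq_bigr => o _; apply: eq_bigr => k _.
rewrite countE big_distrr; apply: eq_bigr => p _.
by case: (r (o, k)); case: (is_end p (o, k)).
Qed.

Lemma inc_csize s c : (forall o k, o < 4 -> k < 21 ->
    count (fun p => is_end p (o, k)) (iota s 7) = nth 0 c o) ->
  s + 7 <= 14 ->
  \sum_(p <- iota s 7) need0 p = \sum_(o <- iota 0 4) csize o * nth 0 c o.
Proof.
move=> cE s7; transitivity (\sum_(p <- iota s 7) count (fun v => r v && is_end p v) cells).
  apply: eq_big_seq => p; rewrite mem_iota => /andP[_ ps]; rewrite row_inc //.
  exact: leq_trans ps s7.
rewrite inc_sum; apply: eq_big_seq => o; rewrite mem_iota => /andP[_ o4].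
rewrite /csize countE big_distrl; apply: eq_big_seq => k; rewrite mem_iota => /andP[_ k21].
by rewrite cE.
Qed.

(** Counting ends in each heptad gives 2 c0 + c2 + c3 = 12 = 2 c1 + c2 + c3 for the numbers of
    neighbours in the four orbits. The common neighbours of the base cell with its translates give 2
    c0^2 + c2^2 + c3^2 = 42 - c0. Only c0 = 2 is possible. *)
Lemma csize0 : csize 0 = 2.
Proof.
have chk s c : all (fun o => all (fun k => count (fun p => is_end p (o, k)) (iota s 7) == nth 0 c o)
    (iota 0 21)) (iota 0 4) ->
  forall o k, o < 4 -> k < 21 -> count (fun p => is_end p (o, k)) (iota s 7) = nth 0 c o.
  by move=> H o k oo kk; apply/eqP; apply: (all_iotaP (all_iotaP H oo) kk).
have I1 := inc_csize (chk 0 [:: 2; 0; 1; 1] isT) isT.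
have I2 := inc_csize (chk 7 [:: 0; 2; 1; 1] isT) isT.
have D0 : dcount 0 = count r cells.
  apply: eq_in_count => v vc; rewrite (_ : aff_act 0 v = v) ?andbb //.
  by apply/eqP; move: v vc; apply/allP; vm_compute.
have C12 : count r cells = \sum_(o <- iota 0 4) csize o.
  by rewrite countE sum_cells; apply: eq_bigr => o _; rewrite /csize countE.
have S := sum_dcount.
have D1 : \sum_(k <- iota 1 20) (nbr_overlap k + dcount k + r (0, k)) = \sum_(k <- iota 1 20) 2.
  by apply: eq_big_seq => k; rewrite mem_iota => kk; apply: row_diff.
have r00 : r (0, 0) = false by rewrite /orbit_row (adj_irr srg) andbF.
have C0 : csize 0 = \sum_(k <- iota 1 20) r (0, k).
  by rewrite /csize countE big_cons r00.
(* Each of the 4 ordered pairs of elements of {0, 1} is realized by 3 of the 21 affine maps, and the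
   identity contributes 2: 12 - 2 = 10. *)
have SH : \sum_(k <- iota 1 20) nbr_overlap k = 10.
  by rewrite unlock; vm_compute.
rewrite big_split big_split SH -C0 in D1.
have D2 : 10 + \sum_(k <- iota 1 20) dcount k + csize 0 = 40.
  by rewrite [LHS]D1 big_const_seq; vm_compute.
have S1 : dcount 0 + \sum_(k <- iota 1 20) dcount k = \sum_(o <- iota 0 4) csize o ^ 2.
  by rewrite -S [RHS]big_cons.
have sum4 F : \sum_(o <- iota 0 4) F o = F 0 + F 1 + F 2 + F 3.
  by rewrite unlock /= addn0 !addnA.
have N1 : \sum_(p <- iota 0 7) need0 p = 12 by rewrite unlock.
have N2 : \sum_(p <- iota 7 7) need0 p = 12 by rewrite unlock.
move: I1 I2 S1 D2; rewrite N1 N2 D0 C12 !sum4 -!mulnn.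
move: (csize 0) (csize 1) (csize 2) (csize 3) (\sum_(k <- _) _) => c0 c1 c2 c3 D /=.
clear; move=> I1 I2 S1 D2.
have ? : c1 = c0 by lia.
have ? : D = 30 - c0 by lia.
have c06 : c0 <= 6 by lia.
subst c1; subst D.
have ? : c3 = 12 - 2 * c0 - c2 by lia.
subst c3.
by case: c0 c06 I1 I2 S1 D2 => [|[|[|[|[|[|[|c0]]]]]]] // c06 I1 I2 S1 D2; nia.
Qed.
Lemma aff_act0 k : k < 21 -> aff_act k (0, 0) = (0, k).
Proof.
move=> kk; have T1 : all (fun k => aff_act k (0, 0) == (0, k)) (iota 0 21) by vm_compute.
exact/eqP/(all_iotaP T1 kk).
Qed.

Lemma aff_inv_facts k : 6 < k < 21 ->
  [/\ aff_inv k < 21, aff_inv k != k, aff_act k (0, aff_inv k) = (0, 0), 2 < aff_class k < 10 &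
   forall l, (l == k) || (l == aff_inv k) =
     (l == class_rep (aff_class k)) || (l == aff_inv (class_rep (aff_class k)))].
Proof.
have T1 : all (fun k => (6 < k) ==> [&& aff_inv k < 21, aff_inv k != k, aff_act k (0, aff_inv k) == (0, 0),
    2 < aff_class k < 10 & (class_rep (aff_class k) == k) && (aff_inv (class_rep (aff_class k)) == aff_inv k) ||
    (class_rep (aff_class k) == aff_inv k) && (aff_inv (class_rep (aff_class k)) == k)]) (iota 0 21).
  by vm_compute.
move=> /andP[k6 kk]; have := all_iotaP T1 kk; rewrite k6 => {T1}/and5P[i21 ik /eqP ga c10 H].
split; [exact: i21 | exact: ik | exact: ga | exact: c10 | move=> l].
by case/orP: H => /andP[/eqP E1 /eqP E2]; [rewrite E1 | rewrite E2 E1 orbC].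
Qed.

Lemma row_sym k : 6 < k < 21 -> r (0, aff_inv k) = r (0, k).
Proof.
move=> kk; have [i21 ik ga c10 _] := aff_inv_facts kk; case/andP: kk => k6 kk.
have ic : (0, aff_inv k) \in cells by rewrite mem_cells.
rewrite /orbit_row ic mem_cells kk /= -(autE (hA k)) !h_V ?c00 // ga aff_act0 //.
by rewrite adjC.
Qed.

(** The row restricted to the orbit 0 is closed under inversion and has two elements; none is a
    translation by [no_short]. So it is {k, k^-1} with k of order 3. *)
Lemma row_specP : exists2 tc, 2 < tc < 10 & row_spec tc r.
Proof.
have r0 : r (0, 0) = false by rewrite /orbit_row (adj_irr srg) andbF.
have rs k : k < 7 -> r (0, k) = false.
  by case: k => // k kk; rewrite /orbit_row (negPf (no_short _)) ?andbF.
have : has (fun k => r (0, k)) (iota 0 21) by rewrite has_count -/(csize 0) csize0.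
case/hasP=> k; rewrite mem_iota => /andP[_ kk] rk.
have k6 : 6 < k < 21 by rewrite kk andbT ltnNge; apply: contraL rk => /rs ->.
have [i21 ik ga c10 cE] := aff_inv_facts k6.
have ri : r (0, aff_inv k) by rewrite row_sym.
rewrite eq_sym in ik.
have rE := count2_eq csize0 kk i21 rk ri ik.
exists (aff_class k) => //; split.
- exact: row_inc.
- move=> d dd; have T1 : all (fun d => 0 < class_rep d < 21) (iota 0 10) by vm_compute.
  have rd := all_iotaP T1 dd; have := row_diff rd.
  have /andP[_ rd21] := rd; rewrite (rE _ rd21) cE.
  have T2 : all (fun d => all (fun t => 2 <= nbr_overlap (class_rep d) + quota0 t d +
     ((class_rep d == class_rep t) || (class_rep d == aff_inv (class_rep t)))) (iota 0 10)) (iota 0 10) by vm_compute.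
  have /andP[_ ct] := c10.
  have := all_iotaP (all_iotaP T2 dd) ct; rewrite -/(dcount (class_rep d)).
  by move: (nbr_overlap _) (dcount _) (quota0 _ _) ((_ || _) : nat) => A B C D; lia.
by move=> l ll; rewrite rE // cE.
Qed.
End Row.

Section F21.
Variables (T : finType) (e : rel T).
Hypothesis srg : strongly_regular e 99 14 1 2.
Local Notation Aut := (graph_aut e).
Local Notation N := (nbhd e).
Variables (sg : {perm T}) (x a : T).
Hypotheses (sA : sg \in Aut) (o7 : #[sg]%g = 7) (sx : sg x = x) (xa : e x a) (sa : sg a != a).
Variable h : nat -> {perm T}.
Hypotheses (hA : forall k, h k \in Aut) (hx : forall k, h k x = x).
Hypothesis hP : forall k p, k < 21 -> p < 14 ->
  phik k p < 14 /\ h k (nbr_label e sg x a p) = nbr_label e sg x a (phik k p).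
Hypothesis no_short : forall z k, 0 < k < 7 -> ~~ e z (h k z).
Let b := mate e x a.
Local Notation Va := (far_label e sg x a).
Local Notation Vb := (far_label e sg x b).

Lemma mate_index_phik k p : k < 21 -> p < 14 -> phik k (mate_index p) = mate_index (phik k p).
Proof.
have T1 : all (fun k => all (fun p => phik k (mate_index p) == mate_index (phik k p)) (iota 0 14)) (iota 0 21).
  by vm_compute.
by move=> kk pp; apply/eqP; apply: (all_iotaP (all_iotaP T1 kk) pp).
Qed.

Lemma Pt_mate p : p < 14 -> nbr_label e sg x b p = nbr_label e sg x a (mate_index p).
Proof.
move=> pp; rewrite -(mate_Pt srg sA sx xa pp) /nbr_label.
rewrite -(sXmate srg sA sx) //; last by case: ifP => _ //; apply: (adj_x_mate srg xa).
by case: ifP => _ //; rewrite (mate_b srg xa).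
Qed.

Definition swpc (v : cell) : cell := (swap_orbit v.1, v.2).

Lemma swpc_cells v : v \in cells -> swpc v \in cells.
Proof. by move: v; apply/allP; vm_compute. Qed.

Lemma V_mate v : v \in cells -> Vb v = Va (swpc v).
Proof.
move=> vc; have /and4P[p14 q14 _ _] := ends_good vc.
rewrite /far_label /pair_label !Pt_mate //.
have /eqP-> // : ends (swpc v) == (mate_index (ends v).1, mate_index (ends v).2).
by move: v vc {p14 q14}; apply/allP; vm_compute.
Qed.

Lemma no_F21 : False.
Proof.
have adj_x_mate := adj_x_mate srg xa; have mate_moved := mate_moved srg sA sx xa sa; rewrite -/b in adj_x_mate mate_moved.
have hP' k p : k < 21 -> p < 14 -> phik k p < 14 /\ h k (nbr_label e sg x b p) = nbr_label e sg x b (phik k p).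
  move=> kk pp; have [q14 _] := hP kk pp; split=> //.
  by rewrite !Pt_mate // -mate_index_phik //; have [_ ->] := hP kk (mate_index_lt pp).
have h_Va k v : k < 21 -> v \in cells -> h k (Va v) = Va (aff_act k v).
  by move=> kk vc; apply: (h_V srg sA o7 sx xa sa hA hx hP).
have h_Vb k v : k < 21 -> v \in cells -> h k (Vb v) = Vb (aff_act k v).
  by move=> kk vc; apply: (h_V srg sA o7 sx adj_x_mate mate_moved hA hx hP').
have shortA k : 0 < k < 7 -> ~~ e (Va (0, 0)) (Va (0, k)).
  move=> k7; have kk : k < 21 by case/andP: k7 => _ k7; apply: leq_trans k7 _.
  by rewrite -(aff_act0 kk) -h_Va ?c00 // no_short.
have shortB k : 0 < k < 7 -> ~~ e (Vb (0, 0)) (Vb (0, k)).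
  move=> k7; have kk : k < 21 by case/andP: k7 => _ k7; apply: leq_trans k7 _.
  by rewrite -(aff_act0 kk) -h_Vb ?c00 // no_short.
have [tc tcP rP] := row_specP srg sA o7 sx xa sa hA hx hP shortA.
have [tc' tcP' rP'] := row_specP srg sA o7 sx adj_x_mate mate_moved hA hx hP' shortB.
apply: (no_rows tcP tcP' rP rP'); [exact: row_cells | exact: row_cells |].
move=> k kk; have c1k : (1, k) \in cells by rewrite mem_cells.
pose y := Va (0, 0); pose w := Va (1, k).
have wE : w = h k (Vb (0, 0)).
  rewrite (V_mate c00) h_Va ?swpc_cells ?c00 //; congr Va; apply/eqP.
  by move: k kk {c1k w}; apply: all_iotaP; vm_compute.
have yw : (y == w) = false by apply/eqP=> /(V_inj srg sA o7 sx xa sa c00 c1k).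
have := common_nbrs srg y w; rewrite yw (common_label srg sA o7 sx xa sa).
rewrite {1}/y (e_yx srg sA o7 sx xa sa).
have -> : count (fun p => e y (nbr_label e sg x a p) && e w (nbr_label e sg x a p)) (iota 0 14) = 0.
  have T1 : all (fun k => count (fun p => is_end p (0, 0) && is_end p (1, k)) (iota 0 14) == 0) (iota 0 21).
    by vm_compute.
  apply: etrans (eqP (all_iotaP T1 kk)); apply: eq_in_count => p; rewrite mem_iota => /andP[_ pp].
  rewrite (e_yPt srg sA o7 sx xa sa) // [e w _]adjC //.
  by rewrite (e_PtV srg sA o7 sx xa sa).
have -> : count (fun v => e y (Va v) && e w (Va v)) cells =
   count (fun v => orbit_row e sg x a v && orbit_row e sg x b (cross_shift k v)) cells.
  apply: eq_in_count => v vc; rewrite /orbit_row vc.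
  have T1 : all (fun k => all (fun v => [&& (v.1, aff_mul (aff_inv k) v.2) \in cells,
     aff_act k (v.1, aff_mul (aff_inv k) v.2) == v & swpc (cross_shift k v) == (v.1, aff_mul (aff_inv k) v.2)])
     cells) (iota 0 21) by vm_compute.
  have /and3P[uc /eqP gu /eqP su] := allP (all_iotaP T1 kk) v vc; clear T1.
  have gc : cross_shift k v \in cells.
    have -> : cross_shift k v = swpc (v.1, aff_mul (aff_inv k) v.2) by [].
    exact: swpc_cells.
  have ew : e w (Va v) = e (Vb (0, 0)) (Vb (cross_shift k v)).
    by rewrite wE -{1}gu -(h_Va _ _ kk uc) (autE (hA k)) (V_mate gc) su.
  by rewrite ew gc.
have -> : (e y w : nat) = orbit_row e sg x a (1, k) by rewrite /orbit_row c1k.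
by rewrite add0n.
Qed.
End F21.

(** * Vertices adjacent to a translate under an automorphism of order 7 *)

Lemma sum_cycle (gT : finGroupType) (s : gT) (F : gT -> nat) :
  \sum_(h in <[s]>%g) F h = \sum_(k <- iota 0 #[s]%g) F (s ^+ k)%g.
Proof.
have inj : {in iota 0 #[s]%g &, injective (fun k => (s ^+ k)%g)}.
  move=> i j; rewrite !mem_iota !add0n /= => il jl /eqP.
  by rewrite eq_expg_mod_order !modn_small // => /eqP.
have P : perm_eq [seq (s ^+ k)%g | k <- iota 0 #[s]%g] (enum <[s]>%g).
  apply: uniq_perm; rewrite ?enum_uniq ?map_inj_in_uniq ?iota_uniq // => h.
  rewrite mem_enum; apply/mapP/cycleP => [[k _ ->]|[i ->]]; first by exists k.
  exists (i %% #[s]%g); last by rewrite expg_mod_order.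
  by rewrite mem_iota add0n /= ltn_pmod // order_gt0.
by rewrite -big_enum -(perm_big _ P) big_map.
Qed.

Section Short.
Variables (T : finType) (e : rel T).
Hypothesis srg : strongly_regular e 99 14 1 2.
Local Notation Aut := (graph_aut e).
Variables (sg : {perm T}) (x : T).
Hypotheses (sA : sg \in Aut) (o7 : #[sg]%g = 7) (sx : sg x = x).
Hypothesis sfix : forall z, sg z = z -> z = x.

Lemma sgX_fix k z : 0 < k < 7 -> (sg ^+ k)%g z = z -> z = x.
Proof.
move=> /andP[k0 k7] E; apply/sfix/(prime_expg_fix (k := k) _ o7 _ E) => //.
by rewrite gtnNdvd.
Qed.

Lemma sg7 z : (sg ^+ 7)%g z = z.
Proof. by rewrite -o7 expg_order perm1. Qed.

Let f z k := e z ((sg ^+ k)%g z).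

Lemma short_sym z k : k <= 7 -> f z (7 - k) = f z k.
Proof.
move=> k7; rewrite /f -(autE (groupX k sA) z) -permM -expgD subnK // sg7.
by rewrite adjC.
Qed.

(** Put g = sg^k. The adjacent vertices z and g z would have both g^2 z and g^-1 z as common
    neighbours, so g^3 would fix z. *)
Lemma short_double z k : z != x -> 0 < k < 7 -> f z k -> f z (2 * k) -> False.
Proof.
move=> zx k7 fk f2; have gA := groupX k sA; set g := (sg ^+ k)%g in gA fk.
have g2 : (sg ^+ (2 * k))%g z = g (g z) by rewrite mul2n -addnn expgD permM.
have f2' : e z (g (g z)) by rewrite -g2.
pose w := (g^-1)%g z; have gw : g w = z by rewrite permKV.
have E : g (g z) = w.
  apply: (triangle_uniq srg fk) => //.
  - by rewrite (autE gA).
  - by rewrite adjC // -(autE gA) gw.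
  by rewrite adjC // -(autE gA) gw.
have : (sg ^+ (k * 3))%g z = z.
  by rewrite expgM -/g !expgS expg0 mulg1 !permM E gw.
move=> F3; case/eqP: zx; apply/sfix/(prime_expg_fix _ o7 _ F3) => //.
by rewrite Euclid_dvdM // negb_or gtnNdvd //; case/andP: k7.
Qed.

Definition short_set := [set z | has (f z) (iota 1 6)].

Lemma short_count z : \sum_(k <- iota 1 6) f z k = 2 * (z \in short_set).
Proof.
rewrite inE; have [->|zx] := eqVneq z x.
  rewrite big1_seq => [|k _]; last by rewrite /f (sXx sx) adj_irr.
  by rewrite (_ : has _ _ = false) //; apply/hasPn=> k _; rewrite /f (sXx sx) adj_irr.
(* Up to sign, doubling permutes 1, 2, 3 cyclically mod 7. So [short_double] excludes any two of
   them at once, and a short vertex is adjacent to its translates by one pair k, 7 - k only. *)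
have := @short_double z 1 zx isT; have := @short_double z 2 zx isT.
have := @short_double z 3 zx isT.
have := @short_sym z 1 isT; have := @short_sym z 2 isT; have := @short_sym z 3 isT.
rewrite /= unlock /= => -> -> ->.
by case: (f z 1); case: (f z 2); case: (f z 3) => //= H1 H2 H3; exfalso; auto.
Qed.

Lemma short_dvd : 49 %| #|short_set|.
Proof.
have sub : (<[sg]> \subset Aut)%g by rewrite cycle_subG.
have [r] := trace_count srg (H := <[sg]>%G) sub.
rewrite /= sum_cycle [#|<[sg]>%g|]o7 o7 big_cons expg0.
have -> : nshift e 1 = 0 by apply: eq_card0 => z; rewrite !inE perm1 adj_irr.
have -> : nfix (1 : {perm T})%g = 99.
  rewrite /nfix -(srg_card srg) -[RHS]cardsT; congr #|pred_of_set _|.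
  by apply/setP=> z; rewrite !inE perm1 eqxx.
have -> : \sum_(k <- iota 1 6) (nshift e (sg ^+ k)%g + 4 * nfix (sg ^+ k)%g) =
    2 * #|short_set| + 24.
  rewrite big_split; congr (_ + _).
    rewrite -sum1_card big_distrr.
    transitivity (\sum_z \sum_(k <- iota 1 6) f z k).
      rewrite exchange_big; apply: eq_bigr => k _; rewrite /nshift -sum1_card big_mkcond.
      by apply: eq_bigr => z _; rewrite inE /f; case: (e z ((sg ^+ k)%g z)).
    rewrite [RHS]big_mkcond; apply: eq_bigr => z _; rewrite short_count.
    by case: (z \in _).
  transitivity (\sum_(k <- iota 1 6) 4); last by rewrite unlock.
  apply: eq_big_seq => k; rewrite mem_iota => kk.
  rewrite /nfix (_ : [set z | _] = [set x]) ?cards1 //.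
  apply/setP=> z; rewrite !inE; apply/eqP/eqP => [/(sgX_fix kk) //|->].
  exact: (sXx sx).
(* 396 = 4 * 99 comes from the identity and 24 = 6 * 4 from the fixed vertex of the other six
   powers. *)
move=> H; have {}H : 396 + (2 * #|short_set| + 24) = 7 * (18 + 7 * r) := H.
rewrite -(@Gauss_dvdr 49 2) //.
have -> : 2 * #|short_set| = 49 * (r - 6) by lia.
exact: dvdn_mulr.
Qed.
End Short.

(** * Commuting involutions *)

Fixpoint bounded_rows n s q : seq (seq nat) :=
  if n is n'.+1 then
    flatten [seq [seq c :: l | l <- bounded_rows n' (s - c) (q - c * c)]
            | c <- iota 0 7 & (c <= s) && (c * c <= q)]
  else if s is 0 then if q is 0 then [:: [::]] else [::] else [::].

Definition sumsq (l : seq nat) := sumn [seq c * c | c <- l].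

(** The bound [q < 49] keeps every entry below 7, the range tried by [bounded_rows]. *)
Lemma mem_bounded_rows n s q l : size l = n -> sumn l = s -> sumsq l = q -> q < 49 -> l \in bounded_rows n s q.
Proof.
elim: n s q l => [|n IH] s q [|c l] //; first by move=> _ <- <-.
move=> [sl] Es Eq q49.
have Es' : c + sumn l = s by []; have Eq' : c * c + sumsq l = q by [].
apply/flatten_mapP; exists c.
  rewrite mem_filter mem_iota -Es' -Eq' !leq_addr /=.
  by move: q49; rewrite -Eq'; nia.
by apply: map_f; apply: IH; lia.
Qed.

Definition insert_at i d (l : seq nat) := take i l ++ d :: drop i l.
(* The row [i] has sum 12, sum of squares [36 - d] and diagonal entry [d]. *)
Definition diag_rows i := [seq insert_at i d l | d <- [:: 0; 2], l <- bounded_rows 5 (12 - d) (36 - d - d * d)].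
Fixpoint row_dot (l m : seq nat) := if l is a :: l' then if m is b :: m' then a * b + row_dot l' m' else 0 else 0.

Definition compatible_rows i R j R' :=
  if eqn (nth 0 R j) (nth 0 R' i) then eqn (row_dot R R' + nth 0 R j) 24 else false.

Fixpoint prune i R j (cs : seq (seq (seq nat))) :=
  if cs is c :: cs' then filter (compatible_rows i R j) c :: prune i R j.+1 cs' else [::].

(* [cs] lists the candidates for the rows [i], [i.+1], ... that remain compatible with those chosen. *)
Fixpoint no_matrix n i cs : bool :=
  if n is n'.+1 then
    if cs is c :: cs' then
      ~~ anyb (fun R => ~~ no_matrix n' i.+1 (prune i R i.+1 cs')) c
    else false
  else false.

Lemma diag_rows_no_matrix : no_matrix 6 0 [seq diag_rows i | i <- iota 0 6].
Proof. by vm_compute. Qed.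

Lemma nth_prune i R j cs t : t < size cs ->
  nth [::] (prune i R j cs) t = filter (compatible_rows i R (j + t)) (nth [::] cs t).
Proof.
elim: cs j t => [|c cs IH] j [|t] //= tc; first by rewrite addn0.
by rewrite IH // addSnnS.
Qed.

Lemma size_prune i R j cs : size (prune i R j cs) = size cs.
Proof. by elim: cs j => //= c cs IH j; rewrite IH. Qed.

Lemma no_matrix_sound (Rs : nat -> seq nat) n i cs : no_matrix n i cs -> size cs = n ->
  (forall t, t < n -> Rs (i + t) \in nth [::] cs t) ->
  (forall k l, k < l < i + n -> compatible_rows k (Rs k) l (Rs l)) -> False.
Proof.
elim: n i cs => // n IH i [|c cs] //=; rewrite anybE => /hasPn H [sc] mem co.
have := mem 0 isT; rewrite addn0 /= => /H; rewrite negbK => /IH; apply.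
- by rewrite size_prune.
- move=> t tn; rewrite nth_prune ?sc // mem_filter addSnnS (mem t.+1) // andbT.
  by apply: co; lia.
by move=> k l kl; apply: co; lia.
Qed.

(** The diagonal of C^2 + C = 24 J + 12 I gives row i the sum of squares 36 - C i i, whence finitely
    many candidates per row; the off-diagonal entries are the compatibility conditions of the
    backtracking. *)
Lemma no_quotient (C : nat -> nat -> nat) :
  (forall i j, i < 6 -> j < 6 -> C i j = C j i) ->
  (forall i, i < 6 -> \sum_(j <- iota 0 6) C i j = 12) ->
  (forall i j, i < 6 -> j < 6 ->
     \sum_(k <- iota 0 6) C i k * C k j + C i j = 24 + 12 * (i == j)) ->
  (forall i, i < 6 -> (C i i == 0) || (C i i == 2)) -> False.
Proof.
move=> sym row sq diag; pose Rs i := mkseq (C i) 6.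
apply: (@no_matrix_sound Rs 6 0 _ diag_rows_no_matrix) => //.
  move=> i i6; rewrite (nth_map 0) ?size_iota // nth_iota // !add0n.
  have D := diag i i6; have S1 := row i i6; have S2 := sq i i i6 i6.
  rewrite eqxx unlock /= in S1 S2.
  have insE : Rs i = insert_at i (C i i) (take i (Rs i) ++ drop i.+1 (Rs i)).
    case: i i6 {D S1 S2} => [|[|[|[|[|[|]]]]]] //.
  rewrite insE; apply/allpairsPdep; exists (C i i), (take i (Rs i) ++ drop i.+1 (Rs i)).
  split=> //; first by rewrite !inE.
  apply: mem_bounded_rows; last by lia.
  - by case: i i6 {D S1 S2 insE} => [|[|[|[|[|[|]]]]]].
  - by case: i i6 {D S2 insE} S1 => [|[|[|[|[|[|]]]]]] //= _; lia.
  by case: i i6 {D S1 insE} S2 => [|[|[|[|[|[|]]]]]] //= _; rewrite /sumsq /=;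
    rewrite ?(sym 1 0) ?(sym 2 0) ?(sym 3 0) ?(sym 4 0) ?(sym 5 0) ?(sym 2 1) ?(sym 3 1) ?(sym 4 1)
      ?(sym 5 1) ?(sym 3 2) ?(sym 4 2) ?(sym 5 2) ?(sym 4 3) ?(sym 5 3) ?(sym 5 4) //; lia.
move=> k l /andP[kl l6]; have k6 := ltn_trans kl l6.
have E : row_dot (Rs k) (Rs l) = \sum_(t <- iota 0 6) C k t * C t l.
  by rewrite unlock /= !(sym l) // !addn0.
rewrite /compatible_rows !eqnE E [in nth _ (Rs k)]/Rs [in nth _ (Rs l)]/Rs !nth_mkseq // (sym l) // eqxx.
by rewrite sq // (ltn_eqF kl).
Qed.

(* The action of [(sg * tau) ^+ l] on points; [bz] gives one cell in each of its 6 orbits. *)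
Definition zphi l p := 7 * ((p %/ 7 + l) %% 2) + (p %% 7 + l) %% 7.
Definition bz i : cell := if i < 3 then (0, 7 * i) else (2, 7 * (i - 3)).
Definition bcell i l := actc (zphi l) (bz i).

(** Up to sign the nonzero elements of Z/7 are 1, 2, 4. They give three orbits of pairs inside a
    heptad and three of mixed pairs, as the interchange reverses the sign of the difference. *)
Lemma bcells_perm : perm_eq [seq bcell i l | i <- iota 0 6, l <- iota 0 14] cells.
Proof. by vm_compute. Qed.

Lemma bz_cells i : i < 6 -> bz i \in cells.
Proof.
have T1 : all (fun i => bz i \in cells) (iota 0 6) by vm_compute.
exact: (all_iotaP T1).
Qed.

Lemma bcell_cells i l : i < 6 -> l < 14 -> bcell i l \in cells.
Proof.
move=> i6 l14; rewrite -(perm_mem bcells_perm); apply: allpairs_f; by rewrite mem_iota.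
Qed.

Lemma bcell_eq i j l : i < 6 -> j < 6 -> l < 14 -> (bz i == bcell j l) = (i == j) && (l == 0).
Proof.
have T1 : all (fun i => all (fun j => all (fun l => (bz i == bcell j l) == ((i == j) && (l == 0)))
  (iota 0 14)) (iota 0 6)) (iota 0 6) by vm_compute.
by move=> i6 j6 l14; have /eqP := all_iotaP (all_iotaP (all_iotaP T1 i6) j6) l14.
Qed.

Lemma sum_period n (g : nat -> nat) (F : nat -> nat) :
  perm_eq [seq g l %% n | l <- iota 0 n] (iota 0 n) -> (forall l, F (l %% n) = F l) ->
  \sum_(l <- iota 0 n) F (g l) = \sum_(l <- iota 0 n) F l.
Proof.
move=> P per; rewrite -[RHS](perm_big _ P) big_map.
by apply: eq_bigr => l _; rewrite per.
Qed.

Section Z14.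
Variables (T : finType) (e : rel T).
Hypothesis srg : strongly_regular e 99 14 1 2.
Local Notation Aut := (graph_aut e).
Local Notation N := (nbhd e).
Variables (sg : {perm T}) (x a : T).
Hypotheses (sA : sg \in Aut) (o7 : #[sg]%g = 7) (sx : sg x = x) (xa : e x a) (sa : sg a != a).
Hypothesis sfix : forall z, sg z = z -> z = x.
Local Notation Pt := (nbr_label e sg x a).
Local Notation V := (far_label e sg x a).

Lemma sgX_Pt k p : p < 14 -> (sg ^+ k)%g (Pt p) = Pt (7 * (p %/ 7) + (p %% 7 + k) %% 7).
Proof.
move=> pp; rewrite {1}/nbr_label -permM -expgD -(sXmod o7).
case: (ltnP p 7) => p7.
  by rewrite (Pt_a e x a o7) modn_mod divn_small.
have -> : p %/ 7 = 1 by move: p7 pp; clear; lia.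
by rewrite (Pt_b e x a o7) modn_mod muln1.
Qed.

Variable tau : {perm T}.
Hypotheses (tA : tau \in Aut) (tx : tau x = x) (tt : (tau * tau = 1)%g).
Hypotheses (tP : forall p, p < 14 -> tau (Pt p) = Pt (mate_index p)) (ts : commute sg tau).

Let gm := (sg * tau)%g.
Let h l := (gm ^+ l)%g.
Local Notation y i := (V (bz i)).

Lemma gmA : gm \in Aut. Proof. exact: groupM. Qed.
Lemma hA l : h l \in Aut. Proof. exact: groupX gmA. Qed.
Lemma gmx : gm x = x. Proof. by rewrite permM sx tx. Qed.
Lemma hx l : h l x = x.
Proof. by rewrite /h; elim: l => [|l IH]; rewrite ?perm1 // expgSr permM IH gmx. Qed.

Lemma zphi_lt l p : zphi l p < 14.
Proof.
have : (p %% 7 + l) %% 7 < 7 by rewrite ltn_pmod.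
have : (p %/ 7 + l) %% 2 < 2 by rewrite ltn_pmod.
by rewrite /zphi; lia.
Qed.

Lemma zphiS l p : p < 14 -> zphi l.+1 p = mate_index (7 * (zphi l p %/ 7) + (zphi l p %% 7 + 1) %% 7).
Proof.
move=> pp; rewrite /zphi /mate_index; clear -pp.
by case: ifP; lia.
Qed.

Lemma hP l p : p < 14 -> zphi l p < 14 /\ h l (Pt p) = Pt (zphi l p).
Proof.
move=> pp; split; first exact: zphi_lt.
elim: l => [|l IH].
  rewrite perm1 /zphi !addn0 modn_mod; congr Pt.
  by apply/eqP; move: p pp; apply: all_iotaP; vm_compute.
rewrite /h expgSr permM -/(h l) IH /gm permM -[sg]expg1 sgX_Pt ?zphi_lt //.
rewrite zphiS // tP //.
by have := zphi_lt l p; clear; lia.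
Qed.

Lemma h_y i l : i < 6 -> h l (y i) = V (bcell i l).
Proof.
move=> i6; apply: (act_V srg sA o7 sx xa sa (hA l) (hx l)) (bz_cells i6) => p.
exact: hP.
Qed.

Lemma gm14 : (gm ^+ 14 = 1)%g.
Proof.
rewrite expgMn // -[14]/(7 * 2) expgM -o7 expg_order expg1n mul1g mulnC expgM.
by rewrite expgS expg1 tt expg1n.
Qed.

Lemma h_mod l : h (l %% 14) = h l.
Proof. by rewrite /h -(expg_mod l gm14). Qed.

Lemma hD l m z : h (l + m) z = h m (h l z).
Proof. by rewrite /h expgD permM. Qed.

Lemma h_even k z : h (2 * k) z = (sg ^+ (2 * k))%g z.
Proof. by rewrite /h expgMn // [in X in (_ * X)%g]expgM expgS expg1 tt expg1n mulg1. Qed.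

Lemma short_h l z : (h l z \in short_set e sg) = (z \in short_set e sg).
Proof.
rewrite !inE; apply: eq_has => k.
have cm : (sg ^+ k * h l = h l * sg ^+ k)%g.
  apply: commuteX2; rewrite /gm; apply: commuteM => //; exact: commute_refl.
by rewrite -permM -cm permM (autE (hA l)).
Qed.

Lemma card_label (A : {set T}) : #|A| = (x \in A)
  + count (fun p => Pt p \in A) (iota 0 14) + count (fun v => V v \in A) cells.
Proof.
rewrite -(count_label srg sA o7 sx xa sa (fun z => z \in A)).
exact: eq_card.
Qed.

Lemma x_short : (x \in short_set e sg) = false.
Proof.
by apply/negbTE; rewrite inE; apply/hasPn=> k _; rewrite (sXx sx) (adj_irr srg).
Qed.

Lemma Pt_short p : p < 14 -> (Pt p \in short_set e sg) = false.
Proof.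
move=> pp; apply/negbTE; rewrite inE; apply/hasPn=> k _.
have qq : 7 * (p %/ 7) + (p %% 7 + k) %% 7 < 14.
  have : (p %% 7 + k) %% 7 < 7 by rewrite ltn_pmod.
  by move: pp; clear; lia.
rewrite sgX_Pt // (e_Pt srg sA o7 sx xa sa) // /mate_index.
have : (p %% 7 + k) %% 7 < 7 by rewrite ltn_pmod.
by move: pp; clear; case: ifP; lia.
Qed.

(** A neighbour of [x] is adjacent in [N x] only to its mate, in the other heptad, so short vertices
    are cells. Their number is 14 c with c <= 6, and 49 divides it only for c = 0. *)
Lemma short_empty z : z \in short_set e sg = false.
Proof.
have d49 := short_dvd srg sA o7 sx sfix.
have E : #|short_set e sg| = 14 * \sum_(i <- iota 0 6) (y i \in short_set e sg).
  rewrite card_label x_short (@eq_in_count _ _ pred0) ?count_pred0; last first.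
    by move=> p; rewrite mem_iota => /= pp; rewrite Pt_short.
  rewrite -(seq.permP bcells_perm) countE big_allpairs_dep big_distrr.
  apply: eq_big_seq => i; rewrite mem_iota => /= i6.
  transitivity (\sum_(l <- iota 0 14) (y i \in short_set e sg)).
    by apply: eq_bigr => l _; rewrite -h_y // short_h.
  by rewrite big_const_seq count_predT size_iota iter_addn_0 mulnC.
have c6 : \sum_(i <- iota 0 6) (y i \in short_set e sg) <= 6.
  by rewrite -countE; apply: leq_trans (count_size _ _) _; rewrite size_iota.
have c0 : #|short_set e sg| = 0.
  rewrite E; move: d49; rewrite E -[49]/(7 * 7) -[14]/(7 * 2) -mulnA dvdn_pmul2l //.
  by rewrite Gauss_dvdr // => /dvdnP[k]; lia.
by move/cards0_eq: c0 ->; rewrite inE.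
Qed.

Lemma h7_fix z : h 7 z = z -> z = x.
Proof.
have F : nfix (h 7) = 1.
  rewrite (nfix_label srg sA o7 sx xa sa (hA 7) (hx 7) (phi := zphi 7) (fun p => hP 7 (p := p))).
  by vm_compute.
have /eqP/cards1P[w E] := F.
have : x \in [set z | h 7 z == z] by rewrite inE hx.
rewrite E inE => /eqP -> hz; apply/eqP; rewrite -in_set1 -E inE; exact/eqP.
Qed.

(** [h 7] is an involution fixing only [x]. If it moved the vertex to a neighbour, it would fix the
    third vertex of their triangle, which would then be [x]. *)
Lemma h7_nadj v : v \in cells -> ~~ e (V v) (h 7 (V v)).
Proof.
move=> vc; apply/negP=> ve; have hh z : h 7 (h 7 z) = z.
  by rewrite -hD -h_mod /h expg0 perm1.
pose w := mate e (V v) (h 7 (V v)).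
have /andP[vw hw] := mateP srg ve.
have : h 7 w = w.
  apply: (triangle_uniq srg ve _ _ vw hw); first by rewrite -(autE (hA 7)) hh.
  by rewrite (autE (hA 7)).
by move/h7_fix=> wx; move: vw; rewrite -/w wx adjC // (e_xV srg sA o7 sx xa sa vc).
Qed.

(* Number of neighbours of [y i] in the orbit of [y j]. *)
Definition quotient_entry i j := \sum_(l <- iota 0 14) e (y i) (h l (y j)).

Lemma h14 z : h 14 z = z. Proof. by rewrite -h_mod /h expg0 perm1. Qed.

Lemma quo_shift m i j : m < 14 ->
  \sum_(l <- iota 0 14) e (h l (y i)) (h m (y j)) = quotient_entry j i.
Proof.
move=> m14.
rewrite /quotient_entry -(@sum_period 14 (fun l => l + (14 - m)) (fun l => e (y j) (h l (y i)))).
- apply: eq_bigr => l _; rewrite hD adjC // -(autE (hA (14 - m))) -hD.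
  by rewrite subnKC ?h14 // ltnW.
- by move: m m14; apply: all_iotaP; vm_compute.
by move=> l; rewrite h_mod.
Qed.

Lemma quo_sym i j : quotient_entry i j = quotient_entry j i.
Proof.
rewrite /quotient_entry -[RHS](@sum_period 14 (fun l => l * 13) (fun l => e (y j) (h l (y i)))) //; last first.
  by move=> l; rewrite h_mod.
apply: eq_bigr => l _; rewrite -(autE (hA (l * 13))) -hD -mulnS adjC //.
by rewrite -(h_mod (l * 14)) modnMl /h expg0 perm1.
Qed.

Lemma y_neq i j l : i < 6 -> j < 6 -> l < 14 -> (y i == h l (y j)) = (i == j) && (l == 0).
Proof.
move=> i6 j6 l14; rewrite h_y // -(bcell_eq i6 j6 l14); apply/eqP/eqP => [|->//].
by apply: (V_inj srg sA o7 sx xa sa); [apply: bz_cells | apply: bcell_cells].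
Qed.

Lemma count_cells (Q : pred T) : count (fun v => Q (V v)) cells =
  \sum_(k <- iota 0 6) \sum_(m <- iota 0 14) Q (h m (y k)).
Proof.
rewrite -(seq.permP bcells_perm) countE big_allpairs_dep.
apply: eq_big_seq => k; rewrite mem_iota => /= k6.
by apply: eq_bigr => m _; rewrite h_y.
Qed.

Lemma e_orbit_Pt i p : i < 6 -> p < 14 -> e (y i) (Pt p) = is_end p (bz i).
Proof. by move=> i6 p14; rewrite adjC // (e_PtV srg sA o7 sx xa sa p14 (bz_cells i6)). Qed.

Lemma e_orbit_x i : i < 6 -> e (y i) x = false.
Proof. by move=> i6; rewrite adjC // (e_xV srg sA o7 sx xa sa (bz_cells i6)). Qed.

Lemma quo_row i : i < 6 -> \sum_(j <- iota 0 6) quotient_entry i j = 12.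
Proof.
move=> i6; have := srg_reg srg (y i).
rewrite card_label inE e_orbit_x // (@eq_in_count _ _ (fun p => is_end p (bz i))); last first.
  by move=> p; rewrite mem_iota inE => /= pp; rewrite e_orbit_Pt.
have -> : count (fun p => is_end p (bz i)) (iota 0 14) = 2 by apply: on2; apply: bz_cells.
rewrite (@eq_count _ _ (fun v => e (y i) (V v))); last by move=> v; rewrite inE.
by rewrite count_cells => -[].
Qed.

Lemma quo_sq i j : i < 6 -> j < 6 ->
  \sum_(k <- iota 0 6) quotient_entry i k * quotient_entry k j + quotient_entry i j = 24 + 12 * (i == j).
Proof.
move=> i6 j6.
have S1 : \sum_(l <- iota 0 14) #|N (y i) :&: N (h l (y j))| + quotient_entry i j = 28 + 12 * (i == j).
  rewrite /quotient_entry -big_split.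
  transitivity (\sum_(l <- iota 0 14) (2 + 12 * ((i == j) && (l == 0)))).
    apply: eq_big_seq => l; rewrite mem_iota => /andP[_ l14].
    by rewrite [LHS](common_nbrs srg) y_neq.
  by case: (i == j); rewrite unlock.
(* The group of order 14 is regular on the 14 neighbours of [x], so each of the 2 * 2 pairs of ends
   coincides for one translate. This 4 turns 28 = 14 * 2 into the 24 of the statement. *)
have S2 : \sum_(l <- iota 0 14) #|N (y i) :&: N (h l (y j))| =
    4 + \sum_(k <- iota 0 6) quotient_entry i k * quotient_entry k j.
  transitivity (\sum_(l <- iota 0 14) (count (fun p => is_end p (bz i) && is_end p (bcell j l)) (iota 0 14)
     + \sum_(k <- iota 0 6) \sum_(m <- iota 0 14) (e (y i) (h m (y k)) && e (h l (y j)) (h m (y k))))).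
    apply: eq_big_seq => l; rewrite mem_iota => /andP[_ l14].
    rewrite (common_label srg sA o7 sx xa sa) e_orbit_x // andFb add0n; congr (_ + _).
      apply: eq_in_count => p; rewrite mem_iota => /andP[_ pp].
      by rewrite e_orbit_Pt // h_y // [e (V _) _]adjC // (e_PtV srg sA o7 sx xa sa pp) // bcell_cells.
    exact: (count_cells (fun z => e (y i) z && e (h l (y j)) z)).
  rewrite big_split; congr (_ + _).
    have T1 : all (fun i => all (fun j => sumn [seq count (fun p => is_end p (bz i) &&
        is_end p (bcell j l)) (iota 0 14) | l <- iota 0 14] == 4) (iota 0 6)) (iota 0 6).
      by vm_compute.
    have /eqP E := all_iotaP (all_iotaP T1 i6) j6.
    by rewrite -[RHS]E sumnE big_map.
  rewrite exchange_big; apply: eq_bigr => k _.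
  rewrite exchange_big {1}/quotient_entry big_distrl.
  apply: eq_big_seq => m; rewrite mem_iota => /andP[_ m14].
  rewrite -(quo_shift j k m14) big_distrr; apply: eq_bigr => l _.
  by case: (e (y i) _); case: (e (h l _) _).
by move: S1; rewrite S2; lia.
Qed.

Let g i l := e (y i) (h l (y i)).

Lemma g_adj i l m : e (h l (y i)) (h m (y i)) = g i ((m + 13 * l) %% 14).
Proof.
rewrite -(autE (hA (13 * l))) -!hD -mulSn -[h (14 * l)]h_mod mulnC modnMl.
by rewrite /g h_mod /h expg0 perm1 mulnC.
Qed.

Lemma g_sym i l : l <= 14 -> g i (14 - l) = g i l.
Proof.
move=> l14; rewrite /g -[LHS](autE (hA l)) -hD subnK // -[h 14]h_mod /h expg0 perm1.
exact: adjC.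
Qed.

Lemma g0 i : g i 0 = false. Proof. by rewrite /g /h expg0 perm1 (adj_irr srg). Qed.

Lemma g_even i k : 0 < k < 7 -> g i (2 * k) = false.
Proof.
move=> k7; apply/negbTE; have := short_empty (y i); rewrite /g h_even inE => /negbT/hasPn.
rewrite -(sXmod o7); apply; rewrite mem_iota.
by move: k7; clear; lia.
Qed.

Lemma h_y_neq i l m : i < 6 -> l < 14 -> m < 14 -> l != m -> h l (y i) != h m (y i).
Proof.
move=> i6 l14 m14 lm; rewrite !h_y //; apply/eqP.
move=> /(V_inj srg sA o7 sx xa sa (bcell_cells i6 l14) (bcell_cells i6 m14)) E.
have T1 : all (fun i => all (fun l => all (fun m => (bcell i l == bcell i m) == (l == m))
    (iota 0 14)) (iota 0 14)) (iota 0 6) by vm_compute.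
have := all_iotaP (all_iotaP (all_iotaP T1 i6) l14) m14.
by rewrite E eqxx (negPf lm).
Qed.

Lemma g_triple i k l m n : i < 6 -> k < 14 -> l < 14 -> m < 14 -> n < 14 ->
  uniq [:: 0; m; n] -> k != l ->
  g i ((0 + 13 * k) %% 14) -> g i ((0 + 13 * l) %% 14) ->
  g i ((m + 13 * k) %% 14) -> g i ((m + 13 * l) %% 14) ->
  g i ((n + 13 * k) %% 14) -> g i ((n + 13 * l) %% 14) -> False.
Proof.
move=> i6 k14 l14 m14 n14 + kl; rewrite -!g_adj /= !inE !negb_or andbT.
move=> /andP[/andP[m0 n0] mn] a1 a2 a3 a4 a5 a6.
apply: (no_three_common srg (h_y_neq i6 k14 l14 kl) _ a1 a2 a3 a4 a5 a6).
by rewrite /= !inE !negb_or !h_y_neq.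
Qed.

Lemma quo_diag i : i < 6 -> (quotient_entry i i == 0) || (quotient_entry i i == 2).
Proof.
(* If [y i] were adjacent to its translates by two of the shifts 1, 3, 5, then two translates of
   [y i] would have three common neighbours. *)
move=> i6; have T1 : ~~ (g i 1 && g i 3).
  apply/negP=> /andP[g1 g3]; have g13 := g_sym i (isT : 1 <= 14); have g11 := g_sym i (isT : 3 <= 14).
  rewrite g1 in g13; rewrite g3 in g11.
  exact: (@g_triple i 1 13 2 12).
have T2 : ~~ (g i 3 && g i 5).
  apply/negP=> /andP[g3 g5]; have g11 := g_sym i (isT : 3 <= 14); have g9 := g_sym i (isT : 5 <= 14).
  rewrite g3 in g11; rewrite g5 in g9.
  exact: (@g_triple i 3 11 6 8).
have T3 : ~~ (g i 5 && g i 1).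
  apply/negP=> /andP[g5 g1]; have g13 := g_sym i (isT : 1 <= 14); have g9 := g_sym i (isT : 5 <= 14).
  rewrite g1 in g13; rewrite g5 in g9.
  exact: (@g_triple i 5 9 10 4).
have E : quotient_entry i i = \sum_(l <- iota 0 14) g i l by [].
have s1 := g_sym i (isT : 1 <= 14); have s3 := g_sym i (isT : 3 <= 14).
have s5 := g_sym i (isT : 5 <= 14).
have e1 := @g_even i 1 isT; have e2 := @g_even i 2 isT; have e3 := @g_even i 3 isT.
have e4 := @g_even i 4 isT; have e5 := @g_even i 5 isT; have e6 := @g_even i 6 isT.
have g7 : g i 7 = false by apply/negbTE/h7_nadj/bz_cells.
have z := g0 i.
rewrite E unlock; move: T1 T2 T3 s1 s3 s5 e1 e2 e3 e4 e5 e6 g7 z.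
move: (g i) => G; rewrite /= => T1 T2 T3 -> -> -> -> -> -> -> -> -> -> ->.
by case: (G 1) T1 T3; case: (G 3) T2; case: (G 5).
Qed.

Lemma no_Z14 : False.
Proof.
apply: (no_quotient (C := quotient_entry)); [|exact: quo_row|exact: quo_sq|exact: quo_diag].
by move=> i j _ _; apply: quo_sym.
Qed.
End Z14.

(** * The normalizer of an automorphism of order 7 *)

Lemma phik_lt k p : p < 14 -> phik k p < 14.
Proof.
move=> pp; rewrite /phik.
have : (pow2 (k %/ 7) * (p %% 7) + k %% 7) %% 7 < 7 by rewrite ltn_pmod.
by move: (pow2 _ * _ + _) => m; lia.
Qed.

Section Frob21.
Variables (T : finType) (e : rel T).
Hypothesis srg : strongly_regular e 99 14 1 2.
Local Notation Aut := (graph_aut e).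
Variables (sg : {perm T}) (x a : T).
Hypotheses (sA : sg \in Aut) (o7 : #[sg]%g = 7) (sx : sg x = x) (xa : e x a) (sa : sg a != a).
Hypothesis sfix : forall z, sg z = z -> z = x.
Local Notation Pt := (nbr_label e sg x a).
Local Notation V := (far_label e sg x a).
Variable rho : {perm T}.
Hypotheses (rA : rho \in Aut) (rx : rho x = x).
Hypothesis rP : forall p, p < 14 -> rho (Pt p) = Pt (phik 7 p).

Let h k := (rho ^+ (k %/ 7) * sg ^+ (k %% 7))%g.

Lemma frob_hA k : h k \in Aut. Proof. by rewrite groupM ?groupX. Qed.
Lemma frob_hx k : h k x = x.
Proof.
rewrite /h permM (_ : (rho ^+ _)%g x = x) ?(sXx sx) //.
by elim: (k %/ 7) => [|j IH]; rewrite ?perm1 // expgSr permM IH.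
Qed.

Lemma frob_hP k p : k < 21 -> p < 14 -> phik k p < 14 /\ h k (Pt p) = Pt (phik k p).
Proof.
have L j q : phik j q %% 7 < 7 by rewrite ltn_pmod.
have T1 : all (fun k => all (fun p => (phik k p < 14) &&
   (phik k p == 7 * (iter (k %/ 7) (phik 7) p %/ 7) + (iter (k %/ 7) (phik 7) p %% 7 + k %% 7) %% 7))
   (iota 0 14)) (iota 0 21) by vm_compute.
move=> kk pp; have := all_iotaP (all_iotaP T1 kk) pp => {T1}/andP[-> /eqP E]; split=> //.
have R j : iter j (phik 7) p < 14 /\ (rho ^+ j)%g (Pt p) = Pt (iter j (phik 7) p).
  elim: j => [|j [l14 IH]]; first by rewrite perm1.
  rewrite expgSr permM IH rP //; split=> //; exact: phik_lt.
have [l14 Er] := R (k %/ 7).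
by rewrite /h permM Er (sgX_Pt _ _ _ o7) // -E.
Qed.

Lemma frob_hV k v : k < 21 -> v \in cells -> h k (V v) = V (aff_act k v).
Proof. exact: (h_V srg sA o7 sx xa sa frob_hA frob_hx frob_hP). Qed.

(** [h l] normalizes <[sg]>, and conjugation by it permutes the six nontrivial powers of [sg]. *)
Lemma short_V o l : o < 4 -> l < 21 ->
  (V (o, l) \in short_set e sg) = (V (o, 0) \in short_set e sg).
Proof.
move=> o4 l21; pose c k := aff_mul (aff_inv l) (aff_mul k l).
have oc k : k < 21 -> (o, k) \in cells by move=> kk; rewrite mem_cells o4.
have hk k m : 0 < k < 7 -> m < 21 -> (sg ^+ k)%g (V (o, m)) = V (o, aff_mul k m).
  move=> /andP[k0 k7] m21.
  have -> : (sg ^+ k = h k)%g by rewrite /h divn_small // modn_small // mul1g.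
  by rewrite frob_hV ?oc // (leq_trans k7).
have T1 : all (fun l => perm_eq [seq aff_mul (aff_inv l) (aff_mul k l) | k <- iota 1 6] (iota 1 6) &&
    (aff_act l (0, 0) == (0, l)) &&
    all (fun k => (aff_act l (0, aff_mul (aff_inv l) (aff_mul k l)) == (0, aff_mul k l)) &&
      (aff_mul (aff_inv l) (aff_mul k l) < 21) && (aff_mul k 0 == k)) (iota 0 7)) (iota 0 21) by vm_compute.
have /andP[/andP[P G0] G] := all_iotaP T1 l21; clear T1.
rewrite !inE -[RHS](eq_has_r (perm_mem P)) has_map.
apply: eq_in_has => k; rewrite mem_iota => /= kk.
have k7 : k < 7 by case/andP: kk.
have /andP[/andP[Gk c21] k0] := all_iotaP G k7.
have ck : 0 < c k < 7.
  have : c k \in iota 1 6 by rewrite -(perm_mem P); apply: map_f; rewrite mem_iota.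
  by rewrite mem_iota.
have /andP[_ /eqP ck0] := all_iotaP G (proj2 (andP ck)).
rewrite /= hk // hk // ck0.
have gE m n : aff_act l (0, m) == (0, n) -> aff_act l (o, m) = (o, n).
  by rewrite /aff_act /= => /eqP[->].
by rewrite -(gE _ _ G0) -(gE _ _ Gk) -!frob_hV ?oc // (autE (frob_hA l)).
Qed.

Lemma frob_short z : z \in short_set e sg = false.
Proof.
have d49 := short_dvd srg sA o7 sx sfix.
have E : #|short_set e sg| = 21 * \sum_(o <- iota 0 4) (V (o, 0) \in short_set e sg).
  rewrite (card_label srg sA o7 sx xa sa) (x_short srg sx).
  rewrite (@eq_in_count _ _ pred0) ?count_pred0; last first.
    by move=> p; rewrite mem_iota => /= pp; rewrite (Pt_short srg sA o7 sx xa sa).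
  rewrite countE sum_cells big_distrr.
  apply: eq_big_seq => o; rewrite mem_iota => /andP[_ o4].
  transitivity (\sum_(l <- iota 0 21) (V (o, 0) \in short_set e sg)).
    by apply: eq_big_seq => l; rewrite mem_iota => /andP[_ l21]; rewrite short_V.
  by rewrite big_const_seq count_predT size_iota iter_addn_0 mulnC.
have c4 : \sum_(o <- iota 0 4) (V (o, 0) \in short_set e sg) <= 4.
  by rewrite -countE; apply: leq_trans (count_size _ _) _; rewrite size_iota.
have c0 : #|short_set e sg| = 0.
  rewrite E; move: d49; rewrite E -[49]/(7 * 7) -[21]/(7 * 3) -mulnA dvdn_pmul2l //.
  by rewrite Gauss_dvdr // => /dvdnP[k]; lia.
by move/cards0_eq: c0 ->; rewrite inE.
Qed.

Lemma no_Frob21 : False.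
Proof.
apply: (no_F21 srg sA o7 sx xa sa frob_hA frob_hx frob_hP) => z k k7.
have := frob_short z; rewrite inE => /negbT/hasPn.
have -> : (h k = sg ^+ k)%g by case/andP: k7 => _ k7; rewrite /h divn_small // modn_small // mul1g.
by apply; rewrite mem_iota.
Qed.
End Frob21.

(** * Automorphisms inverting an automorphism of order 7 *)

Fixpoint all_bits n (P : seq bool -> bool) : bool :=
  if n is n'.+1 then
    if all_bits n' (fun s => P (false :: s)) then all_bits n' (fun s => P (true :: s)) else false
  else P [::].

Lemma all_bitsP n P : all_bits n P -> forall s, size s = n -> P s.
Proof.
elim: n P => [|n IH] P /=; first by move=> Pn [].
by case: ifP => // H0 H1 [|[] s] // [sz]; [apply: (IH _ H1) | apply: (IH _ H0)].
Qed.

(* A graph on 6 vertices is encoded by the 15 entries of its adjacency matrix below the diagonal. *)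
Definition bit_adj (s : seq bool) i j :=
  if i == j then false else let m := minn i j in let n := maxn i j in
  nth false s (n * n.-1 %/ 2 + m).
Definition bit_tab s := mkseq (fun i => mkseq (bit_adj s i) 6) 6.
Definition one_third (r1 r2 : seq bool) :=
  eqn (count id (map (fun p => if p.1 then p.2 else false) (zip r1 r2))) 1.
(* If every edge is in exactly one triangle, the sum of [d (d - 1)] over the degrees is not 1 or 4
   mod 7. *)
Definition six_ok s :=
  let t := bit_tab s in
  if anyb (fun i => let r := nth [::] t i in
       anyb (fun j => if nth false r j then ~~ one_third r (nth [::] t j) else false) (iota 0 i)) (iota 0 6)
  then true
  else let gs := map (count id) t in
    let k := (sumn (map (fun g => g * g.-1) gs)) %% 7 in
    if eqn k 1 then false else if eqn k 4 then false else true.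

Lemma six_okT : all_bits 15 six_ok.
Proof. by vm_compute. Qed.

(** The map i |-> - i on both heptads, composed with the interchange of the heptads when [m]
    holds. *)
Definition diph (m : bool) p :=
  let q := 7 * (p %/ 7) + (7 - p %% 7) %% 7 in if m then mate_index q else q.

Lemma diph_facts b p : p < 14 -> (diph b p < 14) && (diph b (diph b p) == p).
Proof.
have T1 c : all (fun p => (diph c p < 14) && (diph c (diph c p) == p)) (iota 0 14).
  by case: c; vm_compute.
by move=> pp; apply: (all_iotaP (T1 b) pp).
Qed.

Section Dih.
Variables (T : finType) (e : rel T).
Hypothesis srg : strongly_regular e 99 14 1 2.
Local Notation Aut := (graph_aut e).
Local Notation N := (nbhd e).
Variables (sg : {perm T}) (x a : T).
Hypotheses (sA : sg \in Aut) (o7 : #[sg]%g = 7) (sx : sg x = x) (xa : e x a) (sa : sg a != a).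
Local Notation Pt := (nbr_label e sg x a).
Local Notation V := (far_label e sg x a).
Variables (t : {perm T}) (m : bool).
Hypotheses (tA : t \in Aut) (tx : t x = x).
Hypothesis tP' : forall p, p < 14 -> t (Pt p) = Pt (diph m p).

Let phi := diph m.
Lemma diph_lt p : p < 14 -> phi p < 14.
Proof. by case/(diph_facts m)/andP. Qed.

Lemma dih_P p : p < 14 -> phi p < 14 /\ t (Pt p) = Pt (phi p).
Proof. by move=> pp; rewrite diph_lt // tP'. Qed.

Lemma dih_involution : (t * t = 1)%g.
Proof.
apply: (@aut_fix_nbhd _ _ srg _ x (groupM tA tA)) => [|u xu]; first by rewrite permM !tx.
have [p pp ->] := ptP srg sA o7 sx xa sa xu; rewrite permM.
have [qq ->] := dih_P pp; have [_ ->] := dih_P qq.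
by have /andP[_ /eqP E] := diph_facts m pp; rewrite /phi E.
Qed.

Lemma dih_neq1 : t != 1%g.
Proof.
apply/eqP=> t1; have [q14 E] := dih_P (isT : 1 < 14).
have := Pt_inj srg sA o7 sx xa sa (isT : 1 < 14) q14; rewrite -E t1 perm1 => /(_ erefl).
by rewrite /phi /diph; case: (m).
Qed.

Definition fixed_cells := filter (fun v => actc (diph m) v == v) cells.
Definition fixed_points := filter (fun p => diph m p == p) (iota 0 14).

Lemma sum_fix (F : T -> nat) : \sum_(z in fixset t) F z =
  F x + \sum_(p <- fixed_points) F (Pt p) + \sum_(v <- fixed_cells) F (V v).
Proof.
rewrite big_mkcond (sum_label srg sA o7 sx xa sa) inE tx eqxx; congr (_ + _ + _).
  rewrite /fixed_points big_filter [RHS]big_mkcond; apply: eq_big_seq => p.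
  rewrite mem_iota => /andP[_ pp]; rewrite inE.
  by rewrite (fix_Pt srg sA o7 sx xa sa dih_P).
rewrite /fixed_cells big_filter [RHS]big_mkcond; apply: eq_big_seq => v vc; rewrite inE.
by rewrite (fix_V srg sA o7 sx xa sa tA tx dih_P).
Qed.

Lemma nfn_fix u : nfn e t u = e u x + count (fun p => e u (Pt p)) fixed_points + count (fun v => e u (V v)) fixed_cells.
Proof.
have -> : nfn e t u = \sum_(z in fixset t) e u z.
  rewrite /nfn -sum1_card [LHS]big_mkcond [RHS]big_mkcond; apply: eq_bigr => z _.
  by rewrite !inE; case: (e u z); case: (t z == z).
by rewrite sum_fix !countE.
Qed.
Definition far_adj v w := e (V v) (V w).

Lemma fixed_cells_cells v : v \in fixed_cells -> v \in cells. Proof. by rewrite mem_filter => /andP[]. Qed.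

(** A pair is fixed if its elements are exchanged or both fixed, and the only possible fixed
    neighbours of [x], the two elements 0, are mates. So the fixed cells are isolated from the other
    fixed vertices. *)
Lemma fixed_cells_on p v : p \in fixed_points -> v \in fixed_cells -> is_end p v = false.
Proof.
have T1 : all (fun b => all (fun p => all (fun v => is_end p v == false)
  (filter (fun v => actc (diph b) v == v) cells)) (filter (fun p => diph b p == p) (iota 0 14))) [:: true; false].
  by vm_compute.
move=> pp vv; have bb : m \in [:: true; false] by case: (m).
by have /eqP := allP (allP (allP T1 m bb) p pp) v vv.
Qed.

Lemma nfn_V v : v \in fixed_cells -> nfn e t (V v) = count (far_adj v) fixed_cells.
Proof.
move=> vL; have vc := fixed_cells_cells vL.
rewrite nfn_fix adjC // (e_xV srg sA o7 sx xa sa vc) add0n.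
rewrite (@eq_in_count _ _ pred0) ?count_pred0 // => p pP.
have pp : p < 14 by move: pP; rewrite mem_filter mem_iota => /andP[_ /andP[]].
by rewrite adjC // (e_PtV srg sA o7 sx xa sa pp vc) fixed_cells_on.
Qed.

(** The third vertex of a triangle on two fixed vertices is fixed; by [fixed_cells_on] it is again a
    cell. *)
Lemma far_adj_third v w : v \in fixed_cells -> w \in fixed_cells -> far_adj v w ->
  count (fun u => far_adj v u && far_adj w u) fixed_cells = 1.
Proof.
move=> vL wL vw; have vc := fixed_cells_cells vL; have wc := fixed_cells_cells wL.
have fixL u : u \in fixed_cells -> t (V u) = V u.
  move=> uL; apply/eqP; rewrite (fix_V srg sA o7 sx xa sa tA tx dih_P (fixed_cells_cells uL)).
  by move: uL; rewrite mem_filter => /andP[].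
have /andP[vz wz] := mateP srg vw; move: (mate _ _ _) vz wz => z vz wz.
have tz : t z = z.
  apply: (triangle_uniq srg vw _ _ vz wz).
    by rewrite -[V v]fixL // (autE tA).
  by rewrite -[V w]fixL // (autE tA).
have zx : z != x.
  by apply: contraTneq vz => ->; rewrite adjC // (e_xV srg sA o7 sx xa sa vc).
have xz : ~~ e x z.
  apply/negP=> xz; have [p pp Ez] := ptP srg sA o7 sx xa sa xz.
  have pP : p \in fixed_points.
    by rewrite mem_filter -(fix_Pt srg sA o7 sx xa sa dih_P) // -Ez tz eqxx mem_iota.
  by move: vz; rewrite Ez adjC // (e_PtV srg sA o7 sx xa sa pp vc) fixed_cells_on.
have [u uc Ez] := labelP srg sA o7 sx xa sa zx xz.
have uL : u \in fixed_cells.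
  by rewrite mem_filter uc -(fix_V srg sA o7 sx xa sa tA tx dih_P) // -Ez tz eqxx.
have uq : uniq fixed_cells by rewrite filter_uniq // cells_uniq.
transitivity (count_mem u fixed_cells); last by rewrite (count_uniq_mem u uq) uL.
apply: eq_in_count => u' uL'; apply/andP/eqP => [[vu wu]|->]; last by rewrite /far_adj -Ez.
apply: (V_inj srg sA o7 sx xa sa (fixed_cells_cells uL') uc); rewrite -Ez.
exact: (triangle_uniq srg vw).
Qed.

Lemma nfn_x : nfn e t x = size fixed_points.
Proof.
rewrite nfn_fix (adj_irr srg) add0n (@eq_in_count _ _ predT) ?count_predT.
  rewrite (@eq_in_count _ _ pred0) ?count_pred0 ?addn0 // => v /fixed_cells_cells vc.
  exact: (e_xV srg sA o7 sx xa sa vc).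
by move=> p _; rewrite (x_Pt srg sA sx xa).
Qed.

Lemma nfn_Pt p : p \in fixed_points -> nfn e t (Pt p) = 1 + count (fun q => q == mate_index p) fixed_points.
Proof.
move=> pP; have lt q : q \in fixed_points -> q < 14.
  by rewrite mem_filter mem_iota => /andP[_ /andP[]].
rewrite nfn_fix adjC // (x_Pt srg sA sx xa).
rewrite (@eq_in_count _ (fun v => e (Pt p) (V v)) pred0) ?count_pred0 ?addn0.
  congr (_ + _); apply: eq_in_count => q qP.
  by rewrite (e_Pt srg sA o7 sx xa sa) ?lt.
by move=> v vL; rewrite (e_PtV srg sA o7 sx xa sa (lt _ pP) (fixed_cells_cells vL)) fixed_cells_on.
Qed.
End Dih.

Lemma one_third_map (A : eqType) (f : rel A) v w L :
  one_third [seq f v u | u <- L] [seq f w u | u <- L] = (count (fun u => f v u && f w u) L == 1).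
Proof.
rewrite /one_third eqnE; congr (_ == _).
by elim: L => //= u L ->; case: (f v u).
Qed.

Lemma six_vertices (A : eqType) (f : rel A) (L : seq A) : size L = 6 ->
  symmetric f -> irreflexive f ->
  (forall v w, v \in L -> w \in L -> f v w -> count (fun u => f v u && f w u) L = 1) ->
  let k := (\sum_(v <- L) count (f v) L * (count (f v) L).-1) %% 7 in (k != 1) && (k != 4).
Proof.
case: L => [|v0 [|v1 [|v2 [|v3 [|v4 [|v5 [|]]]]]]] // _ sym irr third.
set L := [:: v0; v1; v2; v3; v4; v5].
pose s := [:: f v0 v1; f v0 v2; f v1 v2; f v0 v3; f v1 v3; f v2 v3; f v0 v4; f v1 v4;
  f v2 v4; f v3 v4; f v0 v5; f v1 v5; f v2 v5; f v3 v5; f v4 v5].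
have tabE : bit_tab s = [seq [seq f v w | w <- L] | v <- L].
  rewrite /L /= !irr (sym v1 v0) (sym v2 v0) (sym v3 v0) (sym v4 v0) (sym v5 v0) (sym v2 v1)
   (sym v3 v1) (sym v4 v1) (sym v5 v1) (sym v3 v2) (sym v4 v2) (sym v5 v2) (sym v4 v3) (sym v5 v3)
   (sym v5 v4).
  by [].
have := all_bitsP six_okT (s := s) erefl; rewrite /six_ok tabE anybE.
case: ifP => [/hasP[i]|_].
  rewrite mem_iota => /andP[_ i6]; rewrite anybE => /hasP[j].
  rewrite mem_iota => /andP[_ ji]; have j6 := ltn_trans ji i6.
  have iL : nth v0 L i \in L by apply: mem_nth.
  have jL : nth v0 L j \in L by apply: mem_nth.
  rewrite !(nth_map v0) //; case: ifP => // ij.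
  by rewrite one_third_map third.
cbv zeta; rewrite !eqnE; set k := _ %% 7; set k' := _ %% 7.
have -> : k = k'.
  rewrite /k /k' sumnE 3!big_map; congr (_ %% 7); apply: eq_bigr => v _.
by case: (k' == 1); case: (k' == 4).
Qed.

Section Dih2.
Variables (T : finType) (e : rel T).
Hypothesis srg : strongly_regular e 99 14 1 2.
Local Notation Aut := (graph_aut e).
Variables (sg : {perm T}) (x a : T).
Hypotheses (sA : sg \in Aut) (o7 : #[sg]%g = 7) (sx : sg x = x) (xa : e x a) (sa : sg a != a).
Local Notation Pt := (nbr_label e sg x a).
Local Notation V := (far_label e sg x a).
Variables (t : {perm T}) (m : bool).
Hypotheses (tA : t \in Aut) (tx : t x = x).
Hypothesis tP : forall p, p < 14 -> t (Pt p) = Pt (diph m p).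

Lemma no_Dih : False.
Proof.
have := fix_trace srg tA (dih_involution srg sA o7 sx xa sa tA tx tP) (dih_neq1 srg sA o7 sx xa sa tP).
pose Ld := far_adj e sg x a.
have szL : size (fixed_cells m) = 6 by case: (m); vm_compute.
have symL : symmetric Ld by move=> v w; apply: adjC.
have irrL : irreflexive Ld by move=> v; apply: (adj_irr srg).
have := six_vertices szL symL irrL (far_adj_third srg sA o7 sx xa sa tA tx tP).
set K := \sum_(v <- _) _ => /= /andP[K1 K4].
pose S1 := \sum_(v <- fixed_cells m) count (Ld v) (fixed_cells m).
have sf := sum_fix srg sA o7 sx xa sa tA tx tP.
have nP : \sum_(z in fixset t) 1 = 1 + size (fixed_points m) + 6.
  by rewrite sf !big_const_seq !count_predT !iter_addn_0 !mul1n szL.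
rewrite sum1_card in nP.
pose c p := 1 + count (fun q => q == mate_index p) (fixed_points m).
have E1 : fix_degree_sum e t = size (fixed_points m) + \sum_(p <- fixed_points m) c p + S1.
  rewrite /fix_degree_sum sf (nfn_x srg sA o7 sx xa sa tA tx tP); congr (_ + _ + _).
    by apply: eq_big_seq => p pP; rewrite (nfn_Pt srg sA o7 sx xa sa tA tx tP pP).
  by apply: eq_big_seq => v vL; rewrite (nfn_V srg sA o7 sx xa sa tA tx tP vL).
have E2 : fix_degree_sq_sum e t = size (fixed_points m) ^ 2 + \sum_(p <- fixed_points m) c p ^ 2 + (S1 + K).
  rewrite /fix_degree_sq_sum sf (nfn_x srg sA o7 sx xa sa tA tx tP); congr (_ + _ + _).
    by apply: eq_big_seq => p pP; rewrite (nfn_Pt srg sA o7 sx xa sa tA tx tP pP).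
  rewrite -big_split; apply: eq_big_seq => v vL.
  rewrite (nfn_V srg sA o7 sx xa sa tA tx tP vL) -mulnn.
  by case: (count _ _) => // k; apply: mulnS.
(* Without the interchange there are 9 fixed vertices and [fix_trace] reads K = 1 mod 7; with it
   there are 7 and K = 4 mod 7. Both are excluded by [six_vertices]. *)
have [] : [/\ size (fixed_points m) = 2, \sum_(p <- fixed_points m) c p = 4 & \sum_(p <- fixed_points m) c p ^ 2 = 8]
   \/ [/\ size (fixed_points m) = 0, \sum_(p <- fixed_points m) c p = 0 & \sum_(p <- fixed_points m) c p ^ 2 = 0].
  by rewrite unlock /c; case: (m); [right | left]; split; vm_compute.
all: move=> [z1 z2 z3]; rewrite E1 E2 nP z1 z2 z3; move: K1 K4; clear; lia.
Qed.
End Dih2.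

Definition mphi (m : bool) r p :=
  let q := 7 * (p %/ 7) + (r * (p %% 7)) %% 7 in if m then mate_index q else q.

Lemma mphi_lt m r p : p < 14 -> mphi m r p < 14.
Proof.
move=> pp; rewrite /mphi; have r7 : (r * (p %% 7)) %% 7 < 7 by rewrite ltn_pmod.
have q14 : 7 * (p %/ 7) + (r * (p %% 7)) %% 7 < 14 by move: r7; set y := _ %% 7 => {}; move: pp; clear; lia.
by case: m => //; apply: mate_index_lt.
Qed.

(** * A group of order 7 is its own normalizer *)

Section Normalizer.
Variables (T : finType) (e : rel T).
Hypothesis srg : strongly_regular e 99 14 1 2.
Local Notation Aut := (graph_aut e).

Lemma fixpoint7 (s : {perm T}) : #[s]%g = 7 -> exists x, s x = x.
Proof.
move=> o7; have pg : (7.-group <[s]>)%g by rewrite /pgroup -orderE o7 pnat_id.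
have := pgroup_fix_mod (to := ('P)%act) (S := [set: T]) pg.
rewrite cardsT (srg_card srg) => /(_ _)/eqP.
have -> : [acts <[s]>, on [set: T] | 'P]%g by apply/actsP => g _ z; rewrite !inE.
move/(_ isT); case: (set_0Vmem ('Fix_([set: T] | 'P)(<[s]>))%g) => [->|[x]].
  by rewrite cards0.
rewrite !inE /= => /subsetP/(_ s (cycle_id s)); rewrite inE /= apermE => /eqP sx _; by exists x.
Qed.

Lemma moved_nbr (s : {perm T}) x : s \in Aut -> s x = x -> s != 1%g ->
  exists2 a, e x a & s a != a.
Proof.
move=> sA sx s1; case: (pickP (fun a => e x a && (s a != a))) => [a /andP[xa sa]|H].
  by exists a.
case/eqP: s1; apply: (@aut_fix_nbhd _ _ srg _ x sA sx) => u xu.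
by have := H u; rewrite xu /= => /negbFE/eqP.
Qed.

Lemma order7_frame s : s \in Aut -> #[s]%g = 7 ->
  exists x a, [/\ s x = x, e x a, s a != a & forall z, s z = z -> z = x].
Proof.
move=> sA o7; have [x sx] := fixpoint7 o7.
have s1 : s != 1%g by rewrite -order_eq1 o7.
have [a xa sa] := moved_nbr sA sx s1; exists x, a; split=> // z sz.
have hP p : p < 14 -> phik 1 p < 14 /\ s (nbr_label e s x a p) = nbr_label e s x a (phik 1 p).
  move=> pp; split; first exact: phik_lt.
  have := sgX_Pt e x a o7 1 pp; rewrite expg1 => ->; congr (nbr_label _ _ _ _ _).
  by rewrite /phik mul1n modnDml addnC [_ + 7 * _]addnC.
have [//|zx] := eqVneq z x; have [xz|xz] := boolP (e x z).
  have [p pp E] := ptP srg sA o7 sx xa sa xz.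
  have := fix_Pt srg sA o7 sx xa sa hP pp; rewrite -E sz eqxx => /esym/eqP.
  have T1 : all (fun p => phik 1 p != p) (iota 0 14) by vm_compute.
  by move=> Ep; have := all_iotaP T1 pp; rewrite Ep eqxx.
have [v vc E] := labelP srg sA o7 sx xa sa zx xz.
have := fix_V srg sA o7 sx xa sa sA sx hP vc; rewrite -E sz eqxx => /esym/eqP.
have T1 : all (fun v => actc (phik 1) v != v) cells by vm_compute.
by move=> Ep; have := allP T1 v vc; rewrite Ep eqxx.
Qed.

Section Frame.
Variables (s : {perm T}) (x a : T).
Hypotheses (sA : s \in Aut) (o7 : #[s]%g = 7) (sx : s x = x) (xa : e x a) (sa : s a != a).
Hypothesis sfix : forall z, s z = z -> z = x.
Local Notation Pt := (nbr_label e s x a).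

Lemma norm_expg g r k z : (s ^ g = s ^+ r)%g -> g ((s ^+ k)%g z) = (s ^+ (r * k))%g (g z).
Proof. by move=> sg; rewrite -permJ conjXg sg -expgM. Qed.

Lemma norm_fix g r : (s ^ g = s ^+ r)%g -> g x = x.
Proof.
move=> sg; apply: sfix; apply: (prime_expg_fix (k := r) _ o7) => //; last by rewrite -sg permJ sx.
apply/negP=> r7; have : #[s ^ g]%g = 7 by rewrite orderJ.
by move: r7; rewrite sg -{1}o7 order_dvdn => /eqP->; rewrite order1.
Qed.

Lemma norm_Pt g r (m : bool) : g \in Aut -> (s ^ g = s ^+ r)%g -> g a = Pt (7 * m) ->
  forall p, p < 14 -> g (Pt p) = Pt (mphi m r p).
Proof.
move=> gA sg ga p pp; have gx := norm_fix sg.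
have m14 : 7 * m < 14 by case: (m).
have gb : g (mate e x a) = Pt (mate_index (7 * m)).
  by rewrite (aut_mate srg gA xa) gx ga (mate_Pt srg sA sx xa).
have o14 := mate_index_lt m14.
rewrite {1}/nbr_label (norm_expg _ _ sg) -(sXmod o7) /mphi.
have := ltn_pmod (r * (p %% 7)) (isT : 0 < 7); set q := _ %% 7 => q7.
case: (ltnP p 7) => p7.
  rewrite ga (sgX_Pt _ _ _ o7) // (divn_small p7); congr (nbr_label _ _ _ _ _); rewrite /mate_index muln0 add0n q7.
  by case: (m) => /=; move: q7; clear; lia.
have -> : p %/ 7 = 1 by move: p7 pp; clear; lia.
rewrite gb (sgX_Pt _ _ _ o7) //; congr (nbr_label _ _ _ _ _); have n7 : (7 + q < 7) = false by move: q7; clear; lia.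
rewrite /mate_index muln1 n7.
by case: (m) => /=; move: q7; clear; lia.
Qed.

Lemma iter_Pt (g : {perm T}) f j : (forall p, p < 14 -> f p < 14 /\ g (Pt p) = Pt (f p)) ->
  forall p, p < 14 -> (g ^+ j)%g (Pt p) = Pt (iter j f p).
Proof.
move=> H; elim: j => [|j IH] p pp; first by rewrite perm1.
have [fp E] := H p pp; rewrite expgS permM E iterSr; exact: IH.
Qed.

Lemma norm_trivial g r (m : bool) : g \in Aut -> (s ^ g = s ^+ r)%g -> r < 7 ->
  g a = Pt (7 * m) -> g = 1%g.
Proof.
move=> gA sg r7 ga; have gx := norm_fix sg.
have gjA j : (g ^+ j)%g \in Aut by apply: groupX.
have gjx j : (g ^+ j)%g x = x by elim: j => [|j IH]; rewrite ?perm1 // expgSr permM IH.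
have gP j p : p < 14 -> (g ^+ j)%g (Pt p) = Pt (iter j (mphi m r) p).
  by apply: iter_Pt => q qq; split; [apply: mphi_lt | apply: norm_Pt].
have gE j f : all (fun p => iter j (mphi m r) p == f p) (iota 0 14) ->
    forall p, p < 14 -> (g ^+ j)%g (Pt p) = Pt (f p).
  by move=> H p pp; rewrite gP //; congr (nbr_label _ _ _ _ _); apply/eqP; apply: all_iotaP H p pp.
have g1 j : all (fun p => iter j (mphi m r) p == p) (iota 0 14) -> (g ^+ j)%g = 1%g.
  move=> /(gE j id) H; apply: (@aut_fix_nbhd _ _ srg _ x (gjA j) (gjx j)) => u xu.
  have [p pp ->] := ptP srg sA o7 sx xa sa xu; exact: H.
have F21 j : all (fun p => iter j (mphi m r) p == phik 7 p) (iota 0 14) -> False.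
  by move=> /gE; apply: (no_Frob21 srg sA o7 sx xa sa sfix).
have Dih j : all (fun p => iter j (mphi m r) p == diph m p) (iota 0 14) -> False.
  by move=> /gE; apply: (no_Dih srg sA o7 sx xa sa).
move: sg r7 gE g1 F21 Dih {gP ga}.
case: r => [|[|[|[|[|[|[|r]]]]]]] // sg _ gE g1 F21 Dih.
(* According to [r], a power of [g] is the interchange of the heptads, or acts as [i |-> 2 i] or as
   [i |-> - i], up to that interchange. *)
- have : #[s ^ g]%g = 7 by rewrite orderJ.
  by rewrite sg order1.
- case: m gE g1 F21 Dih => gE g1 F21 Dih; last by apply: (g1 1); vm_compute.
  case: (@no_Z14 _ _ srg s x a sA o7 sx xa sa sfix g) => //.
  + by have := g1 2; rewrite expgS expg1; apply; vm_compute.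
  + by move=> p pp; have := gE 1 mate_index _ p pp; rewrite expg1; apply; vm_compute.
  by apply/commgP/conjg_fixP.
(* 2^4 = 4^2 = 2 mod 7 with even exponents, which cancel the interchange; 3^3 = 5^3 = -1 with odd
   exponents, which keep it. *)
- by case: (F21 4); case: (m); vm_compute.
- by case: (Dih 3); case: (m); vm_compute.
- by case: (F21 2); case: (m); vm_compute.
- by case: (Dih 3); case: (m); vm_compute.
by case: (Dih 1); case: (m); vm_compute.
Qed.

End Frame.

Lemma self_normalizing (s g : {perm T}) : s \in Aut -> #[s]%g = 7 -> g \in Aut ->
  g \in ('N(<[s]>))%g -> g \in <[s]>%g.
Proof.
move=> sA o7 gA gN; have [x [a [sx xa sa sfix]]] := order7_frame sA o7.
have /cycleP[r sg] : (s ^ g)%g \in <[s]>%g by rewrite memJ_norm ?cycle_id.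
have gx := norm_fix o7 sx sfix sg.
have [q qq ga] : exists2 q, q < 14 & g a = nbr_label e s x a q.
  by apply: (ptP srg sA o7 sx xa sa); rewrite -{1}gx autE.
(* This power of [s] brings the image of [a] back to the element 0 of its heptad, as [norm_trivial]
   requires. *)
pose k := 7 - q %% 7; suff : (g * s ^+ k)%g = 1%g.
  by move/eqP; rewrite -eq_invg_mul => /eqP; rewrite -groupV => ->; apply: groupX; apply: cycle_id.
apply: (@norm_trivial s x a sA o7 sx xa sa sfix _ (r %% 7) (7 <= q)).
- by rewrite groupM // groupX.
- by rewrite conjgM sg -o7 expg_mod_order; apply/conjg_fixP/commgP/commuteX2.
- by rewrite ltn_pmod.
rewrite permM ga (sgX_Pt _ _ _ o7) // /k subnKC; last by rewrite ltnW // ltn_pmod.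
rewrite modnn addn0; congr (nbr_label _ _ _ _ (7 * _)).
by move: qq; clear; lia.
Qed.

End Normalizer.

(** * Groups normalized by an automorphism of order 7 *)

Fixpoint bitseqs n : seq bitseq :=
  if n is n'.+1 then map (cons true) (bitseqs n') ++ map (cons false) (bitseqs n') else [:: [::]].

Lemma mem_bitseqs (b : bitseq) : b \in bitseqs (size b).
Proof.
elim: b => [|c b IH] //=; rewrite mem_cat; case: c; apply/orP; [left|right]; exact: map_f.
Qed.

Definition xorseq (b c : bitseq) : bitseq := [seq i.1 (+) i.2 | i <- zip b c].
(* [nth false b i] tells whether the points [i] and [i + 7] are exchanged. *)
Definition flip (b : bitseq) p := if nth false b (p %% 7) then mate_index p else p.
(** For w ones this is 1 + 2 (7 - w)^2, since a fixed cell must have both ends fixed: two exchanged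
    points are mates and form no cell. *)
Definition flip_nfix b := 1 + count (fun p => flip b p == p) (iota 0 14)
  + count (fun v => actc (flip b) v == v) cells.
(* The bits of the product of the 7 conjugates of an element under the powers of [s]. *)
Definition norm_bits b := iter 6 (fun c => xorseq b (rotr 1 c)) b.
Definition in_gap n := 19 <= n <= 91.

(* The number of ones is 2 or 4 in the first case, 6 in the second, odd in the third. *)
Lemma bits_dichotomy b : size b = 7 -> b != nseq 7 false ->
  [|| in_gap (flip_nfix b), in_gap (flip_nfix (xorseq b (rotr 1 b))) | norm_bits b == nseq 7 true].
Proof.
move=> sb; have mb : b \in bitseqs 7 by have := mem_bitseqs b; rewrite sb.
have T1 : all (fun b => (b != nseq 7 false) ==> [|| in_gap (flip_nfix b),
   in_gap (flip_nfix (xorseq b (rotr 1 b))) | norm_bits b == nseq 7 true]) (bitseqs 7).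
  by vm_compute.
exact: (implyP (allP T1 b mb)).
Qed.

Lemma flip_lt b p : p < 14 -> flip b p < 14.
Proof. by move=> pp; rewrite /flip; case: ifP => // _; apply: mate_index_lt. Qed.

Lemma flip_xor b c p : size b = 7 -> size c = 7 -> p < 14 -> flip c (flip b p) = flip (xorseq b c) p.
Proof.
move=> sb sc pp; have p7 := ltn_pmod p (isT : 0 < 7).
have oo : mate_index p %% 7 = p %% 7.
  by rewrite /mate_index; case: ltnP => p77; move: pp p77; clear; lia.
have ooo : mate_index (mate_index p) = p.
  by rewrite /mate_index; case: (ltnP p 7) => p77; [have -> : (p + 7 < 7) = false|have -> : (p - 7 < 7) = true];
   move: pp p77; clear; lia.
rewrite /flip /xorseq (nth_map (false, false)) ?size_zip ?sb ?sc // nth_zip ?sb ?sc //=.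
by case: (nth _ b _) => /=; rewrite ?oo; case: (nth _ c _).
Qed.

Definition shiftp p := 7 * (p %/ 7) + (p %% 7 + 1) %% 7.

Lemma flip_rotr b p : size b = 7 -> p < 14 -> flip (rotr 1 b) (shiftp p) = shiftp (flip b p).
Proof.
move=> sb pp; have mb : b \in bitseqs 7 by have := mem_bitseqs b; rewrite sb.
have T1 : all (fun b => all (fun p => flip (rotr 1 b) (shiftp p) == shiftp (flip b p)) (iota 0 14))
  (bitseqs 7) by vm_compute.
exact: (eqP (all_iotaP (allP T1 b mb) pp)).
Qed.

Lemma shiftp_lt p : p < 14 -> shiftp p < 14.
Proof. by rewrite /shiftp => pp; move: pp; clear; lia. Qed.

Lemma shiftp_surj p : p < 14 -> exists2 q, q < 14 & p = shiftp q.
Proof.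
move=> pp; exists (7 * (p %/ 7) + (p %% 7 + 6) %% 7); rewrite /shiftp; move: pp; clear; lia.
Qed.

Section FixedPointGroup.
Variables (T : finType) (e : rel T).
Hypothesis srg : strongly_regular e 99 14 1 2.
Local Notation Aut := (graph_aut e).
Variables (s : {perm T}) (x a : T).
Hypotheses (sA : s \in Aut) (o7 : #[s]%g = 7) (sx : s x = x) (xa : e x a) (sa : s a != a).
Local Notation Pt := (nbr_label e s x a).
Variable Q : {group {perm T}}.
Hypotheses (QA : Q \subset Aut) (sQ : s \in ('N(Q))%g) (cQ : ('C_Q[s] = 1)%g) (Q7 : coprime #|Q| 7).
Hypothesis Qx : forall u, u \in Q -> u x = x.

Definition flip_code (b : bitseq) := size b = 7 /\
  exists2 u, u \in Q & forall p, p < 14 -> u (Pt p) = Pt (flip b p).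

Lemma code_xor b c : flip_code b -> flip_code c -> flip_code (xorseq b c).
Proof.
move=> [sb [u uQ uP]] [sc [v vQ vP]]; split; first by rewrite size_map size_zip sb sc.
exists (u * v)%g => [|p pp]; first exact: groupM.
by rewrite permM uP // vP ?flip_lt // flip_xor.
Qed.

Lemma code_rotr b : flip_code b -> flip_code (rotr 1 b).
Proof.
move=> [sb [u uQ uP]]; split; first by rewrite size_rotr.
exists (u ^ s)%g => [|p pp]; first by rewrite memJ_norm.
have [q qq ->] := shiftp_surj pp; rewrite flip_rotr //.
have sP r : r < 14 -> s (Pt r) = Pt (shiftp r).
  by move=> rr; have := sgX_Pt e x a o7 1 rr; rewrite expg1.
by rewrite -!sP ?flip_lt // permJ uP.
Qed.

Lemma code_gap b : flip_code b -> ~~ in_gap (flip_nfix b).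
Proof.
move=> [sb [u uQ uP]]; have uA := subsetP QA u uQ.
have uP' p : p < 14 -> flip b p < 14 /\ u (Pt p) = Pt (flip b p) by move=> pp; rewrite flip_lt ?uP.
rewrite /flip_nfix -(nfix_label srg sA o7 sx xa sa uA (Qx uQ) uP').
exact: (nfix_gap srg uA).
Qed.

(** Interchanging all mates commutes with [s], contrary to the triviality of the centralizer. *)
Lemma code_not_ones : ~ flip_code (nseq 7 true).
Proof.
move=> [_ [w wQ wP]]; have wA := subsetP QA w wQ.
have sP r : r < 14 -> s (Pt r) = Pt (shiftp r).
  by move=> rr; have := sgX_Pt e x a o7 1 rr; rewrite expg1.
have ws : (w * s = s * w)%g.
  apply/eqP; rewrite eq_mulgV1; apply/eqP; apply: (@aut_fix_nbhd _ _ srg _ x).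
  - by rewrite !(groupM, groupV).
  - by rewrite permM; apply: (canLR (permK (s * w)%g)); rewrite !permM sx Qx.
  move=> u xu; have [p pp ->] := ptP srg sA o7 sx xa sa xu.
  rewrite permM; apply: (canLR (permK (s * w)%g)).
  rewrite !permM sP // !wP ?flip_lt ?shiftp_lt // sP ?flip_lt //; congr (nbr_label _ _ _ _ _).
  by rewrite -[nseq 7 true]/(rotr 1 (nseq 7 true)) flip_rotr.
have : w \in ('C_Q[s])%g by rewrite inE wQ; apply/cent1P; rewrite /commute.
rewrite cQ => /set1P w1; have := wP 0 isT; rewrite w1 perm1 => /eqP.
by rewrite (Pt_eq srg sA o7 sx xa sa).
Qed.

Lemma code_trivial b : flip_code b -> b = nseq 7 false.
Proof.
move=> cb; apply/eqP; apply/negPn/negP => b0; have [sb _] := cb.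
have gap c : flip_code c -> in_gap (flip_nfix c) -> False.
  by move/code_gap/negP.
case/or3P: (bits_dichotomy sb b0); [exact: gap|exact/gap/code_xor/code_rotr|].
move/eqP=> E; apply: code_not_ones; rewrite -E /norm_bits.
elim: 6 => //= n IH; exact/code_xor/code_rotr.
Qed.

Definition mate_pair i := [set Pt i; Pt (i + 7)].
Definition mate_pairs := [set mate_pair i | i : 'I_7].
Local Notation act := (('P^*)%act).

Lemma block_eq i j : i < 7 -> j < 7 -> mate_pair i = mate_pair j -> i = j.
Proof.
move=> i7 j7 E; have : Pt i \in mate_pair j by rewrite -E !inE eqxx.
by rewrite !inE !(Pt_eq srg sA o7 sx xa sa); move: i7 j7; clear; lia.
Qed.

Lemma act_block u i p : u \in Aut -> u x = x -> i < 7 -> p < 14 -> u (Pt i) = Pt p ->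
  act (mate_pair i) u = mate_pair (p %% 7).
Proof.
move=> uA ux i7 pp uE; have i14 : i < 14 by move: i7; clear; lia.
have uE' : u (Pt (i + 7)) = Pt (mate_index p).
  have -> : i + 7 = mate_index i by rewrite /mate_index i7.
  by rewrite -!(mate_Pt srg sA sx xa) // (aut_mate srg uA) ?(x_Pt srg sA sx xa) // ux uE.
have E : act (mate_pair i) u = [set Pt p; Pt (mate_index p)].
  by rewrite /= /setact imsetU1 imset_set1 /= /aperm uE uE'.
rewrite E /mate_pair /mate_index; case: (ltnP p 7) => p7; first by rewrite modn_small.
have -> : p %% 7 = p - 7 by move: pp p7; clear; lia.
by rewrite subnK // setUC.
Qed.

Lemma acts_blocks : [acts Q, on mate_pairs | act]%g.
Proof.
apply/actsP => u uQ A; have act_sub v A' : v \in Q -> A' \in mate_pairs -> act A' v \in mate_pairs.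
  move=> vQ /imsetP[i _ ->]; have vA := subsetP QA v vQ; have [i7 vx] := (ltn_ord i, Qx vQ).
  have [p pp vE] : exists2 p, p < 14 & v (Pt i) = Pt p.
    by apply: (ptP srg sA o7 sx xa sa); rewrite -{1}vx autE // (x_Pt srg sA sx xa).
  rewrite (act_block vA vx i7 pp vE); apply/imsetP.
  by exists (Ordinal (ltn_pmod p (isT : 0 < 7))).
apply/idP/idP => [H|]; last exact: act_sub.
by rewrite -[A](actK act u); apply: act_sub; rewrite ?groupV.
Qed.

Lemma card_blocks : #|mate_pairs| = 7.
Proof.
rewrite card_imset ?card_ord // => i j /block_eq E; apply: val_inj; exact: E (ltn_ord i) (ltn_ord j).
Qed.

Lemma orbit_block i : i < 7 -> #|orbit act Q (mate_pair i)| = #|orbit act Q (mate_pair 0)|.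
Proof.
move=> i7; have sxi : (s ^+ i)%g x = x by apply: sXx.
have sE : (s ^+ i)%g (Pt 0) = Pt i by rewrite (sgX_Pt _ _ _ o7) // modn_small.
have := act_block (groupX i sA) sxi (isT : 0 < 7) (leq_trans i7 (isT : 7 <= 14)) sE.
rewrite modn_small // => <-.
rewrite !card_orbit -!divgS ?subsetIl //; congr (_ %/ _).
rewrite -(cardJg ('C_Q[mate_pair 0 | act])%g (s ^+ i)%g) conjIg (normP (groupX i sQ)).
by rewrite -astab1_act.
Qed.

(** Since [s] normalizes [Q] and permutes the seven pairs transitively, the orbits of [Q] on them
    have equal length, a common divisor of 7 and |Q|. *)
Lemma block_fixed u i : u \in Q -> i < 7 -> act (mate_pair i) u = mate_pair i.
Proof.
move=> uQ i7; set m := #|orbit act Q (mate_pair 0)|.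
have := card_uniform_partition (n := m) _ (orbit_partition acts_blocks).
rewrite card_blocks => /(_ _)H.
have m7 : m %| 7.
  rewrite H ?dvdn_mull // => A /imsetP[B /imsetP[j _ ->] ->]; exact: orbit_block.
have mQ : m %| #|Q| by apply: dvdn_orbit.
have m1 : m = 1 by apply/eqP; rewrite -dvdn1 -(eqP Q7) dvdn_gcd mQ.
have := card_orbit1 (etrans (orbit_block i7) m1).
by move/setP/(_ (act (mate_pair i) u)); rewrite mem_orbit // inE => /esym/eqP.
Qed.

Lemma code_exists u : u \in Q -> exists2 b, flip_code b & forall p, p < 14 -> u (Pt p) = Pt (flip b p).
Proof.
move=> uQ; pose b := [seq u (Pt i) != Pt i | i <- iota 0 7].
have uA := subsetP QA u uQ.
have low i : i < 7 -> u (Pt i) = Pt (flip b i).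
  move=> i7; have : u (Pt i) \in mate_pair i.
    rewrite -[mate_pair i in X in _ \in X](block_fixed uQ i7) /= /setact.
    by apply/imsetP; exists (Pt i); rewrite // !inE eqxx.
  rewrite /flip modn_small // (nth_map 0) ?size_iota // nth_iota // add0n /mate_index i7.
  by rewrite !inE; case: eqVneq => [->|] //= _ /eqP.
have uP p : p < 14 -> u (Pt p) = Pt (flip b p).
  move=> pp; case: (ltnP p 7) => p7; first exact: low.
  have q7 : p - 7 < 7 by move: pp p7; clear; lia.
  have pE : p = mate_index (p - 7) by rewrite /mate_index q7 subnK.
  have q14 : p - 7 < 14 by move: q7; clear; lia.
  rewrite [in LHS]pE -(mate_Pt srg sA sx xa) // (aut_mate srg uA) ?(x_Pt srg sA sx xa) // Qx //.
  rewrite low // (mate_Pt srg sA sx xa) ?flip_lt //; congr (nbr_label _ _ _ _ _).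
  rewrite /flip; have -> : (p - 7) %% 7 = p %% 7 by move: pp p7; clear; lia.
  by case: ifP => _ //; rewrite -pE.
by exists b => //; split; [rewrite size_map size_iota | exists u].
Qed.

Lemma fixing_group_trivial : Q :=: 1%g.
Proof.
apply/trivgP/subsetP=> u uQ; rewrite inE; apply/eqP.
have [b /code_trivial bE uP] := code_exists uQ.
apply: (@aut_fix_nbhd _ _ srg _ x (subsetP QA u uQ) (Qx uQ)) => w xw.
have [p pp ->] := ptP srg sA o7 sx xa sa xw; by rewrite uP // bE /flip nth_nseq if_same.
Qed.

End FixedPointGroup.

(** * An invariant subgroup of order 8 *)

Lemma orbit_order7 (aT : finGroupType) (s : aT) (U : finType) (to : {action aT &-> U})
    (X : {set U}) y : #[s]%g = 7 -> #|X| = 7 -> [acts <[s]>, on X | to]%g -> y \in X ->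
  to y s != y -> orbit to <[s]>%g y = X.
Proof.
move=> o7 X7 sX yX sy; apply/eqP; rewrite eqEcard acts_sub_orbit // yX X7.
have : #|orbit to <[s]>%g y| %| 7 by rewrite -o7 orderE dvdn_orbit.
rewrite dvdn_divisors // !inE => /orP[]/eqP E; last by rewrite E.
have /setP/(_ (to y s)) := card_orbit1 E.
by rewrite mem_orbit ?cycle_id // inE (negPf sy).
Qed.

Lemma card_orbit_norm (aT : finGroupType) (U : finType) (to : {action aT &-> U})
    (H : {group aT}) g y : (g \in 'N(H))%g -> #|orbit to H (to y g)| = #|orbit to H y|.
Proof.
move=> gN; rewrite !card_orbit -!divgS ?subsetIl //; congr (_ %/ _).
by rewrite -(cardJg ('C_H[y | to])%g g) conjIg (normP gN) -astab1_act.
Qed.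

Lemma nfix_conj (T : finType) (u g : {perm T}) : nfix (u ^ g)%g = nfix u.
Proof.
rewrite /nfix -(card_imset (mem [set z | u z == z]) (@perm_inj _ g)); apply: eq_card => z.
rewrite -[z](permKV g) mem_imset ?inE; last exact: perm_inj.
by rewrite permJ (inj_eq perm_inj).
Qed.

Lemma sum_stab (T : finType) (H : {group {perm T}}) :
  \sum_(u in H) nfix u = \sum_y #|('C_H[y | 'P])%g|.
Proof.
transitivity (\sum_(u in H) \sum_y (u y == y)).
  apply: eq_bigr => u _; rewrite /nfix -sum1_card big_mkcond; apply: eq_bigr => y _.
  by rewrite inE; case: (u y == y).
rewrite exchange_big; apply: eq_bigr => y _; rewrite -sum1_card [RHS]big_mkcond [LHS]big_mkcond.
apply: eq_bigr => u _; rewrite inE; case: (u \in H) => //=.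
by rewrite !inE /= sub1set inE /= apermE; case: (u y == y).
Qed.

Section OrderEight.
Variables (T : finType) (e : rel T).
Hypothesis srg : strongly_regular e 99 14 1 2.
Local Notation Aut := (graph_aut e).
Local Notation N := (nbhd e).
Variables (s : {perm T}) (x a : T).
Hypotheses (sA : s \in Aut) (o7 : #[s]%g = 7) (sx : s x = x) (xa : e x a) (sa : s a != a).
Hypothesis sfix : forall z, s z = z -> z = x.

Lemma stable_acts (X : {set T}) : (forall z, z \in X -> s z \in X) -> [acts <[s]>, on X | 'P]%g.
Proof.
move=> H; rewrite cycle_subG !inE /=; apply/subsetP=> z zX; rewrite inE /=.
exact: H.
Qed.

Lemma pgroup7 : (7.-group <[s]>)%g.
Proof. by rewrite /pgroup -orderE o7 pnat_id. Qed.

Lemma dvd7_stable (X : {set T}) : (forall z, z \in X -> s z \in X) -> x \notin X -> 7 %| #|X|.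
Proof.
move=> H xX; have := pgroup_fix_mod pgroup7 (stable_acts H).
have -> : ('Fix_(X | 'P)(<[s]>) = set0)%g.
  apply/setP=> z; rewrite !inE; apply: contraNF xX => /andP[zX].
  by move/subsetP/(_ s (cycle_id s)); rewrite inE /= apermE => /eqP/sfix <-.
by rewrite cards0 => /eqP.
Qed.

Lemma stab_trivial (P : {group {perm T}}) : P \subset Aut -> s \in ('N(P))%g ->
  ('C_P[s] = 1)%g -> coprime #|P| 7 -> ('C_P[x | 'P] = 1)%g.
Proof.
move=> PA sP cP P7; have QP : ('C_P[x | 'P] \subset P)%g by exact: subsetIl.
have Qx u : u \in ('C_P[x | 'P])%g -> u x = x by rewrite inE => /andP[_] /astab1P.
apply: (fixing_group_trivial srg sA o7 sx xa sa (Q := [group of ('C_P[x | 'P])%g])) => //=.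
- exact: subset_trans PA.
- rewrite inE; apply/subsetP=> _ /imsetP[u uQ ->]; rewrite inE memJ_norm ?(subsetP QP) //=.
  by apply/astab1P; rewrite /= apermE -{1}sx permJ Qx.
- by apply/trivgP; rewrite -cP setSI.
by apply: coprime_dvdl P7; apply: cardSg.
Qed.

Variable M : {group {perm T}}.
Hypotheses (MA : M \subset Aut) (sM : s \in ('N(M))%g) (cM : ('C_M[s] = 1)%g) (M8 : #|M| = 8).

Lemma stab_x1 : ('C_M[x | 'P] = 1)%g. Proof. by apply: stab_trivial; rewrite // M8. Qed.

Lemma card_orbit8 : #|orbit 'P M x|%g = 8.
Proof. by rewrite card_orbit -divgS ?subsetIl //= stab_x1 cards1 M8. Qed.

(** Conjugation by [s] permutes the seven nontrivial elements of [M] transitively. *)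
Lemma nfix_const u v : u \in M -> v \in M -> u != 1%g -> v != 1%g -> nfix u = nfix v.
Proof.
move=> uM vM u1 v1; have o7' : orbit 'J <[s]>%g u = (M^#)%g.
  apply: orbit_order7 => //.
  - by have := cardsD1 1%g M; rewrite group1 M8 => -[].
  - by rewrite astabsJ normD1 cycle_subG.
  - by rewrite !inE u1.
  apply: contraNneq u1 => us; have : u \in ('C_M[s])%g.
    by rewrite inE uM; apply/cent1P/commgP/conjg_fixP.
  by rewrite cM => /set1P->.
have : v \in orbit 'J <[s]>%g u by rewrite o7' !inE v1.
by case/orbitP=> g _ <-; rewrite /= nfix_conj.
Qed.

Let Phi := ('Fix_('P)(M))%g.

Lemma PhiP z : reflect (forall u, u \in M -> u z = z) (z \in Phi).
Proof.
rewrite inE /=; apply: (iffP subsetP) => [H u /H|H u uM]; rewrite inE /= apermE; first by move/eqP.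
by rewrite H.
Qed.

Let W := [set z | #|orbit 'P M z|%g == 2].

Lemma sPhi z : z \in Phi -> s z \in Phi.
Proof.
move/PhiP=> H; apply/PhiP=> u uM; have uM' : (u ^ s^-1)%g \in M by rewrite memJ_norm ?groupV.
by rewrite -[u in LHS](conjgKV s) permJ H.
Qed.

Lemma sW z : z \in W -> s z \in W.
Proof. by rewrite !inE => /eqP <-; rewrite -(card_orbit_norm 'P%act z sM) /= apermE. Qed.

Lemma card_stab z : #|orbit 'P%act M z| * #|('C_M[z | 'P])%g| = 8.
Proof. by rewrite card_orbit_stab M8. Qed.

Lemma orbit_Phi z : z \in Phi -> #|orbit 'P M z|%g = 1.
Proof.
move/PhiP=> H; rewrite (_ : orbit _ _ _ = [set z]) ?cards1 //.
apply/setP=> y; rewrite inE; apply/orbitP/eqP => [[u uM <-]|->]; first by rewrite /= apermE H.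
by exists 1%g; rewrite ?group1 // act1.
Qed.

Lemma Phi_orbit z : #|orbit 'P M z|%g = 1 -> z \in Phi.
Proof.
move/card_orbit1/setP=> H; apply/PhiP=> u uM.
by have := H (u z); rewrite -[u z]apermE mem_orbit // inE => /esym/eqP; rewrite /= apermE.
Qed.

Lemma x_Phi : x \notin Phi.
Proof. by apply/negP=> /orbit_Phi; rewrite card_orbit8. Qed.

Lemma x_W : x \notin W. Proof. by rewrite inE card_orbit8. Qed.

Lemma pgroup2 : (2.-group M)%g. Proof. by rewrite /pgroup M8. Qed.

Lemma dvd2_W : 2 %| #|W|.
Proof.
have WM : [acts M, on W | 'P]%g.
  apply/actsP=> u uM z; rewrite !inE card_orbit_norm //.
  exact: subsetP (normG M) u uM.
have := pgroup_fix_mod pgroup2 WM; have -> : ('Fix_(W | 'P)(M) = set0)%g.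
  by apply/setP=> z; rewrite in_setI in_set0; apply/negP=> /andP[zW /orbit_Phi]; move: zW; rewrite inE => /eqP->.
by rewrite cards0 => /eqP.
Qed.

Lemma odd_Phi : odd #|Phi|.
Proof.
have TM : [acts M, on [set: T] | 'P]%g by apply/actsP=> u _ z; rewrite !inE.
have := pgroup_fix_mod pgroup2 TM; rewrite cardsT (srg_card srg) setTI => /eqP; rewrite !modn2 -/Phi.
by case: (odd #|Phi|).
Qed.

Lemma exists_M1 : exists2 u, u \in M & u != 1%g.
Proof.
have : (M :!=: 1)%g by rewrite -cardG_gt1 M8.
by case/trivgPn=> u uM u1; exists u.
Qed.

(** Burnside's count 99 + 7 n = 0 mod 8 gives n = 3 mod 8. The orbit of [x] is moved by [u], so n <=
    91, and [nfix_gap] leaves 3 or 11. The common fixed set is odd, a multiple of 7 and at most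
    n. *)
Lemma nfix_eq11 u : u \in M -> u != 1%g -> nfix u = 11 /\ #|Phi| = 7.
Proof.
move=> uM u1; have uA := subsetP MA u uM.
have F91 : nfix u <= 91.
  have sub : orbit 'P%act M x \subset ~: [set z | u z == z].
    apply/subsetP=> _ /orbitP[m mM <-]; rewrite !inE /= apermE; apply: contra u1 => /eqP um.
    have : (m * u * m^-1)%g \in ('C_M[x | 'P])%g.
      apply/setIP; split; first by rewrite !groupM ?groupV.
      by apply/astab1P; rewrite /= apermE !permM um permK.
    by rewrite stab_x1 => /set1P/(canRL (mulgKV m)); rewrite mul1g -{2}[m]mulg1 => /mulgI->.
  have := subset_leq_card sub; rewrite card_orbit8 => H.
  have := cardsC [set z | u z == z]; rewrite (srg_card srg) -/(nfix u); move: H.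
  by move: #|~: _| (nfix u) => c n; clear; lia.
have TM : [acts M, on [set: T] | 'P]%g by apply/actsP=> v _ z; rewrite !inE.
have := Frobenius_Cauchy TM; rewrite M8.
have -> : \sum_(v in M) #|('Fix_([set: T] | 'P)[v])%g| = 99 + 7 * nfix u.
  rewrite (bigD1 1%g) //=; congr (_ + _).
    by rewrite -(srg_card srg); apply: eq_card => z; rewrite !inE /= sub1set inE /= apermE perm1 eqxx.
  rewrite (eq_bigr (fun _ => nfix u)) => [|v /andP[vM v1]].
    rewrite sum_nat_const; congr (_ * _).
    have := cardsD1 1%g M; rewrite group1 M8 => -[E]; rewrite [RHS]E.
    by apply: eq_card => z; rewrite !inE andbC.
  rewrite (nfix_const uM vM u1 v1); apply: eq_card => z.
  by rewrite !inE /= sub1set inE /= apermE.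
have Phi7 := dvd7_stable sPhi x_Phi.
have PhiF : #|Phi| <= nfix u.
  by apply/subset_leq_card/subsetP=> z /PhiP H; rewrite inE H.
have := nfix_gap srg uA; rewrite -/(nfix u); move: odd_Phi Phi7 PhiF F91.
move: #|Phi| => p; move: (nfix u) => n; move: #|_| => k; clear; rewrite -[odd p]negbK -dvdn2; lia.
Qed.

Lemma no_orbit2 z : z \notin W.
Proof.
have [u uM u1] := exists_M1; have [F P7] := nfix_eq11 uM u1.
suff : #|W| = 0 by move/eqP; rewrite cards_eq0 => /eqP->; rewrite inE.
have W7 := dvd7_stable sW x_W.
(* Otherwise W has at least 14 points, with stabilizers of order 4, and the sum of the orders of the
   stabilizers exceeds 99 + 7 * 11. *)
suff : 99 + 7 * #|Phi| + 3 * #|W| <= 99 + 77.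
  by rewrite P7; move: W7 dvd2_W; move: #|W| => w; clear; lia.
apply: (leq_trans (n := \sum_y #|('C_M[y | 'P])%g|)).
  have -> : 99 + 7 * #|Phi| + 3 * #|W| = \sum_y (1 + 7 * (y \in Phi) + 3 * (y \in W)).
    have cardE (X : {set T}) c : c * #|X| = \sum_y c * (y \in X).
      rewrite -big_distrr /=; congr (_ * _); rewrite -sum1_card [LHS]big_mkcond.
      by apply: eq_bigr => y _; case: (y \in X).
    by rewrite (cardE Phi) (cardE W) -{1}(srg_card srg) -sum1_card -!big_split.
  apply: leq_sum => y _; have := card_stab y; case: (boolP (y \in Phi)) => [yP|_].
    by rewrite orbit_Phi // inE orbit_Phi // mul1n => ->.
  rewrite inE; case: eqP => [->|_]; first by move: #|_| => c; clear; lia.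
  by move=> _; rewrite cardG_gt0.
rewrite -sum_stab (bigD1 1%g) //= leq_add //.
  by rewrite /nfix -(srg_card srg) max_card.
rewrite (eq_bigr (fun _ => 11)) => [|v /andP[vM v1]]; last by case: (nfix_eq11 vM v1).
rewrite sum_nat_const -[77]/(7 * 11) leq_mul2r /=.
have := cardsD1 1%g M; rewrite group1 M8 => -[E]; rewrite [X in _ <= X]E.
by apply: subset_leq_card; apply/subsetP=> z'; rewrite !inE andbC.
Qed.

(** [M] permutes the at most two common neighbours of fixed vertices, and it has no orbit of length
    2. *)
Lemma common_Phi y z : y \in Phi -> z \in Phi -> y != z -> N y :&: N z \subset Phi.
Proof.
move=> /PhiP yP /PhiP zP yz; apply/subsetP=> w wI; apply: Phi_orbit.
have : #|orbit 'P M w|%g <= 2.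
  apply: leq_trans (common_le2 srg yz); apply/subset_leq_card/subsetP=> _ /orbitP[u uM <-].
  move: wI; rewrite !inE /= apermE => /andP[yw zw].
  by rewrite -{1}(yP u uM) -{1}(zP u uM) !(autE (subsetP MA u uM)) yw.
have := no_orbit2 w; rewrite inE; have := card_stab w.
by case: #|orbit _ _ _| => [|[|[|]]].
Qed.

Lemma no_order8 : False.
Proof.
have [u uM u1] := exists_M1; have [_ P7] := nfix_eq11 uM u1.
have /card_gt0P[z zP] : 0 < #|Phi| by rewrite P7.
pose d y := #|N y :&: Phi|.
have zs : orbit 'P%act <[s]>%g z = Phi.
  apply: orbit_order7 => //; first exact: stable_acts sPhi.
  by rewrite /= apermE; apply: contraNneq x_Phi => /sfix <-.
have ds y : d (s y) = d y.
  rewrite /d -(card_imset (mem (N y :&: Phi)) (@perm_inj _ s)); apply: eq_card => w.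
  rewrite -[w](permKV s) mem_imset ?in_setI; last exact: perm_inj.
  congr (_ && _); first by rewrite !inE (autE sA).
  apply/idP/idP; last exact: sPhi.
  move/PhiP=> H; apply/PhiP=> v vM; apply: (@perm_inj _ s); rewrite -permJ H //.
  by rewrite memJ_norm.
have dz y : y \in Phi -> d y = d z.
  rewrite -zs => /orbitP[_ /cycleP[k ->] <-]; rewrite /= apermE.
  by elim: k => [|k IH]; rewrite ?perm1 // expgSr permM ds.
have nE v w : (w \in N v) = e v w by rewrite inE.
(* Both sides count paths of length 2 from z in Phi: [d z ^ 2 = 12]. *)
have : d z * d z + (d z + 2) = 14 + d z.
  transitivity (\sum_(y in Phi) (#|N z :&: N y :&: Phi| + e z y + (y == z) * 2)).
    rewrite !big_split /= -addnA; congr (_ + (_ + _)).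
    - transitivity (\sum_(w in N z :&: Phi) d w).
        rewrite (eq_bigr (fun _ => d z)) => [|w /setIP[_ /dz]//].
        by rewrite sum_nat_const.
      transitivity (\sum_(w in N z :&: Phi) \sum_(y in Phi) e w y).
        apply: eq_bigr => w _; rewrite /d -sum1_card [LHS]big_mkcond [RHS]big_mkcond; apply: eq_bigr => y _.
        by rewrite !in_setI !nE; case: (e w y); case: (y \in Phi).
      rewrite exchange_big; apply: eq_bigr => y _; rewrite -sum1_card [RHS]big_mkcond [LHS]big_mkcond.
      by apply: eq_bigr => w _; rewrite !in_setI !nE [e w y](adjC srg); case: (e z w); case: (e y w); case: (w \in Phi).
    - rewrite /d -sum1_card [LHS]big_mkcond [RHS]big_mkcond; apply: eq_bigr => y _.
      by rewrite !in_setI !nE; case: (e z y); case: (y \in Phi).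
    by rewrite (bigD1 z) // eqxx big1 // => y /andP[_ /negPf->].
  transitivity (\sum_(y in Phi) (2 + d z * (y == z))).
    apply: eq_bigr => y yP; case: (eqVneq y z) => [->|yz].
      by rewrite setIid (adj_irr srg) addn0 muln1 addnC.
    have := common_nbrs srg z y; rewrite [z == y]eq_sym (negPf yz) !muln0 !addn0 => <-.
    by congr (_ + _); apply: eq_card => w; rewrite inE; apply: andb_idr;
      apply: (subsetP (common_Phi zP yP _)); rewrite eq_sym.
  rewrite big_split /= sum_nat_const P7 (bigD1 z) //= eqxx big1 => [|y /andP[_ /negPf->]].
    by rewrite addn0 muln1.
  by rewrite muln0.
move: (d z) => n; clear; case: (leqP n 3) => n3; nia.
Qed.

End OrderEight.

(** * The automorphism group *)

Section Order7Action.
Variables (gT : finGroupType) (s : gT).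
Hypothesis o7 : #[s]%g = 7.
Local Open Scope group_scope.

Lemma card_mod7 (P : {group gT}) : s \in 'N(P) -> 'C_P[s] = 1 -> #|P| %% 7 = 1%N.
Proof.
move=> sP cP; have pg : 7.-group <[s]> by rewrite /pgroup -orderE o7 pnat_id.
have PJ : [acts <[s]>, on P | 'J] by rewrite astabsJ cycle_subG.
have := pgroup_fix_mod pg PJ; rewrite afixJ cent_cycle cP cards1.
by move=> ->.
Qed.

Lemma card_mulG_le (A B : {group gT}) : #|A * B| <= #|A| * #|B|.
Proof. by rewrite mul_cardG leq_pmulr ?cardG_gt0. Qed.

Lemma ex_shift_relation (Z : {group gT}) : s \in 'N(Z) -> 'C_Z[s] = 1 -> 2.-abelem Z -> Z :!=: 1 ->
  exists u, [/\ u \in Z, u != 1 & u ^ (s ^+ 3) = u * u ^ s \/ u ^ (s ^+ 3) = u * u ^ (s ^+ 2)].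
Proof.
move=> sZ cZ /abelemP[//|abZ Z2] /trivgPn[v vZ v1].
have sq g : g \in Z -> g * g = 1 by move/Z2; rewrite expgS expg1.
have inv g : g \in Z -> g^-1 = g.
  by move=> gZ; apply/eqP; rewrite eq_invg_mul sq.
pose c k := v ^ (s ^+ k); have cZ' k : c k \in Z by rewrite memJ_norm ?groupX.
have cc i j : c i * c j = c j * c i by apply: (centsP abZ).
have sw g i j : g * c i * c j = g * c j * c i by rewrite -mulgA (cc i j) mulgA.
have c0 : c 0 = v by rewrite /c expg0 conjg1.
have cE k : v ^ (s ^+ k) = c k by [].
have cJ k l : c k ^ (s ^+ l) = c (k + l) by rewrite /c -conjgM -expgD.
have cS k : c k ^ s = c k.+1 by rewrite /c -conjgM -expgSr.
have c7 : c 7 = c 0 by rewrite /c -o7 expg_order expg0.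
clearbody c.
(* Over F_2, [X^7 - 1 = (X - 1) (X^3 + X + 1) (X^3 + X^2 + 1)]: either the second factor kills [v] or
   the third one kills the image of [v] under the second. *)
pose w := v * c 1%N * c 3; have wZ : w \in Z.
  exact: groupM (groupM vZ (cZ' 1%N)) (cZ' 3).
case: (eqVneq w 1) => [w1|w1].
  exists v; split=> //; left; rewrite cE -[v in v ^ s]c0 cS.
  by move/eqP: w1; rewrite -eq_invg_mul (inv _ (groupM vZ (cZ' 1%N))) => /eqP->.
exists w; split=> //; right.
(* The product of the seven conjugates is fixed by [s], hence trivial; this disposes of the factor X
   - 1. *)
have norm1 : c 0 * c 1%N * c 2 * c 3 * c 4 * c 5 * c 6 = 1.
  set g := LHS; suff : g \in 'C_Z[s] by rewrite cZ => /set1P.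
  rewrite inE; apply/andP; split; first by do !apply: groupM => //.
  apply/cent1P/commgP/conjg_fixP.
  rewrite /g !conjMg !cS c7.
  by rewrite (sw _ 6 0) (sw _ 5 0) (sw _ 4 0) (sw _ 3 0) (sw _ 2 0) (cc 1%N).
have : w * w ^ (s ^+ 2) * w ^ (s ^+ 3) = 1.
  rewrite -norm1 /w -c0 !conjMg !cJ !mulgA /= !add3n !add1n !add0n.
  rewrite (sw _ 3 2) -[_ * c 3 * c 3]mulgA sq // mulg1.
  by rewrite (sw _ 5 3) (sw _ 5 4).
have wZ2 : w ^ (s ^+ 2) \in Z by rewrite memJ_norm ?groupX.
by move/eqP; rewrite -eq_invg_mul (inv _ (groupM wZ wZ2)) => /eqP->.
Qed.

(** [ex_shift_relation] makes the span of u, u^s and u^(s^2) invariant under [s]. Its order is at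
    most 8, greater than 1 and equal to 1 mod 7. *)
Lemma ex_order8 (P : {group gT}) : s \in 'N(P) -> 'C_P[s] = 1 -> 2.-group P -> P :!=: 1 ->
  exists M : {group gT}, [/\ M \subset P, s \in 'N(M) & #|M| = 8].
Proof.
move=> sP cP pP P1; set Z := [group of 'Ohm_1('Z(P))].
have Zchar : Z \char P by apply: gFchar_trans (center_char P).
have sZ : s \in 'N(Z) := subsetP (char_norms Zchar) s sP.
have ZP : Z \subset P := char_sub Zchar.
have cent1 (H : {group gT}) : H \subset P -> 'C_H[s] = 1.
  by move=> HP; apply/trivgP; rewrite -cP setSI.
have Zab : 2.-abelem Z.
  by apply: Ohm1_abelem (center_abelian P); apply: pgroupS (center_sub P) pP.
have Z1 : Z :!=: 1 by rewrite Ohm1_eq1 center_nil_eq1 ?(pgroup_nil pP).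
have [u [uZ u1 u3]] := ex_shift_relation sZ (cent1 _ ZP) Zab Z1.
have [//|abZ Z2] := @abelemP _ 2 Z _ Zab.
pose u_ k := u ^ (s ^+ k); have uZ_ k : u_ k \in Z by rewrite memJ_norm ?groupX.
have card_u k : #|<[u_ k]>| <= 2.
  by apply: dvdn_leq => //; rewrite -orderE order_dvdn Z2.
have u0 : u_ 0 = u by rewrite /u_ expg0 conjg1.
have sub k : <[u_ k]> \subset Z by rewrite cycle_subG.
pose M := (<[u_ 0]> <*> <[u_ 1%N]> <*> <[u_ 2]>)%G.
have MZ : M \subset Z by rewrite !join_subG !sub.
have MP := subset_trans MZ ZP.
have uM k : k < 3 -> u_ k \in M.
  move=> k3; rewrite -cycle_subG; move: k k3 => [|[|[|k]]] // _.
  - exact: subset_trans (joing_subl _ _) (joing_subl _ _).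
  - exact: subset_trans (joing_subr _ _) (joing_subl _ _).
  exact: joing_subr.
have sM : s \in 'N(M).
  rewrite inE /= !conjYg -!cycleJ !join_subG !cycle_subG.
  have uJ k : u_ k ^ s = u_ k.+1 by rewrite /u_ -conjgM -expgSr.
  rewrite !uJ (uM 1%N) // (uM 2) //=.
  by case: u3 => E; rewrite {1}/u_ E groupM ?(uM 1%N) ?(uM 2) // -u0 uM.
have M8 : #|M| <= 8.
  have cents (A B : {set gT}) : A \subset Z -> B \subset Z -> B \subset 'C(A).
    by move=> AZ BZ; apply: subset_trans BZ (subset_trans abZ (centS AZ)).
  have s01 : <[u_ 0]> <*> <[u_ 1%N]> \subset Z by rewrite join_subG !sub.
  rewrite /M /= (cent_joinEr (cents _ _ s01 (sub 2))).
  apply: leq_trans (card_mulG_le _ _) _; rewrite -[8]/(4 * 2)%N; apply: leq_mul; last exact: card_u.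
  rewrite /=.
  rewrite (cent_joinEr (cents _ _ (sub 0) (sub 1%N))).
  apply: leq_trans (card_mulG_le _ _) _; rewrite -[4]/(2 * 2)%N; apply: leq_mul; exact: card_u.
exists M; split=> //; have := card_mod7 sM (cent1 _ MP).
have : (1 < #|M|)%N.
  by rewrite cardG_gt1; apply/trivgPn; exists u; rewrite // -u0 uM.
by move: M8; move: #|M| => m; clear; lia.
Qed.

End Order7Action.

(** The prime powers concerned are 8, 64, 29, 43 and 71. *)
Lemma prime_power_mod7 n p k : prime p -> n = p ^ k -> n <= 99 -> n %% 7 = 1 -> n != 1 ->
  p = 2 \/ (14 < p /\ 99 %% p != 0).
Proof.
move=> pp nE n99 n7 n1; have k0 : 0 < k.
  by rewrite lt0n; apply: contraNneq n1 => k0; rewrite nE k0 expn0.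
have pE : pdiv n = p by rewrite nE -(prednK k0) pdiv_pfactor.
have kE : logn p n = k by rewrite nE pfactorK.
pose Q n := [&& n %% 7 == 1, n != 1 & n == pdiv n ^ logn (pdiv n) n] ==>
  (pdiv n == 2) || (14 < pdiv n) && (99 %% pdiv n != 0).
have T1 : all Q (iota 0 100) by vm_compute.
have /implyP := all_iotaP T1 (n99 : n < 100).
rewrite pE kE -nE n7 n1 !eqxx => /(_ isT)/orP[/eqP|/andP[]]; by [left|right].
Qed.

Section Trivial.
Variables (T : finType) (e : rel T).
Hypothesis srg : strongly_regular e 99 14 1 2.
Local Notation Aut := (graph_aut e).
Local Notation N := (nbhd e).

Lemma large_pgroup_trivial p (P : {group {perm T}}) : prime p -> (p.-group P)%g -> P \subset Aut ->
  14 < p -> 99 %% p != 0 -> P :=: 1%g.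
Proof.
move=> pp pP PA p14 p99.
have TP : [acts P, on [set: T] | 'P]%g by apply/actsP=> u _ z; rewrite !inE.
have := pgroup_fix_mod pP TP; rewrite cardsT (srg_card srg) setTI => E.
have : 0 < #|('Fix_('P)(P))%g|.
  by rewrite lt0n; apply: contraNneq p99 => F0; move: E; rewrite F0 mod0n => ->.
case/card_gt0P=> y; rewrite inE /= => /subsetP yP.
have uy u : u \in P -> u y = y by move/yP; rewrite inE /= apermE => /eqP.
apply/trivgP/subsetP=> u uP; rewrite inE; apply/eqP.
apply: (@aut_fix_nbhd _ _ srg _ y (subsetP PA u uP) (uy u uP)) => z yz.
have sub : orbit 'P%act P z \subset N y.
  apply/subsetP=> _ /orbitP[v vP <-]; rewrite inE /= apermE -{1}(uy v vP).
  by rewrite (autE (subsetP PA v vP)).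
have := subset_leq_card sub; rewrite (srg_reg srg) => le14.
have /p_natP[k oE] : (p.-nat #|orbit 'P P z|)%g.
  exact: pnat_dvd (dvdn_orbit _ _ _) pP.
have k0 : k = 0.
  case: k oE => // k oE; move: le14; rewrite oE leqNgt expnS.
  by rewrite (leq_trans p14) // leq_pmulr // expn_gt0 prime_gt0.
have := card_orbit1 (etrans oE (congr1 (expn p) k0)).
move/setP/(_ (u z)); rewrite -[u z]apermE mem_orbit // inE => /esym/eqP.
by rewrite apermE.
Qed.

Lemma semiregular_pgroup_trivial p (s : {perm T}) (P : {group {perm T}}) :
  prime p -> (p.-group P)%g -> P \subset Aut -> s \in Aut -> #[s]%g = 7 ->
  s \in ('N(P))%g -> ('C_P[s] = 1)%g -> P :=: 1%g.
Proof.
move=> pp pP PA sA o7 sP cP; have [x [a [sx xa sa sfix]]] := order7_frame srg sA o7.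
have P7 := card_mod7 o7 sP cP.
have co7 : coprime #|P| 7 by rewrite -coprime_modl P7.
have Px := stab_trivial srg sA o7 sx xa sa PA sP cP co7.
have P99 : #|P| <= 99.
  rewrite -(srg_card srg) -(card_orbit_stab 'P P x) Px cards1 muln1; exact: max_card.
case: (eqVneq #|P| 1) => [/eqP|P1]; first by rewrite -trivg_card1 => /eqP.
have /p_natP[k kE] := pP.
case: (prime_power_mod7 pp kE P99 P7 P1) => [p2|[p14 p99]]; last exact: large_pgroup_trivial pP _ _ _.
rewrite p2 in pP; have [|M [MP sM M8]] := ex_order8 o7 sP cP pP.
  by rewrite trivg_card1.
have cM : ('C_M[s] = 1)%g by apply/trivgP; rewrite -cP setSI.
by have := no_order8 srg sA o7 sx xa sa sfix (subset_trans MP PA) sM cM M8.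
Qed.

End Trivial.

Theorem mainTheorem1 (T : finType) (e : rel T)
    (srg : strongly_regular e 99 14 1 2)
    (dvd7 : 7 %| #|graph_aut e|) :
  (graph_aut e \isog [set: 'Z_7])%g.
Proof.
have [s sA o7] := Cauchy (isT : prime 7) dvd7.
pose G := [group of graph_aut e]; pose S := <[s]>%G.
have S7 : #|S| = 7 by rewrite -o7.
suff E : graph_aut e = <[s]>%g.
  by rewrite E isog_sym; have := Zp_isog s; rewrite o7.
have NS : ('N_G(S) = S)%g.
  apply/eqP; rewrite eqEsubset; apply/andP; split.
    by apply/subsetP=> g /setIP[gA gN]; apply: (self_normalizing srg sA o7).
  by rewrite subsetI cycle_subG sA normG.
apply/eqP/negPn/negP=> nE.
have cycS h : h \in (S^#)%g -> (<[h]> = S)%g.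
  rewrite !inE => /andP[h1 hS]; apply/eqP; rewrite eqEcard cycle_subG hS S7.
  have := order_dvdG hS; rewrite S7 dvdn_divisors // !inE order_eq1 (negPf h1).
  by move/eqP; rewrite /order => ->.
have frob : [Frobenius G with complement S]%g.
  apply/andP; split; first by rewrite eq_sym.
  apply/normedTI_P; split.
  - by apply/set0Pn; exists s; rewrite !inE -order_eq1 o7 cycle_id.
  - by rewrite subsetI cycle_subG sA normD1 normG.
  (* A conjugate of S sharing a nontrivial element with S equals S, because any such element
     generates both; so g normalizes S. *)
  move=> g gG; rewrite -setI_eq0 => /set0Pn[h /setIP[hS /imsetP[k kS hE]]].
  rewrite -NS inE gG; apply/normP.
  by rewrite -{1}(cycS k kS) -cycleJ -hE cycS.
have [K frobK] := vcharacter.Frobenius_kernel_exists frob.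
have [defG ntK _ _ _] := Frobenius_context frobK.
have [/= _ defKS nKS tiKS] := sdprodP defG.
have KA : K \subset graph_aut e by have [] := mulG_sub defKS.
have sS1 : s \in (S^#)%g by rewrite !inE -order_eq1 o7 cycle_id.
have p_pr : prime (pdiv #|K|) by rewrite pdiv_prime // cardG_gt1.
(* The coprime action of S on the kernel yields an invariant Sylow subgroup for a prime dividing
   |K|, which must be nontrivial. *)
have [P sylP nPS] := sol_coprime_Sylow_exists (pdiv #|K|)
  (abelian_sol (cycle_abelian s)) nKS (Frobenius_coprime frobK).
have cP : ('C_P[s] = 1)%g.
  apply/trivgP; rewrite -(Frobenius_reg_ker frobK sS1) setSI //; exact: pHall_sub sylP.
have P1 := semiregular_pgroup_trivial srg p_pr (pHall_pgroup sylP)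
  (subset_trans (pHall_sub sylP) KA) sA o7 (subsetP nPS s (cycle_id s)) cP.
have := card_Hall sylP; rewrite P1 cards1 => /esym/eqP.
by rewrite p_part_eq1 mem_primes p_pr cardG_gt0 pdiv_dvd.
Qed.
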